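(* Let $X$ be a Banach space, $1\le p<\infty$, let $(A,D(A))$ be the generator of a strongly continuous semigroup $(S(t))_{t\ge0}$ on $X$, and let $\Phi:W^{1,p}([-1,0],X)\to X$ be a bounded linear operator. Assume that there exists $q:\mathbb{R}_+\to\mathbb{R}_+$ with $\lim_{t\to0^+}q(t)=0$ and $$\int_0^t\|\Phi(S_sx+T_0(s)f)\|\,ds\le q(t)\left\|\begin{pmatrix}x\\ f\end{pmatrix}\right\|$$ for all $t>0$ and all $(x,f)\in D(A)\times W^{1,p}([-1,0],X)$ with $f(0)=x$. Let $(\mathcal{T}(t))_{t\ge0}$ be the strongly continuous semigroup on $\mathcal{E}:=X\times L^p([-1,0],X)$ generated by $$\mathcal{A}\begin{pmatrix}x\\ f\end{pmatrix}=\begin{pmatrix}Ax+\Phi f\\ f'\end{pmatrix},\qquad D(\mathcal{A})=\left\{\begin{pmatrix}x\\ f\end{pmatrix}\in D(A)\times W^{1,p}([-1,0],X)\ :\ f(0)=x\right\}.$$ If $(S(t))_{t\ge0}$ is immediately norm continuous, then $(\mathcal{T}(t))_{t\ge0}$ is norm continuous for $t\ge1$, i.e. the map $[1,\infty)\ni t\mapsto\mathcal{T}(t)\in\mathcal{L}(\mathcal{E})$ is continuous in the operator norm.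
   Context: A strongly continuous semigroup $(S(t))_{t\ge0}$ on $X$ is immediately norm continuous if $t\mapsto S(t)$ is continuous from $(0,\infty)$ to $\mathcal{L}(X)$ in operator norm. The norm on $\mathcal{E}$ is $\|x\|+\|f\|_p$; elements of $W^{1,p}([-1,0],X)$ are identified with their continuous representatives. $(T_0(t))_{t\ge0}$ is the nilpotent left shift semigroup on $L^p([-1,0],X)$: $(T_0(t)f)(\tau)=f(t+\tau)$ if $t+\tau\le0$ and $0$ otherwise. For $t\ge0$, $S_t:X\to L^p([-1,0],X)$ is defined by $(S_tx)(\tau)=S(t+\tau)x$ if $-t<\tau\le0$ and $(S_tx)(\tau)=0$ if $-1\le\tau\le-t$. Under the stated integral condition, $(\mathcal{A},D(\mathcal{A}))$ generates a strongly continuous semigroup on $\mathcal{E}$ (by the Miyadera–Voigt perturbation theorem). *)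

(* Defs.v *)
From HB Require Import structures.
From mathcomp Require Import all_boot all_order all_algebra generic_quotient ring_quotient.
From mathcomp Require Import all_classical all_reals all_analysis measurable_realfun.

Set Implicit Arguments.
Unset Strict Implicit.
Unset Printing Implicit Defensive.

Import Order.TTheory GRing.Theory Num.Theory.
Import numFieldNormedType.Exports.

Local Open Scope classical_set_scope.
Local Open Scope ring_scope.
Local Open Scope quotient_scope.

Section StronglyMeasurable.
Context d (T : measurableType d) (R : realType) (X : normedModType R).
Implicit Types f g s : T -> X.

Definition simple s :=
  finite_set (range s) /\ forall y, measurable (s @^-1` [set y]).

(* The limit is required at every point, and not only almost everywhere, since
   the sigma-algebra on T need not be complete; a function that is a limit of
   simple functions only almost everywhere differs from such a pointwise limit
   on a null set, so the classes modulo equality almost everywhere are the same. *)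
Definition strongly_measurable f :=
  exists2 s : (T -> X)^nat, forall n, simple (s n) &
    forall x, s n x @[n --> \oo] --> f x.

Lemma finite_range_preimage s (B : set X) : simple s ->
  measurable (s @^-1` B).
Proof.
move=> [fs ms].
have -> : s @^-1` B = \bigcup_(y in range s `&` B) s @^-1` [set y].
  apply/seteqP; split=> [x Bx|x [y [_ By] /= ->]//].
  by exists (s x) => //; split => //; exists x.
by apply: fin_bigcup_measurable => //; exact: finite_setIl.
Qed.

Lemma simple_cst (y : X) : simple (fun=> y).
Proof.
split=> [|z].
  by apply: (@sub_finite_set _ _ [set y]); [move=> _ [? _ <-]|exact: finite_set1].
by rewrite preimage_cst; case: ifP.
Qed.

Lemma simple_lin (a : R) s t : simple s -> simple t ->
  simple (fun x => a *: s x + t x).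
Proof.
move=> ss st; split=> [|z].
  apply: (@sub_finite_set _ _ [set a *: u + v | u in range s & v in range t]).
    by move=> _ [x _ <-]; exists (s x); [exists x|exists (t x); [exists x|]].
  by apply: finite_image2; [case: ss|case: st].
rewrite (_ : _ @^-1` _ = \bigcup_(y in range s)
    ((s @^-1` [set y]) `&` (t @^-1` [set z - a *: y]))).
  apply: fin_bigcup_measurable; first by case: ss.
  by move=> y _; apply: measurableI; exact: finite_range_preimage.
apply/seteqP; split=> [x /= <-|x [_ _ [/= <- ->]]]; last by rewrite addrC subrK.
by exists (s x); [exists x|split => //=; rewrite addrAC subrr add0r].
Qed.

Lemma strongly_measurable0 : strongly_measurable (0 : T -> X).
Proof.
by exists (fun=> 0) => [n|x]; [exact: simple_cst|exact: cvg_cst].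
Qed.

Lemma strongly_measurable_lin (a : R) f g :
  strongly_measurable f -> strongly_measurable g ->
  strongly_measurable (a *: f + g).
Proof.
move=> [s ss sf] [t st tg]; exists (fun n x => a *: s n x + t n x) => [n|x].
  exact: simple_lin.
by apply: cvgD; [apply: cvgZl_tmp; exact: sf|exact: tg].
Qed.

Lemma strongly_measurable_norm f : strongly_measurable f ->
  measurable_fun setT (fun x => `|f x|).
Proof.
move=> [s ss sf]; apply: (@measurable_fun_cvg _ _ _ _ (fun n x => `|s n x|)).
  move=> n _ B mB; rewrite setTI.
  by rewrite (_ : _ @^-1` _ = s n @^-1` ((fun y => `|y|) @^-1` B))//; exact: finite_range_preimage.
by move=> x _; apply: cvg_norm; exact: sf.
Qed.

End StronglyMeasurable.

Section BochnerIntegral.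
Context d (T : measurableType d) (R : realType) (X : normedModType R).
Variable mu : {measure set T -> \bar R}.

Definition simple_integral (s : T -> X) : X :=
  \sum_(y \in range s `\ 0) fine (mu (s @^-1` [set y])) *: y.

Definition is_bochner_integral (f : T -> X) (I : X) :=
  exists s : (T -> X)^nat,
    [/\ forall n, simple (s n) /\
          (forall y, y != 0 -> (mu (s n @^-1` [set y]) < +oo)%E),
        forall x, s n x @[n --> \oo] --> f x,
        (\int[mu]_x `|s n x - f x|%:E)%E @[n --> \oo] --> 0%E &
        simple_integral (s n) @[n --> \oo] --> I].

End BochnerIntegral.

Section BochnerLp.
Context d (T : measurableType d) (R : realType) (mu : {measure set T -> \bar R}).
Context (p : R) (p1 : 1 <= p) (X : normedModType R).
Implicit Types f g : T -> X.

Definition norm_fun f : T -> R := fun x => `|f x|.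

Definition bLfun of 1 <= p : {pred T -> X} :=
  mem [set f | strongly_measurable f /\ finite_norm mu p%:E (norm_fun f)].

Lemma bLfunP f : reflect
  (strongly_measurable f /\ finite_norm mu p%:E (norm_fun f)) (f \in bLfun p1).
Proof. exact: asboolP. Qed.

Let p_gt0 : 0 < p. Proof. exact: lt_le_trans p1. Qed.

Let LnormE (h : T -> R) :
  ('N[mu]_p%:E[EFin \o h] = (\int[mu]_x (`|h x| `^ p)%:E) `^ p^-1)%E.
Proof. by rewrite unlock. Qed.

Lemma Lnorm_norm_funZ (a : R) f : strongly_measurable f ->
  ('N[mu]_p%:E[EFin \o norm_fun (a *: f)%R] =
   `|a|%:E * 'N[mu]_p%:E[EFin \o norm_fun f])%E.
Proof.
move=> /strongly_measurable_norm mf; rewrite !LnormE.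
under eq_integral.
  move=> x _.
  have -> : norm_fun (a *: f) x = `|a| * norm_fun f x by exact: normrZ.
  rewrite normrM normr_id powRM// EFinM; over.
rewrite ge0_integralZl//; last first.
- apply/measurable_EFinP; apply: (measurableT_comp (measurable_powR p)).
  exact: measurableT_comp mf.
rewrite poweRM ?lee_fin ?powR_ge0//; last first.
  by apply: integral_ge0 => x _; rewrite lee_fin powR_ge0.
by rewrite poweR_EFin -powRrM mulfV ?gt_eqF// powRr1.
Qed.

Lemma Lnorm_norm_funD f g : strongly_measurable f -> strongly_measurable g ->
  ('N[mu]_p%:E[EFin \o norm_fun (f + g)%R] <=
   'N[mu]_p%:E[EFin \o norm_fun f] + 'N[mu]_p%:E[EFin \o norm_fun g])%E.
Proof.
move=> mf mg.
have /strongly_measurable_norm mfg : strongly_measurable (f + g).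
  by rewrite -[f]scale1r; exact: strongly_measurable_lin.
move: mf mg => /strongly_measurable_norm mf /strongly_measurable_norm mg.
apply: le_trans (minkowski_EFin _ mf mg p1).
rewrite !LnormE; apply: gt0_ler_poweR.
- by rewrite invr_ge0 ltW.
- rewrite in_itv/= leey andbT.
  by apply: integral_ge0 => x _; rewrite lee_fin powR_ge0.
- rewrite in_itv/= leey andbT.
  by apply: integral_ge0 => x _; rewrite lee_fin powR_ge0.
apply: ge0_le_integral => //.
- apply/measurable_EFinP; apply: (measurableT_comp (measurable_powR p)).
  exact: measurableT_comp mfg.
- apply/measurable_EFinP; apply: (measurableT_comp (measurable_powR p)).
  by apply: measurableT_comp => //; exact: measurable_funD.
move=> x _; rewrite lee_fin ge0_ler_powR ?nnegrE ?(ltW p_gt0)//.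
rewrite /norm_fun /= normr_id [leRHS]ger0_norm ?addr_ge0//.
exact: ler_normD.
Qed.

Lemma bLfun_submod_closed : submod_closed (bLfun p1).
Proof.
split=> [|a f g /bLfunP[mf ff] /bLfunP[mg fg]]; apply/bLfunP; split.
- exact: strongly_measurable0.
- rewrite /finite_norm (_ : _ \o _ = cst 0%E) ?Lnorm0 ?eqe ?gt_eqF//.
  by apply/funext => x; rewrite /= /norm_fun normr0.
- exact: strongly_measurable_lin.
- have maf : strongly_measurable (a *: f).
    rewrite -[_ *: f]addr0; apply: strongly_measurable_lin => //.
    exact: strongly_measurable0.
  apply: le_lt_trans (Lnorm_norm_funD maf mg) _.
  rewrite Lnorm_norm_funZ// lte_add_pinfty//.
  by rewrite lte_mul_pinfty// ?lee_fin.
Qed.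

HB.instance Definition _ :=
  GRing.isSubmodClosed.Build _ _ (bLfun p1) bLfun_submod_closed.

Record bLfunType := BLfun { blfun :> T -> X ; blfun_subproof : blfun \in bLfun p1 }.
HB.instance Definition _ := [isSub for blfun].
HB.instance Definition _ := [Choice of bLfunType by <:].
HB.instance Definition _ := [SubChoice_isSubLmodule of bLfunType by <:].
Implicit Types u v : bLfunType.

Definition ae_null : {pred bLfunType} :=
  mem [set u : bLfunType | \forall x \ae mu, u x = 0].

Lemma ae_nullP u : reflect (\forall x \ae mu, u x = 0) (u \in ae_null).
Proof. exact: asboolP. Qed.

Let linE a u v x : (a *: u + v) x = a *: u x + v x. Proof. by []. Qed.

Lemma ae_null_submod_closed : submod_closed ae_null.
Proof.
split=> [|a u v /ae_nullP u0 /ae_nullP v0]; apply/ae_nullP; first exact: aeW.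
apply: filterS2 u0 v0 => x u0 v0.
by rewrite linE u0 v0 scaler0 addr0.
Qed.

HB.instance Definition _ :=
  GRing.isSubmodClosed.Build _ _ ae_null ae_null_submod_closed.

Definition bochnerLp : Type := Quotient.quot ae_null.
HB.instance Definition _ := GRing.Zmodule.on bochnerLp.
HB.instance Definition _ := EqQuotient.on bochnerLp.
Implicit Types F G : bochnerLp.

Definition bochnerLp_fun F : T -> X := blfun (repr F).
Coercion bochnerLp_fun : bochnerLp >-> Funclass.

Definition bochnerLp_class u : bochnerLp := \pi u.

Lemma bochnerLp_classP u v :
  bochnerLp_class u = bochnerLp_class v <-> \forall x \ae mu, u x = v x.
Proof.
split=> [/eqP|uv].
- rewrite -Quotient.idealrBE => /ae_nullP; apply: filterS => x.
  by move=> /eqP; rewrite subr_eq0 => /eqP.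
- apply/eqP; rewrite -Quotient.idealrBE; apply/ae_nullP.
  apply: filterS uv => x uv.
  by have -> : (u - v) x = u x - v x by []; rewrite uv subrr.
Qed.

Lemma bochnerLp_reprK F : bochnerLp_class (repr F) = F.
Proof. exact: reprK. Qed.

Lemma bochnerLp_classK u : \forall x \ae mu, bochnerLp_class u x = u x.
Proof. by apply/bochnerLp_classP; rewrite bochnerLp_reprK. Qed.

Lemma bochnerLp_classD u v :
  bochnerLp_class (u + v) = bochnerLp_class u + bochnerLp_class v.
Proof. exact: pi_addr. Qed.

Definition bochnerLp_scale a F := bochnerLp_class (a *: repr F).

Lemma bochnerLp_classZ a u :
  bochnerLp_scale a (bochnerLp_class u) = bochnerLp_class (a *: u).
Proof.
apply/bochnerLp_classP; apply: filterS (bochnerLp_classK u) => x.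
have E (w : bLfunType) : (a *: w) x = a *: w x by [].
by rewrite !E => <-.
Qed.

Lemma bochnerLp_scalerA a b F :
  bochnerLp_scale a (bochnerLp_scale b F) = bochnerLp_scale (a * b) F.
Proof. by rewrite -[F]bochnerLp_reprK !bochnerLp_classZ scalerA. Qed.

Lemma bochnerLp_scale1r : left_id 1 bochnerLp_scale.
Proof.
by move=> F; rewrite -[F]bochnerLp_reprK bochnerLp_classZ scale1r.
Qed.

Lemma bochnerLp_scalerDr : right_distributive bochnerLp_scale +%R.
Proof.
move=> a F G; rewrite -[F]bochnerLp_reprK -[G]bochnerLp_reprK.
by rewrite -bochnerLp_classD !bochnerLp_classZ scalerDr bochnerLp_classD.
Qed.

Lemma bochnerLp_scalerDl F : {morph bochnerLp_scale^~ F : a b / a + b}.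
Proof.
move=> a b; rewrite -[F]bochnerLp_reprK.
by rewrite !bochnerLp_classZ scalerDl bochnerLp_classD.
Qed.

HB.instance Definition _ := GRing.Zmodule_isLmodule.Build R bochnerLp
  bochnerLp_scalerA bochnerLp_scale1r bochnerLp_scalerDr bochnerLp_scalerDl.

Definition bochnerLp_norm F : R := fine 'N[mu]_p%:E[EFin \o norm_fun F].

Let nrm u : R := fine 'N[mu]_p%:E[EFin \o norm_fun u].

Let nrmE u : (nrm u)%:E = 'N[mu]_p%:E[EFin \o norm_fun u]%E.
Proof.
rewrite fineK// ge0_fin_numE ?Lnorm_ge0//.
by have /bLfunP[] := blfun_subproof u.
Qed.

Let sm u : strongly_measurable u.
Proof. by have /bLfunP[] := blfun_subproof u. Qed.

Let bochnerLp_norm_class u : bochnerLp_norm (bochnerLp_class u) = nrm u.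
Proof.
congr fine; rewrite !LnormE; congr (_ `^ _)%E; apply: ae_eq_integral => //.
- apply/measurable_EFinP; apply: (measurableT_comp (measurable_powR p)).
  by apply: measurableT_comp => //; exact/strongly_measurable_norm/sm.
- apply/measurable_EFinP; apply: (measurableT_comp (measurable_powR p)).
  by apply: measurableT_comp => //; exact/strongly_measurable_norm/sm.
by apply: filterS (bochnerLp_classK u) => x E _; rewrite /norm_fun E.
Qed.

Let bochnerLp_normD F G :
  bochnerLp_norm (F + G) <= bochnerLp_norm F + bochnerLp_norm G.
Proof.
rewrite -[F]bochnerLp_reprK -[G]bochnerLp_reprK -bochnerLp_classD.
rewrite !bochnerLp_norm_class -lee_fin EFinD !nrmE.
exact: Lnorm_norm_funD.
Qed.

Let bochnerLp_normZ a F : bochnerLp_norm (a *: F) = `|a| * bochnerLp_norm F.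
Proof.
rewrite -[F]bochnerLp_reprK [_ *: _]bochnerLp_classZ !bochnerLp_norm_class.
by apply: EFin_inj; rewrite EFinM !nrmE; exact: Lnorm_norm_funZ.
Qed.

Let bochnerLp_norm0_eq0 F : bochnerLp_norm F = 0 -> F = 0.
Proof.
rewrite -[F]bochnerLp_reprK bochnerLp_norm_class => F0.
have {}F0 : 'N[mu]_p%:E[EFin \o norm_fun (repr F)]%E = 0%E by rewrite -nrmE F0.
have -> : 0 = bochnerLp_class 0 by rewrite /bochnerLp_class pi_zeror.
apply/bochnerLp_classP.
have mF : measurable_fun setT (EFin \o norm_fun (repr F)).
  by apply/measurable_EFinP; exact/strongly_measurable_norm/sm.
have := Lnorm_eq0_eq0 mF _ F0; rewrite lte_fin => /(_ p_gt0).
by apply: filterS => x /(_ Logic.I) [] /normr0_eq0.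
Qed.

HB.instance Definition _ := Lmodule_isNormed.Build R bochnerLp
  bochnerLp_normD bochnerLp_normZ bochnerLp_norm0_eq0.

(* The class of f if f is strongly measurable with finite p-norm, and 0
   otherwise. *)
Definition toLp f : bochnerLp :=
  if pselect (f \in bLfun p1) is left fL then bochnerLp_class (BLfun fL) else 0.

End BochnerLp.

(* The product with the norm |x| + |y|; the library puts the max norm on the
   type V * W. *)
Definition l1prod (V W : Type) : Type := V * W.

Section L1prod.
Context (R : realType) (V W : normedModType R).
Implicit Types z : l1prod V W.

HB.instance Definition _ := GRing.Lmodule.on (l1prod V W).

Let norm z : R := `|z.1| + `|z.2|.

Let normD z1 z2 : norm (z1 + z2) <= norm z1 + norm z2.
Proof. by rewrite /norm addrACA lerD// ler_normD. Qed.

Let normZ a z : norm (a *: z) = `|a| * norm z.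
Proof. by rewrite /norm /= !normrZ mulrDr. Qed.

Let norm0_eq0 z : norm z = 0 -> z = 0.
Proof.
move=> /eqP; rewrite paddr_eq0// !normr_eq0 => /andP[/eqP z1 /eqP z2].
by rewrite [z]surjective_pairing z1 z2.
Qed.

HB.instance Definition _ :=
  Lmodule_isNormed.Build R (l1prod V W) normD normZ norm0_eq0.

End L1prod.

Section Semigroup.
Context (R : realType).

Record c0_semigroup (V : normedModType R) (T : R -> V -> V) : Prop := {
  c0_linear : forall t, 0 <= t -> linear (T t) ;
  c0_bounded : forall t, 0 <= t -> continuous (T t) ;
  c0_id : T 0 = id ;
  c0_add : forall s t, 0 <= s -> 0 <= t -> T (s + t) = T s \o T t ;
  c0_continuous : forall v, {within `[0, +oo[, continuous (fun t => T t v)}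
}.

Definition is_generator (V : normedModType R) (T : R -> V -> V)
    (D : set V) (A : V -> V) :=
  let quotient v := fun h : R => h^-1 *: (T h v - v) in
  (forall v, D v <-> cvg (quotient v @ 0^'+)) /\
  (forall v, D v -> quotient v @ 0^'+ --> A v).

(* Meaningful for bounded L only: [sup] is 0 on unbounded sets. *)
Definition opnorm (V W : normedModType R) (L : V -> W) : R :=
  sup [set `|L v| | v in [set v | `|v| <= 1]].

Definition norm_continuous_on (V : normedModType R) (J : set R)
    (T : R -> V -> V) :=
  forall t, J t -> opnorm (T s \- T t) @[s --> within J (nbhs t)] --> (0 : R).

Definition immediately_norm_continuous (V : normedModType R)
  (T : R -> V -> V) := norm_continuous_on `]0, +oo[ T.

End Semigroup.

Definition lebesgue_delay (R : realType) :
    {measure set (measurableTypeR R) -> \bar R} :=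
  mrestr lebesgue_measure (measurable_itv `[(-1 : R), 0]).

Notation delayLp p1 X := (bochnerLp (lebesgue_delay _) p1 X).
Notation delaySpace p1 X := (l1prod X (delayLp p1 X)).

Section Delay.
Context (R : realType) (X : normedModType R) (p : R) (p1 : 1 <= p).
Local Notation mu := (lebesgue_delay R).
Local Notation Lp := (delayLp p1 X).
Local Notation E := (delaySpace p1 X).

(* The measure ignores the values outside of [-1, 0]; they are set to 0 so that
   strong measurability of f is only required on [-1, 0]. *)
Definition delay_toLp (f : R -> X) : Lp := toLp mu p1 (f \_ `[-1, 0]).

(* T_0(t); f is evaluated through a representative of its class. *)
Definition nilpotent_shift (t : R) (f : Lp) : Lp :=
  delay_toLp (fun tau => if t + tau <= 0 then f (t + tau) else 0).

(* The map written S_t : X -> L^p([-1, 0], X). *)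
Definition history (S : R -> X -> X) (t : R) (x : X) : Lp :=
  delay_toLp (fun tau => if - t < tau then S (t + tau) x else 0).

(* C^1 functions with compact support in ]-1, 0[; they define the same weak
   derivatives as C^infinity ones. *)
Definition test_function (phi : R -> R) :=
  [/\ forall t, derivable phi t 1, continuous (derive1 phi) &
      exists a b, [/\ -1 < a, b < 0 & forall t, t \notin `[a, b] -> phi t = 0]].

Definition weak_derivative (f g : Lp) :=
  forall phi, test_function phi -> exists2 I : X,
    is_bochner_integral mu (fun t => derive1 phi t *: f t) I &
    is_bochner_integral mu (fun t => phi t *: g t) (- I).

Definition W1p : set Lp := [set f | exists g, weak_derivative f g].

Definition derivative (f : Lp) : Lp := xget 0 (weak_derivative f).

Definition W1p_norm (f : Lp) : R := `|f| + `|derivative f|.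

(* The continuous representative of f takes the value x at 0. *)
Definition value_at_0 (f : Lp) (x : X) :=
  exists fc : R -> X, [/\ {within `[-1, 0], continuous fc},
    \forall t \ae mu, f t = fc t & fc 0 = x].

(* Phi is an operator on W^{1,p}; its values outside of [W1p] are irrelevant. *)
Definition W1p_bounded_linear (Phi : Lp -> X) :=
  (forall a f g, W1p f -> W1p g -> Phi (a *: f + g) = a *: Phi f + Phi g) /\
  (exists M, forall f, W1p f -> `|Phi f| <= M * W1p_norm f).

Definition delay_domain (D : set X) : set E :=
  [set z | [/\ D z.1, W1p z.2 & value_at_0 z.2 z.1]].

Definition delay_operator (A : X -> X) (Phi : Lp -> X)
  (z : E) : E := (A z.1 + Phi z.2, derivative z.2).

End Delay.

(* Main.v *)
(* Write [state k s = (k s, k(s + .))] for the orbits of the unperturbed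
   semigroup (Phi = 0), k being a C^1 orbit of S with a C^1 history; their
   initial states are dense. Duhamel's formula and the integral condition
   show that [T t (state k 0)] and [state k t] differ by at most a multiple
   of q(t). Splitting the formula for [T(a + h) - T(a)] at a small time d
   bounds its norm, on vectors [(y, 0)], by [N q(a)], with N a bound of T,
   times the corresponding norm at d, plus terms of order q(d), plus the
   increment of the unperturbed state, which tends to 0 on such vectors
   because S is immediately norm continuous. For small a the factor [N q(a)]
   is at most 1/2, so [T(a + h)(y, 0)] tends to [T(a)(y, 0)] as h -> 0+,
   uniformly for y in the unit ball. The same estimate at a = 1, where the
   nilpotent shift has vanished, applies to all of the space, and the
   semigroup law propagates it to all t >= 1. *)

Require Import Defs.
From HB Require Import structures.
From mathcomp Require Import all_boot all_order all_algebra.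
From mathcomp Require Import all_classical all_reals all_analysis measurable_realfun.
From mathcomp Require Import lra ring.

Set Implicit Arguments.
Unset Strict Implicit.
Unset Printing Implicit Defensive.

Import Order.TTheory GRing.Theory Num.Theory.
Import numFieldNormedType.Exports.

Local Open Scope classical_set_scope.
Local Open Scope ring_scope.

(** * The mean value inequality *)

(** The integral condition controls only a time integral of the norm of the perturbation, so in
    Duhamel's formula the increments of [T] itself stay under the integral, and an estimate for them
    is bound to refer to itself. It closes on vectors [(y, 0)] because the perturbation takes its
    values there; on all of the space it cannot be expected before time 1, since the nilpotent shift
    is not norm continuous before it vanishes. Stopping the formula at time [a - d] keeps the
    operator in front at times at least [d > 0], as no norm continuity is available at 0. Constants
    [c] stand in for a limsup of increments: starting from the trivial [2 N], each pass halves [c]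
    for all small times at once. No integral in the product space is formed: along C^1 curves the
    perturbation is continuous in time, and the formula enters as a mean value inequality whose
    majorant is a scalar antiderivative of its norm. Increments to the right suffice, since an
    increment to the left of t is one to the right of a nearby s. *)

Section MeanValue.
Context (R : realType) (V : normedModType R).

(** Continuity induction: the set of s where the estimate holds with an extra slope [e1] contains
    its supremum by left continuity, and the local estimate to the right carries it beyond. The
    majorant is a general function because it is later a multiple of an antiderivative of the norm
    of the perturbation. *)
Lemma increment_bound (F : R -> V) (phi : R -> R) (a b : R) : a <= b ->
  (forall s, a < s -> s <= b -> F r @[r --> s^'-] --> F s) ->
  (forall s t, a <= s -> s <= t -> t <= b -> phi s <= phi t) ->
  (forall s e, a <= s -> s < b -> 0 < e -> \forall h \near 0^'+,
    `|F (s + h) - F s| <= phi (s + h) - phi s + e * h) ->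
  `|F b - F a| <= phi b - phi a.
Proof.
move=> ab cF mphi iF; apply/ler_addgt0Pr => e e0.
have [->|ab'] := eqVneq a b; first by rewrite !subrr normr0 add0r ltW.
have {}ab' : a < b by rewrite lt_neqAle ab'.
(* The slack [e] is spread over the interval as a slope, so that the local errors add up to at most
   [e]. *)
pose e1 := e / (b - a).
have e10 : 0 < e1 by rewrite divr_gt0// subr_gt0.
pose P s := `|F s - F a| <= phi s - phi a + e1 * (s - a).
pose Z := [set s | a <= s <= b /\ P s].
have Za : Z a by split; rewrite ?lexx//= /P !subrr normr0 mulr0 addr0.
have hZ : has_sup Z by split; [exists a|exists b => s [/andP[]]].
pose s0 := sup Z.
have as0 : a <= s0 by apply: sup_upper_bound.
have s0b : s0 <= b by apply: sup_le_ub; [exists a|move=> s [/andP[]]].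
have Ps0 : P s0.
  have [<-|as0'] := eqVneq a s0; first by case: Za.
  have {}as0' : a < s0 by rewrite lt_neqAle as0'.
  apply/ler_addgt0Pr => d d0.
  have /cvgrPdist_lt/(_ _ d0) := cF _ as0' s0b.
  rewrite near_withinE => -[r /= r0 H].
  have [s Zs ss0] := sup_adherent r0 hZ.
  have ss0' : s <= s0 by apply: sup_upper_bound.
  case: Zs => /andP[as_ sb] Ps.
  have [ss|ss] := eqVneq s s0; first by rewrite -ss (le_trans Ps)// lerDl ltW.
  have Fs : `|F s0 - F s| < d.
    apply: H; last by rewrite lt_neqAle ss.
    by rewrite /= ger0_norm ?subr_ge0// ltrBlDr -ltrBlDl.
  rewrite (le_trans (ler_distD (F s) _ _))// addrC lerD ?(ltW Fs)//.
  rewrite (le_trans Ps)// lerD// ?lerB// ?mphi//.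
  by rewrite ler_pM2l// lerD2r.
have [s0b'|] := ltP s0 b; last first.
  move=> bs0; have /le_anti s0E : s0 <= b <= s0 by rewrite s0b.
  by move: Ps0; rewrite /P s0E divfK// gt_eqF// subr_gt0.
exfalso.
have [h [h0 hb Hh]] : exists h, [/\ 0 < h, s0 + h <= b &
    `|F (s0 + h) - F s0| <= phi (s0 + h) - phi s0 + e1 * h].
  have := iF s0 e1 as0 s0b' e10; rewrite near_withinE => -[r /= r0 H].
  exists (Num.min (r / 2) (b - s0)); split.
  - by rewrite lt_min divr_gt0// subr_gt0.
  - by rewrite -lerBrDl ge_min lexx orbT.
  - have m0 : 0 < Num.min (r / 2) (b - s0) by rewrite lt_min divr_gt0// subr_gt0.
    apply: H => //; rewrite /= sub0r normrN gtr0_norm//.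
    by rewrite gt_min ltr_pdivrMr// mulr2n mulrDr mulr1 ltrDl r0.
have : Z (s0 + h).
  split; first by rewrite hb (le_trans as0)// lerDl ltW.
  rewrite /P (le_trans (ler_distD (F s0) _ _))//.
  by rewrite (le_trans (lerD Hh Ps0))//; lra.
by move=> /(sup_upper_bound hZ); rewrite leNgt ltrDl h0.
Qed.

(* One-sided quotients suffice for the mean value inequality and are what the
   generator of a semigroup provides. *)
Definition right_C1 (k k' : R -> V) :=
  [/\ continuous k, continuous k' &
      forall t, h^-1 *: (k (t + h) - k t) @[h --> 0^'+] --> k' t].

Lemma right_derivative_le (F : R -> V) (t : R) (v : V) (e : R) : 0 < e ->
  h^-1 *: (F (t + h) - F t) @[h --> 0^'+] --> v ->
  \forall h \near 0^'+, `|F (t + h) - F t - h *: v| <= e * h.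
Proof.
move=> e0 /cvgrPdist_le/(_ _ e0) H; near=> h.
have h0 : 0 < h by near: h; exact: nbhs_right_gt.
have -> : F (t + h) - F t - h *: v = - h *: (v - h^-1 *: (F (t + h) - F t)).
  by rewrite scalerBr scalerA !mulNr mulfV ?gt_eqF// scaleN1r opprK addrC scaleNr.
rewrite normrZ normrN gtr0_norm// mulrC ler_pM2r//.
by near: h.
Unshelve. all: by end_near. Qed.

(** The curve minus the line of slope [v] has right derivatives of norm at most [e], so
    [increment_bound] applies to it with a linear majorant. *)
Lemma mean_value_le (F F' : R -> V) (a b : R) (v : V) (e : R) : a <= b ->
  (forall s, a < s -> s <= b -> F r @[r --> s^'-] --> F s) ->
  (forall s, a <= s -> s < b ->
    h^-1 *: (F (s + h) - F s) @[h --> 0^'+] --> F' s) ->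
  (forall s, a <= s -> s < b -> `|F' s - v| <= e) ->
  `|F b - F a - (b - a) *: v| <= e * (b - a).
Proof.
move=> ab cF dF Fe.
have [->|ab'] := eqVneq a b.
  by rewrite !subrr scale0r mulr0 subrr normr0.
have {}ab' : a < b by rewrite lt_neqAle ab'.
have e0 : 0 <= e by rewrite (le_trans _ (Fe a _ _)).
have -> : F b - F a - (b - a) *: v = (F b - b *: v) - (F a - a *: v).
  by rewrite scalerBl !opprB addrACA [in RHS]addrACA [- F a + _]addrC.
rewrite [e * _]mulrBr.
apply: (@increment_bound (fun s => F s - s *: v) (fun s => e * s)) => //.
- move=> s as_ sb; apply: cvgB; first exact: cF.
  by apply: cvgZr_tmp; apply: cvg_at_left_filter; exact: cvg_id.
- by move=> s t _ st _; rewrite ler_wpM2l.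
- move=> s d as_ sb d0; have D1 := right_derivative_le d0 (dF _ as_ sb).
  near=> h.
  have h0 : 0 < h by near: h; exact: nbhs_right_gt.
  have -> : F (s + h) - (s + h) *: v - (F s - s *: v) =
      (F (s + h) - F s - h *: F' s) + h *: (F' s - v).
    by rewrite scalerBr scalerDl opprB [s *: v + _]addrC opprD !addrA !subrK addrAC.
  rewrite (le_trans (ler_normD _ _))// -mulrBr (_ : s + h - s = h) 1?[leRHS]addrC; last by rewrite addrC addKr.
  rewrite lerD//; first by near: h.
  by rewrite normrZ gtr0_norm// mulrC ler_pM2r// Fe.
Unshelve. all: by end_near. Qed.

Lemma right_C1_mean (k k' : R -> V) (a b : R) (v : V) (e : R) :
  right_C1 k k' -> a <= b -> (forall s, a <= s -> s <= b -> `|k' s - v| <= e) ->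
  `|k b - k a - (b - a) *: v| <= e * (b - a).
Proof.
move=> [ck _ dk] ab ke; apply: (mean_value_le (F' := k')) => //.
- by move=> s _ _; apply: cvg_at_left_filter; exact: ck.
- by move=> s as_ /ltW sb; exact: ke.
Qed.

Lemma right_C1_shift (k k' : R -> V) (s : R) : right_C1 k k' ->
  right_C1 (fun t => k (s + t)) (fun t => k' (s + t)).
Proof.
move=> [ck ck' dk].
have cs : continuous (fun t : R => s + t).
  by move=> t; apply: cvgD; [exact: cvg_cst|exact: cvg_id].
split.
- by move=> t; exact: (continuous_comp (cs t) (ck _)).
- by move=> t; exact: (continuous_comp (cs t) (ck' _)).
- by move=> t; under eq_fun do rewrite addrA; exact: dk.
Qed.

Lemma right_C1D (k k' l l' : R -> V) : right_C1 k k' -> right_C1 l l' ->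
  right_C1 (k \+ l) (k' \+ l').
Proof.
move=> [ck ck' dk] [cl cl' dl]; split.
- by move=> t; apply: cvgD; [exact: ck|exact: cl].
- by move=> t; apply: cvgD; [exact: ck'|exact: cl'].
- move=> t /=; under eq_fun do rewrite opprD addrACA scalerDr.
  by apply: cvgD.
Qed.

Lemma right_C1Z (a : R) (k k' : R -> V) : right_C1 k k' ->
  right_C1 (a \*: k) (a \*: k').
Proof.
move=> [ck ck' dk]; split.
- by move=> t; apply: cvgZl_tmp; exact: ck.
- by move=> t; apply: cvgZl_tmp; exact: ck'.
- move=> t /=; under eq_fun do rewrite -scalerBr scalerA mulrC -scalerA.
  exact: cvgZl_tmp.
Qed.

Lemma right_C1B (k k' l l' : R -> V) : right_C1 k k' -> right_C1 l l' ->
  right_C1 (k \- l) (k' \- l').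
Proof.
move=> hk hl; have /= := right_C1D hk (right_C1Z (-1) hl).
by congr right_C1; apply/funext => t /=; rewrite scaleN1r.
Qed.

Lemma right_C1_cst (v : V) : right_C1 (fun=> v) (fun=> 0).
Proof.
split; [by move=> t; exact: cvg_cst..|].
by move=> t; under eq_fun do rewrite subrr scaler0; exact: cvg_cst.
Qed.

Lemma continuous_uniform (k : R -> V) (a b e : R) : continuous k -> 0 < e ->
  exists2 d, 0 < d & forall s t, a <= s <= b -> a <= t <= b -> `|s - t| <= d ->
    `|k s - k t| <= e.
Proof.
move=> ck e0.
(* Only [x] is covered by compactness; [y] may leave the interval. Near each point [P d] holds for
   all small [d], and the covering property yields one radius for all of [[a, b]]. *)
pose P (d x : R) := forall y, `|x - y| <= d -> `|k x - k y| <= e.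
have : near_covering `[a, b]%classic.
  by apply/compact_near_coveringP; exact: segment_compact.
move=> /(_ _ (0^'+ : set_system R) P _) [].
  move=> x _.
  have e20 : 0 < e / 2 by rewrite divr_gt0.
  have /cvgrPdist_lt/(_ _ e20)/nbhs_ballP[d /= d0 Hd] := ck x.
  have Hd' y : `|x - y| < d -> `|k x - k y| < e / 2 by move=> ?; apply: Hd.
  have d20 : 0 < d / 2 by rewrite divr_gt0.
  exists (ball x (d / 2), [set d' | d' < d / 2]) => /=.
    by split; [exact: nbhsx_ballx|exact: nbhs_right_lt].
  move=> [x' d'] [/= xx' dd'] y x'y.
  rewrite (le_trans (ler_distD (k x) _ _))// (splitr e) lerD//.
    by rewrite distrC ltW// Hd'// (lt_le_trans xx')// ler_pdivrMr// ler_peMr ?ler1n ?ltW.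
  rewrite ltW// Hd'// (le_lt_trans (ler_distD x' _ _))// (splitr d).
  by rewrite ltrD// (le_lt_trans x'y).
move=> d /= d0 Hd.
exists (d / 2); first by rewrite divr_gt0.
move=> s t sab tab st; apply: (Hd (d / 2)) => //=.
- by rewrite sub0r normrN gtr0_norm ?divr_gt0// ltr_pdivrMr// ltr_pMr// ltr1n.
- by rewrite divr_gt0.
Qed.

End MeanValue.

(** * Strongly continuous semigroups *)

Section LinearFun.
Context (R : realType) (V W : normedModType R) (f : V -> W) (lf : linear f).

Lemma lin0 : f 0 = 0.
Proof. by have := lf (-1) 0 0; rewrite scaler0 addr0 scaleN1r addNr. Qed.

Lemma linD x y : f (x + y) = f x + f y.
Proof. by have := lf 1 x y; rewrite !scale1r. Qed.

Lemma linZ a x : f (a *: x) = a *: f x.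
Proof. by have := lf a x 0; rewrite lin0 !addr0. Qed.

Lemma linN x : f (- x) = - f x.
Proof. by rewrite -scaleN1r linZ scaleN1r. Qed.

Lemma linB x y : f (x - y) = f x - f y.
Proof. by rewrite linD linN. Qed.

Lemma linear_continuous_bound : continuous f ->
  exists2 M, 0 < M & forall v, `|f v| <= M * `|v|.
Proof.
pose g : {linear V -> W} := HB.pack f (GRing.isLinear.Build _ _ _ _ _ lf).
move=> /(@linear_bounded_continuous _ _ _ g)/linear_boundedP/pinfty_ex_gt0.
by move=> [M M0 H]; exists M.
Qed.

End LinearFun.

Section OpNorm.
Context (R : realType) (V W : normedModType R).

(** The bound [M] makes the set under the supremum bounded, so that [sup] is an upper bound of
    it. *)
Lemma opnorm_ge (L : V -> W) (M : R) (v : V) : linear L ->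
  (forall v, `|L v| <= M * `|v|) -> `|L v| <= opnorm L * `|v|.
Proof.
move=> lL LM; have [->|v0] := eqVneq v 0.
  by rewrite lin0// !normr0 mulr0.
have nv0 : 0 < `|v| by rewrite normr_gt0.
rewrite -ler_pdivrMr// mulrC -(gtr0_norm nv0) -normfV -normrZ -linZ//.
apply: sup_upper_bound.
  split; first by exists `|L 0|, 0 => //=; rewrite normr0.
  exists `|M| => _ [w /= w1 <-]; rewrite (le_trans (LM w))//.
  by rewrite (le_trans (ler_norm _))// normrM normr_id ler_piMr.
exists (`|v|^-1 *: v) => //=; rewrite normrZ normfV normr_id mulVf//.
by rewrite gt_eqF.
Qed.

Lemma opnorm_le (L : V -> W) (e : R) : 0 <= e ->
  (forall v, `|L v| <= e * `|v|) -> opnorm L <= e.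
Proof.
move=> e0 Le; apply: sup_le_ub; first by exists `|L 0|, 0 => //=; rewrite normr0.
by move=> _ [w /= w1 <-]; rewrite (le_trans (Le w))// ler_piMr.
Qed.

Lemma opnorm_ge0 (L : V -> W) (M : R) :
  (forall v, `|L v| <= M * `|v|) -> 0 <= opnorm L.
Proof.
move=> LM; apply: (@le_trans _ _ `|L 0|) => //.
apply: sup_upper_bound.
  split; first by exists `|L 0|, 0 => //=; rewrite normr0.
  exists `|M| => _ [w /= w1 <-]; rewrite (le_trans (LM w))//.
  by rewrite (le_trans (ler_norm _))// normrM normr_id ler_piMr.
by exists 0 => //=; rewrite normr0.
Qed.

End OpNorm.

Section C0.
Context (R : realType) (V : normedModType R) (T : R -> V -> V).
Hypothesis cT : c0_semigroup T.

(** The orbit is continued to negative times by its value at 0, which makes it continuous on the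
    whole line. *)
Lemma c0_max_continuous (v : V) : continuous (fun s : R => T (Num.max s 0) v).
Proof.
move=> t; apply/cvgrPdist_lt => e e0.
have /subspace_continuousP/(_ (Num.max t 0)) := @c0_continuous _ _ _ cT v.
have mt : `[0, +oo[%classic (Num.max t 0) by rewrite /= in_itv/= andbT le_max lexx orbT.
move=> /(_ mt)/cvgrPdist_lt/(_ _ e0); rewrite near_withinE => /nbhs_ballP[d /= d0 H].
apply/nbhs_ballP; exists d => //= s; rewrite /ball/= => ts.
apply: H; last by rewrite /= in_itv/= andbT le_max lexx orbT.
rewrite /ball /=; apply: le_lt_trans ts.
rewrite !maxEle; have [t0|t0] := leP t 0; have [s0|s0] := leP s 0.
- by rewrite subrr normr0.
- by rewrite sub0r normrN distrC [leRHS]gtr0_norm ?gtr0_norm//; lra.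
- by rewrite subr0 !gtr0_norm//; lra.
- by [].
Qed.

Lemma c0_orbit_bounded (b : R) v : exists C, forall t, 0 <= t <= b -> `|T t v| <= C.
Proof.
have cI : {within `[0, b], continuous (fun s : R => T (Num.max s 0) v)}.
  by apply: continuous_subspaceT; exact: c0_max_continuous.
have /compact_bounded[M [_ HM]] :=
  continuous_compact cI (@segment_compact R 0 b).
exists (M + 1) => t t0b; apply: HM; first by rewrite ltrDl.
by exists t => //=; case/andP: t0b => t0 _; rewrite max_l.
Qed.

Context (D : set V) (A : V -> V).
Hypothesis gT : is_generator T D A.

Lemma generator_cvg v : D v -> h^-1 *: (T h v - v) @[h --> 0^'+] --> A v.
Proof. by move=> Dv; case: gT => _; exact. Qed.

Lemma generator_uniq v w : h^-1 *: (T h v - v) @[h --> 0^'+] --> w ->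
  D v /\ A v = w.
Proof.
move=> vw; have Dv : D v by case: gT => H _; apply/H; apply/cvg_ex; exists w.
split=> //; apply: cvg_unique vw; last exact: generator_cvg.
exact: norm_hausdorff.
Qed.

Lemma generator_orbit v t : 0 <= t -> D v ->
  h^-1 *: (T (t + h) v - T t v) @[h --> 0^'+] --> T t (A v).
Proof.
move=> t0 Dv; have lT := c0_linear cT t0; have bT := c0_bounded cT t0.
have : T t (h^-1 *: (T h v - v)) @[h --> 0^'+] --> T t (A v).
  by apply: cvg_comp (generator_cvg Dv) _; exact: bT.
apply: cvg_trans; apply: near_eq_cvg; near=> h.
rewrite linZ// linB// (c0_add cT)//.
Unshelve. all: by end_near. Qed.

Lemma generator_invariant v t : 0 <= t -> D v ->
  D (T t v) /\ A (T t v) = T t (A v).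
Proof.
move=> t0 Dv; apply: generator_uniq; have := generator_orbit t0 Dv.
apply: cvg_trans; apply: near_eq_cvg; near=> h.
rewrite (addrC t h) (c0_add cT)//.
Unshelve. all: by end_near. Qed.

End C0.

(** Orbits are bounded on compact time intervals, and the uniform boundedness principle does the
    rest. Completeness is a hypothesis on filters rather than a structure, so that the lemma serves
    both X and the product space, whose completeness is proved as a plain statement. *)
Lemma c0_locally_bounded (R : realType) (V : normedModType R)
    (T : R -> V -> V) (b : R) :
  (forall F : set_system V, ProperFilter F -> cauchy F -> cvg F) ->
  c0_semigroup T ->
  exists2 M, 0 < M & forall t, 0 <= t <= b -> forall v, `|T t v| <= M * `|v|.
Proof.
move=> Vc cT.
pose Vcomplete : completeNormedModType R := HB.pack (NormedModule.sort V)
  (Uniform_isComplete.Build (NormedModule.sort V) Vc).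
have [] := @Banach_Steinhauss R Vcomplete V [set T t | t in [set t | 0 <= t <= b]] _ _ 1.
- move=> _ [t /= /andP[t0 _] <-]; split; last exact: (c0_linear cT).
  have [M M0 HM] := linear_continuous_bound (c0_linear cT t0) (c0_bounded cT t0).
  move=> r; exists (M * `|r|) => v vr; rewrite (le_trans (HM v))// ler_pM2l//.
  by rewrite (le_trans vr)// ler_norm.
- move=> v; have [C HC] := c0_orbit_bounded cT b v.
  by exists C => _ [t /= t0 <-]; exact: HC.
move=> M HM; exists (`|M| + 1) => [|t tb v]; first by rewrite ltr_wpDl.
have lT : linear (T t) by apply: (c0_linear cT); case/andP: tb.
have [->|v0] := eqVneq v 0.
  by rewrite lin0// !normr0 mulr0.
have nv0 : 0 < `|v| by rewrite normr_gt0.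
rewrite -ler_pdivrMr// mulrC -{1}(gtr0_norm nv0) -normfV -normrZ -linZ//.
rewrite (@le_trans _ _ M)//; last by rewrite (le_trans (ler_norm M))// lerDl.
apply: HM; first by exists t.
by rewrite normrZ normfV normr_id mulVf// gt_eqF.
Qed.

(** * The Bochner integral *)

Section SimpleIntegral.
Context d (T : measurableType d) (R : realType).
Variable mu : {measure set T -> \bar R}.
Hypothesis mufin : (mu setT < +oo)%E.

Lemma finite_measure_fin_num (A : set T) : measurable A -> mu A \is a fin_num.
Proof.
move=> mA; rewrite ge0_fin_numE//; apply: le_lt_trans mufin.
by apply: le_measure; rewrite ?inE.
Qed.

Lemma simple_comp2 (U W X : normedModType R) (s : T -> U) (t : T -> W)
    (g : U -> W -> X) :
  simple s -> simple t -> simple (fun x => g (s x) (t x)).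
Proof.
move=> ss st; split=> [|z].
  apply: (@sub_finite_set _ _ [set g u v | u in range s & v in range t]).
    by move=> _ [x _ <-]; exists (s x); [exists x|exists (t x); [exists x|]].
  by apply: finite_image2; [case: ss|case: st].
rewrite (_ : _ @^-1` _ = \bigcup_(y in range s)
    ((s @^-1` [set y]) `&` (t @^-1` [set w | g y w = z]))).
  apply: fin_bigcup_measurable; first by case: ss.
  by move=> y _; apply: measurableI; exact: finite_range_preimage.
apply/seteqP; split=> [x /= <-|x [_ [x' _ <-] [/= -> ->]]//].
by exists (s x); [exists x|].
Qed.

Lemma simple_comp1 (U X : normedModType R) (s : T -> U) (g : U -> X) :
  simple s -> simple (fun x => g (s x)).
Proof. by move=> ss; exact: (simple_comp2 (fun u _ => g u) ss ss). Qed.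

Lemma simple_strongly_measurable (X : normedModType R) (s : T -> X) :
  simple s -> strongly_measurable s.
Proof. by move=> ss; exists (fun=> s) => // x; exact: cvg_cst. Qed.

Lemma simple_indic (X : normedModType R) (A : set T) (y : X) : measurable A ->
  simple (fun x => \1_A x *: y).
Proof.
move=> mA; split.
  apply: (@sub_finite_set _ _ [set 0; y]); last by rewrite finite_setU.
  by move=> _ [x _ <-]; rewrite indicE; case: (x \in A) => /=;
    [right; rewrite /= scale1r|left; rewrite /= scale0r].
move=> z; rewrite (_ : _ @^-1` _ =
   (A `&` [set _ | y = z]) `|` (~` A `&` [set _ | 0 = z])).
  apply: measurableU; apply: measurableI => //; first last.
  - have [E|E] := pselect (0 = z).
      by rewrite (_ : [set _ | _] = setT)//; apply/seteqP; split.
    by rewrite (_ : [set _ | _] = set0)//; apply/seteqP; split.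
  - exact: measurableC.
  - have [E|E] := pselect (y = z).
      by rewrite (_ : [set _ | _] = setT)//; apply/seteqP; split.
    by rewrite (_ : [set _ | _] = set0)//; apply/seteqP; split.
apply/seteqP; split=> x /=; rewrite indicE.
  by have [xA|xA] := boolP (x \in A); rewrite ?scale1r ?scale0r => E;
    [left; split=> //; exact: set_mem|right; split=> //; move: xA; rewrite notin_setE].
by case=> -[xA <-]; rewrite ?(mem_set xA) ?(memNset xA) ?scale1r ?scale0r.
Qed.

Context (X : normedModType R).

(** The integral may be computed from labels finer than the values, [c] being arbitrary. Labelling
    by pairs of values then refines two simple functions at once, which gives linearity. *)
Lemma simple_integral_comp (I : choiceType) (r : seq I) (u : T -> I) (c : I -> X) :
  uniq r -> (forall x, u x \in r) -> (forall i, measurable (u @^-1` [set i])) ->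
  simple_integral mu (c \o u) = \sum_(i <- r) fine (mu (u @^-1` [set i])) *: c i.
Proof.
move=> ur xr mr.
set s := c \o u; set S := undup [seq c i | i <- r].
transitivity (\sum_(y <- S) fine (mu (s @^-1` [set y])) *: y).
  apply: fsbig_fwiden; last 2 first.
  - exact: undup_uniq.
  - move=> y [/= _]; rewrite not_andP => -[ny|/= /contrapT ->]; last first.
      by rewrite scaler0.
    rewrite (_ : _ @^-1` _ = set0) ?measure0 ?scale0r//.
    by apply/seteqP; split=> // x /= E; apply: ny; exists x.
  - move=> y [[x _ <-] _] /=; rewrite mem_undup.
    by apply/mapP; exists (u x).
transitivity (\sum_(y <- S) \sum_(i <- r | c i == y) fine (mu (u @^-1` [set i])) *: c i).
  apply: eq_bigr => y _.
  under eq_bigr => i /eqP -> do [].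
  rewrite -scaler_suml; congr (_ *: _).
  rewrite (_ : s @^-1` [set y] = \bigcup_(i in [set` [seq i <- r | c i == y]])
      u @^-1` [set i]).
    rewrite measure_fin_bigcup//; last 1 first.
      by move=> i j _ _ [x [/= <- <-]].
    rewrite -fsbig_seq ?filter_uniq// big_filter.
    by rewrite sum_fine// => i _; exact: finite_measure_fin_num.
  apply/seteqP; split=> [x /= E|x [i /=]].
    by exists (u x) => //=; rewrite mem_filter xr andbT; apply/eqP.
  by rewrite mem_filter => /andP[/eqP <- _] <-.
rewrite (exchange_big_dep predT)//= big_seq [RHS]big_seq.
apply: eq_bigr => i ir; rewrite -big_filter.
have -> : [seq y <- S | c i == y] = [:: c i].
  rewrite (_ : [seq y <- S | c i == y] = seq.filter (pred1 (c i)) S); last first.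
    by apply: eq_filter => y; rewrite /= eq_sym.
  by rewrite filter_pred1_uniq ?undup_uniq// mem_undup map_f.
by rewrite big_seq1.
Qed.

Lemma finite_range_seq (U : choiceType) (s : T -> U) : finite_set (range s) ->
  exists2 r : seq U, uniq r & forall x, s x \in r.
Proof.
move=> /finite_seqP[r rE]; exists (undup r); first exact: undup_uniq.
move=> x; rewrite mem_undup.
have : range s (s x) by exists x.
by rewrite rE.
Qed.

Lemma simple_integral_lin (a : R) (s t : T -> X) : simple s -> simple t ->
  simple_integral mu (fun x => a *: s x + t x) =
  a *: simple_integral mu s + simple_integral mu t.
Proof.
move=> ss st.
pose u x := (s x, t x).
have fu : finite_set (range u).
  apply: (@sub_finite_set _ _ (range s `*` range t)).
    by move=> _ [x _ <-]; split; exists x.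
  by apply: finite_setX; [case: ss|case: st].
have [r ur xr] := finite_range_seq fu.
have mu_ i : measurable (u @^-1` [set i]).
  rewrite (_ : _ @^-1` _ = s @^-1` [set i.1] `&` t @^-1` [set i.2]).
    by apply: measurableI; exact: finite_range_preimage.
  apply/seteqP; split=> [x /= <-//|x [/= E1 E2]].
  by rewrite /u E1 E2 -surjective_pairing.
have E c := @simple_integral_comp _ r u c ur xr mu_.
rewrite [LHS](E (fun i => a *: i.1 + i.2)).
rewrite [simple_integral mu s](E (fun i => i.1)) [simple_integral mu t](E (fun i => i.2)).
rewrite scaler_sumr -big_split/=; apply: eq_bigr => i _.
by rewrite scalerDr !scalerA mulrC.
Qed.

Lemma simple_integral_norm (s : T -> X) : simple s ->
  (`|simple_integral mu s|%:E <= \int[mu]_x `|s x|%:E)%E.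
Proof.
move=> ss; have [r ur xr] := finite_range_seq ss.1.
rewrite (simple_integral_comp id ur xr)//; last by case: ss.
have -> : (\int[mu]_x `|s x|%:E)%E =
    (\int[mu]_x (\sum_(y <- r) (`|y| * \1_(s @^-1` [set y]) x)%:E))%E.
  apply: eq_integral => x _; rewrite sumEFin; congr EFin.
  rewrite (bigD1_seq (s x))//= indicE mem_set// mulr1 big1 ?addr0// => y ysx.
  by rewrite indicE memNset ?mulr0//= => /esym/eqP; rewrite (negbTE ysx).
rewrite ge0_integral_sum//; last first.
  move=> y; apply/measurable_EFinP; apply: measurable_funM => //.
  by apply: measurable_indic; case: ss.
apply: (@le_trans _ _ (\sum_(y <- r) `|fine (mu (s @^-1` [set y])) *: y|)%:E).
  by rewrite lee_fin ler_norm_sum.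
rewrite -sumEFin; apply: lee_sum => y _.
have my : measurable (s @^-1` [set y]) by case: ss.
rewrite (@integralZl_indic _ _ _ mu setT _ (fun=> s @^-1` [set y]))//; last first.
  by rewrite ltNge normr_ge0.
rewrite integral_indic// setIT normrZ mulrC EFinM.
by rewrite ger0_norm ?fine_ge0// fineK ?finite_measure_fin_num.
Qed.

Lemma simple_integral_indic (A : set T) (y : X) : measurable A ->
  simple_integral mu (fun x => \1_A x *: y) = fine (mu A) *: y.
Proof.
move=> mA.
rewrite (@simple_integral_comp bool [:: true; false] (fun x => x \in A)
  (fun b : bool => b%:R *: y))//.
- rewrite !big_cons big_nil /= scale1r scale0r scaler0 !addr0.
  by congr (fine (mu _) *: _); apply/seteqP; split=> x /= H; [exact: set_mem|exact: mem_set].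
- by move=> x; case: (x \in A).
- move=> [].
    by rewrite (_ : _ @^-1` _ = A)//; apply/seteqP; split=> x /= H; [exact: set_mem|exact: mem_set].
  rewrite (_ : _ @^-1` _ = ~` A); first exact: measurableC.
  apply/seteqP; split=> x /=; first by move/negbT; rewrite notin_setE.
  by move=> ?; apply/negbTE; rewrite notin_setE.
Qed.

End SimpleIntegral.

Section StronglyMeasurableOps.
Context d (T : measurableType d) (R : realType).

Lemma strongly_measurable_comp2 (U W X : normedModType R) (f : T -> U) (g : T -> W)
    (h : U -> W -> X) : continuous (fun z : U * W => h z.1 z.2) ->
  strongly_measurable f -> strongly_measurable g ->
  strongly_measurable (fun x => h (f x) (g x)).
Proof.
move=> ch [s ss sf] [t st tg]; exists (fun n x => h (s n x) (t n x)).
  by move=> n; exact: simple_comp2.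
move=> x; apply: (@cvg_comp _ _ _ (fun n => (s n x, t n x)) (fun z => h z.1 z.2)
   \oo (nbhs (f x, g x))); last exact: (ch (f x, g x)).
by apply: cvg_pair; [exact: sf|exact: tg].
Qed.

Import HBSimple.

Lemma strongly_measurable_real (g : T -> R) : measurable_fun setT g ->
  strongly_measurable (g : T -> R^o).
Proof.
move=> mg; have /= [s sg] := approximation_sfun measurableT ((measurable_EFinP _ _).2 mg).
exists (fun n => s n : T -> R) => [n|x]; last by move/fine_cvgP: (sg x Logic.I) => [].
split; first exact: fimfunP.
by move=> y; apply: measurable_funPTI; exact: measurable_set1.
Qed.

Context (X : normedModType R).
Implicit Types f g : T -> X.

Lemma strongly_measurable_continuous (c : R -> X) (g : T -> R) : continuous c ->
  measurable_fun setT g -> strongly_measurable (fun x => c (g x)).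
Proof.
move=> cc /strongly_measurable_real[s ss sg].
exists (fun n x => c (s n x)) => [n|x].
  by apply: (@simple_comp1 _ _ _ R^o X _ c).
by apply: (@cvg_comp _ _ _ (s ^~ x) c \oo (nbhs (g x))); [exact: sg|exact: cc].
Qed.

Lemma strongly_measurable_if (A : set T) f g : measurable A ->
  strongly_measurable f -> strongly_measurable g ->
  strongly_measurable (fun x => if x \in A then f x else g x).
Proof.
move=> mA [s ss sf] [t st tg].
exists (fun n x => if x \in A then s n x else t n x) => [n|x]; last first.
  by case: ifPn => _; [exact: sf|exact: tg].
have := simple_comp2 (fun u (v : R^o * X) => if v.1 == 0 then v.2 else u) (ss n)
  (simple_comp2 (fun (a : R^o) b => (a, b)) (simple_indic (1 : R^o) mA) (st n)).
congr simple; apply/funext => x /=; rewrite indicE.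
by case: (x \in A); rewrite /= ?scale1r ?scale0r ?oner_eq0 ?eqxx.
Qed.

Lemma strongly_measurable_patch (A : set T) f : measurable A ->
  strongly_measurable f -> strongly_measurable (f \_ A).
Proof.
move=> mA mf; apply: (@strongly_measurable_if A f (fun=> point) mA mf).
exact/simple_strongly_measurable/simple_cst.
Qed.

Lemma strongly_measurable_scale (a : T -> R) f : measurable_fun setT a ->
  strongly_measurable f -> strongly_measurable (fun x => a x *: f x).
Proof.
move=> /strongly_measurable_real ma mf.
apply: (strongly_measurable_comp2 (h := fun (u : R^o) v => u *: v)) ma mf.
by move=> z; apply: scale_continuous.
Qed.

Lemma strongly_measurableB f g : strongly_measurable f ->
  strongly_measurable g -> strongly_measurable (fun x => f x - g x).
Proof.
move=> mf mg; have := strongly_measurable_lin (-1) mg mf.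
by congr strongly_measurable; apply/funext => x /=; rewrite scaleN1r addrC.
Qed.

Lemma strongly_measurable_cst (y : X) : strongly_measurable (fun _ : T => y).
Proof. exact/simple_strongly_measurable/simple_cst. Qed.

Lemma measurable_EFin_norm f : strongly_measurable f ->
  measurable_fun setT (fun x => `|f x|%:E).
Proof. by move=> mf; apply/measurable_EFinP; exact: strongly_measurable_norm. Qed.

(** The approximants are cut to 0 wherever they exceed [2 |f|]. Where f is nonzero the cut is
    eventually inactive; where f vanishes the result is 0. *)
Lemma dominated_simple_approx f : strongly_measurable f ->
  exists s : (T -> X)^nat, [/\ forall n, simple (s n),
    forall x, s n x @[n --> \oo] --> f x &
    forall n x, `|s n x| <= 2 * `|f x|].
Proof.
move=> mf; have [s ss sf] := mf.
pose B n := [set x | `|s n x| <= 2 * `|f x|].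
have mB n : measurable (B n).
  rewrite -[B n]setTI; apply: measurable_fun_le => //.
    exact: strongly_measurable_norm (simple_strongly_measurable _).
  by apply: measurable_funM => //; exact: strongly_measurable_norm.
exists (fun n x => if x \in B n then s n x else 0); split.
- move=> n; have := simple_comp2 (fun u (v : R^o) => if v == 0 then 0 else u) (ss n)
    (simple_indic (1 : R^o) (mB n)).
  congr simple; apply/funext => x /=; rewrite indicE.
  by case: (x \in _); rewrite /= ?scale1r ?scale0r ?oner_eq0 ?eqxx.
- move=> x; have [fx0|fx0] := eqVneq (f x) 0.
    rewrite fx0; apply: cvg_near_cst; apply: nearW => n.
    by case: ifPn => //; rewrite inE /B/= fx0 normr0 mulr0 normr_le0 => /eqP ->.
  have sfx := sf x; apply: cvg_trans sfx; apply: near_eq_cvg.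
  have nf : 0 < `|f x| by rewrite normr_gt0.
  have /cvgrPdist_le/(_ _ nf) := sf x; apply: filterS => n fs.
  rewrite ifT// inE /B/=.
  rewrite -[s n x](subrKC (f x)) (le_trans (ler_normD _ _))//.
  by rewrite mulr2n mulrDl mul1r lerD// distrC.
- move=> n x; case: ifPn => [|_]; first by rewrite inE.
  by rewrite normr0 mulr_ge0.
Qed.

End StronglyMeasurableOps.

Lemma strongly_measurable_comp d d' (T : measurableType d) (T' : measurableType d')
    (R : realType) (X : normedModType R) (f : T -> X) (phi : T' -> T) :
  measurable_fun setT phi -> strongly_measurable f ->
  strongly_measurable (fun x => f (phi x)).
Proof.
move=> mphi [s ss sf]; exists (fun n x => s n (phi x)) => [n|x]; last exact: sf.
have [fs ms] := ss n; split.
  by apply: sub_finite_set fs => _ [x _ <-]; exists (phi x).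
move=> y; rewrite -[X in measurable X]setTI.
exact: (mphi measurableT _ (ms y)).
Qed.

Section BochnerTheory.
Context d (T : measurableType d) (R : realType).
Variable mu : {measure set T -> \bar R}.
Hypothesis mufin : (mu setT < +oo)%E.
Context (X : normedModType R).
Implicit Types f g : T -> X.
Local Notation bi := (is_bochner_integral mu).

Lemma integral_norm_triangle f g (h : T -> X) :
  strongly_measurable f -> strongly_measurable g -> strongly_measurable h ->
  (\int[mu]_x `|f x - h x|%:E <=
   \int[mu]_x `|f x - g x|%:E + \int[mu]_x `|g x - h x|%:E)%E.
Proof.
move=> mf mg mh.
rewrite -ge0_integralD//; do ?by [apply: measurable_EFin_norm; exact: strongly_measurableB].
apply: ge0_le_integral => //.
- by apply: measurable_EFin_norm; exact: strongly_measurableB.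
- by apply: emeasurable_funD; apply: measurable_EFin_norm; exact: strongly_measurableB.
- by move=> x _; rewrite -EFinD lee_fin ler_distD.
Qed.

Lemma integral_norm_sym f g :
  (\int[mu]_x `|f x - g x|%:E = \int[mu]_x `|g x - f x|%:E)%E.
Proof. by under eq_integral do rewrite distrC. Qed.

Lemma bochner_strongly_measurable f I : bi f I -> strongly_measurable f.
Proof. by move=> [s [ss sf _ _]]; exists s => // n; case: (ss n). Qed.

Lemma bochner_approx f I (e : R) : bi f I -> 0 < e ->
  exists s, [/\ simple s, (\int[mu]_x `|s x - f x|%:E <= e%:E)%E &
    `|I - simple_integral mu s| <= e].
Proof.
move=> [s [ss sf sL sI]] e0.
have /cvgrPdist_le/(_ _ e0) sI' := sI.
have /fine_cvgP[sfin /cvgrPdist_le/(_ _ e0) sL'] := sL.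
have [n [n1 [n2 n3]]] := filter_ex (filterI sI' (filterI sfin sL')).
exists (s n); split => //; first by case: (ss n).
rewrite -[leLHS]fineK// lee_fin (le_trans (ler_norm _))//.
by move: n3; rewrite /= sub0r normrN.
Qed.

Lemma bochner_lin (a : R) f g I J : bi f I -> bi g J ->
  bi (fun x => a *: f x + g x) (a *: I + J).
Proof.
move=> bf bg; have mf := bochner_strongly_measurable bf.
have mg := bochner_strongly_measurable bg.
case: bf => [s [ss sf sL sI]]; case: bg => [t [st tg tL tJ]].
have mst n : simple (fun x => a *: s n x + t n x).
  by apply: simple_lin; [case: (ss n)|case: (st n)].
exists (fun n x => a *: s n x + t n x); split.
- move=> n; split=> // y _; rewrite -ge0_fin_numE//.
  by apply: finite_measure_fin_num => //; case: (mst n).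
- by move=> x; apply: cvgD; [apply: cvgZl_tmp; exact: sf|exact: tg].
- apply: (@squeeze_cvge _ _ _ _ (cst 0%E) _ (fun n =>
    `|a|%:E * \int[mu]_x `|s n x - f x|%:E + \int[mu]_x `|t n x - g x|%:E)%E).
  + apply: nearW => n; rewrite integral_ge0//=.
    have m1 : measurable_fun setT (fun x => `|s n x - f x|%:E).
      apply: measurable_EFin_norm; apply: strongly_measurableB => //.
      by apply: simple_strongly_measurable; case: (ss n).
    have m2 : measurable_fun setT (fun x => `|t n x - g x|%:E).
      apply: measurable_EFin_norm; apply: strongly_measurableB => //.
      by apply: simple_strongly_measurable; case: (st n).
    rewrite -ge0_integralZl//= -ge0_integralD//; last first.
      by apply: emeasurable_funM => //; exact: measurable_cst.
    apply: ge0_le_integral => //.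
    * apply: measurable_EFin_norm; apply: strongly_measurableB => //.
        exact: simple_strongly_measurable.
      by have := strongly_measurable_lin a mf mg.
    * apply: emeasurable_funD => //.
      by apply: emeasurable_funM => //; exact: measurable_cst.
    * move=> x _; rewrite -EFinM -EFinD lee_fin -normrZ.
      by rewrite opprD addrACA -scalerBr ler_normD.
  + exact: cvg_cst.
  + rewrite -[X in _ --> X](_ : (`|a|%:E * 0 + 0)%E = 0%E); last by rewrite mule0 adde0.
    by apply: cvgeD => //; apply: cvgeZl.
- rewrite (_ : (fun n => _) = (fun n => a *: simple_integral mu (s n) +
    simple_integral mu (t n))).
    by apply: cvgD => //; apply: cvgZl_tmp.
  by apply/funext => n; rewrite simple_integral_lin//; [case: (ss n)|case: (st n)].
Qed.

Lemma bochner_norm f I : bi f I -> (`|I|%:E <= \int[mu]_x `|f x|%:E)%E.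
Proof.
move=> bf; have mf := bochner_strongly_measurable bf.
apply/lee_addgt0Pr => e e0; have e20 : 0 < e / 2 by rewrite divr_gt0.
have [s [ss sL sI]] := bochner_approx bf e20.
have ms := simple_strongly_measurable ss.
have := integral_norm_triangle ms mf (strongly_measurable_cst T 0).
rewrite (_ : (fun x : T => `|s x - 0|%:E) = fun x => `|s x|%:E); last first.
  by apply/funext => x; rewrite subr0.
rewrite (_ : (fun x : T => `|f x - 0|%:E) = fun x => `|f x|%:E); last first.
  by apply/funext => x; rewrite subr0.
move=> /(le_trans (simple_integral_norm mufin ss)) H.
rewrite -[I](subrK (simple_integral mu s)).
apply: (@le_trans _ _ ((e / 2)%:E + `|simple_integral mu s|%:E)%E).
  by rewrite -EFinD lee_fin (le_trans (ler_normD _ _))// lerD2r.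
rewrite [in leRHS](splitr e) EFinD [leRHS]addeC -addeA; apply: leeD => //.
by apply: le_trans H _; apply: leeD.
Qed.

Lemma bochner_uniq f I J : bi f I -> bi f J -> I = J.
Proof.
move=> bI bJ; have /bochner_norm := bochner_lin (-1) bI bJ.
rewrite integral0_eq => [|x _]; last by rewrite scaleN1r addNr normr0.
by rewrite lee_fin normr_le0 scaleN1r addrC subr_eq0 => /eqP.
Qed.

(** The approximation of the integrand has to converge at every point, so on the exceptional null
    set the simple functions for f are replaced by ones that converge to g. *)
Lemma bochner_ae f g I : bi f I -> strongly_measurable g ->
  (\forall x \ae mu, f x = g x) -> bi g I.
Proof.
move=> bf mg fg; have mf := bochner_strongly_measurable bf.
case: bf => [s [ss sf sL sI]]; have [t st tg] := mg.
have [N [mN N0 fgN]] := fg.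
have nN : \forall x \ae mu, x \notin N.
  by exists N; split => // x /=; rewrite notin_setE => /contrapT.
pose u n x := if x \in N then t n x else s n x.
have su n : simple (u n).
  have := simple_comp2 (fun a (v : R^o * X) => if v.1 == 0 then v.2 else a) (st n)
   (simple_comp2 (fun (a : R^o) b => (a, b)) (simple_indic (1 : R^o) mN) (ss n).1).
  congr simple; apply/funext => x /=; rewrite indicE /u.
  by case: (x \in N); rewrite /= ?scale1r ?scale0r ?oner_eq0 ?eqxx.
exists u; split.
- move=> n; split=> // y _; rewrite -ge0_fin_numE//.
  by apply: finite_measure_fin_num => //; case: (su n).
- move=> x; rewrite /u; case: (boolP (x \in N)) => xN; first exact: tg.
  suff -> : g x = f x by exact: sf.
  apply/esym; apply: contrapT => /fgN xN'.
  by move: xN; rewrite notin_setE.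
- rewrite -(_ : (fun n => \int[mu]_x `|s n x - f x|%:E)%E =
    fun n => (\int[mu]_x `|u n x - g x|%:E)%E)//.
  apply/funext => n; apply: ae_eq_integral => //.
  + apply: measurable_EFin_norm; apply: strongly_measurableB => //.
    by apply: simple_strongly_measurable; case: (ss n).
  + apply: measurable_EFin_norm; apply: strongly_measurableB => //.
    exact: simple_strongly_measurable.
  + by apply: filterS2 fg nN => x -> /negbTE xN _; rewrite /u xN.
- rewrite -(_ : (fun n => simple_integral mu (s n)) =
    fun n => simple_integral mu (u n))//.
  apply/funext => n.
  have := simple_integral_norm mufin (simple_lin (-1) (ss n).1 (su n)).
  rewrite (_ : (\int[mu]_x _ = 0)%E); last first.
    rewrite -[RHS](@integral0 _ _ _ mu setT); apply: ae_eq_integral => //.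
      apply: measurable_EFin_norm; apply: simple_strongly_measurable.
      by apply: simple_lin => //; case: (ss n).
    apply: filterS nN => x /negbTE xN _ /=.
    by rewrite /u xN scaleN1r addNr normr0.
  rewrite simple_integral_lin//; last by case: (ss n).
  by rewrite lee_fin normr_le0 scaleN1r addrC subr_eq0 => /eqP.
Qed.

Lemma bochner_simple (s : T -> X) : simple s -> bi s (simple_integral mu s).
Proof.
move=> ss; exists (fun=> s); split.
- move=> n; split=> // y _; rewrite -ge0_fin_numE//.
  by apply: finite_measure_fin_num => //; case: ss.
- by move=> x; exact: cvg_cst.
- apply: cvg_near_cst; apply: nearW => n.
  by rewrite integral0_eq// => x _; rewrite subrr normr0.
- exact: cvg_cst.
Qed.

Lemma bochner_indic (A : set T) (y : X) : measurable A ->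
  bi (fun x => \1_A x *: y) (fine (mu A) *: y).
Proof.
by move=> mA; have := bochner_simple (simple_indic y mA); rewrite simple_integral_indic.
Qed.

Lemma dominated_cvg_L1 (s : (T -> X)^nat) f (g : T -> R) :
  (forall n, strongly_measurable (s n)) -> strongly_measurable f ->
  (\forall x \ae mu, s n x @[n --> \oo] --> f x) ->
  mu.-integrable setT (EFin \o g) -> (forall n x, `|s n x - f x| <= g x) ->
  (\int[mu]_x `|s n x - f x|%:E)%E @[n --> \oo] --> 0%E.
Proof.
move=> ms mf sf ig sg.
have := @dominated_convergence _ _ _ mu setT measurableT
  (fun n x => `|s n x - f x|%:E) (cst 0%E) (EFin \o g).
case.
- by move=> n; apply: measurable_EFin_norm; exact: strongly_measurableB.
- exact: measurable_cst.
- apply: filterS sf => x sfx _; apply: cvg_EFin; first exact: nearW.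
  rewrite -[X in _ --> X](_ : `|f x - f x| = 0); last by rewrite subrr normr0.
  by apply: cvg_norm; apply: cvgB; [exact: sfx|exact: cvg_cst].
- exact: ig.
- by apply: aeW => x n _; rewrite /= normr_id lee_fin.
by move=> _ _; rewrite integral0.
Qed.

End BochnerTheory.

(** Dominated simple approximants converge in the mean, hence their integrals form a Cauchy sequence
    in X. *)
Lemma bochner_exists d (T : measurableType d) (R : realType)
    (mu : {measure set T -> \bar R}) (X : completeNormedModType R) (f : T -> X) :
  (mu setT < +oo)%E -> strongly_measurable f ->
  (\int[mu]_x `|f x|%:E < +oo)%E -> exists I, is_bochner_integral mu f I.
Proof.
move=> mufin mf ff.
have [s [ss sf sle]] := dominated_simple_approx mf.
have sL : (\int[mu]_x `|s n x - f x|%:E)%E @[n --> \oo] --> 0%E.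
  (* The factor 3 is 2 from the domination of [s n], plus 1 for f itself. *)
  apply: (@dominated_cvg_L1 _ _ _ mu X s f (fun x => 3 * `|f x|)) => //.
  - by move=> n; exact: simple_strongly_measurable.
  - exact: aeW.
  - rewrite (_ : _ \o _ = fun x => (3%:E * `|f x|%:E)%E); last first.
      by apply/funext => x; rewrite /= EFinM.
    apply: integrableZl => //; apply/integrableP; split.
      exact: measurable_EFin_norm.
    by under eq_integral do rewrite gee0_abs//.
  - move=> n x; rewrite (le_trans (ler_normB _ _))//.
    by rewrite (le_trans (lerD (sle n x) (lexx _)))//; lra.
have /cvg_ex[I sI] : cvg (simple_integral mu (s n) @[n --> \oo]).
  apply: cauchy_cvg; apply: cauchy_exP => e e0.
  have e20 : 0 < e / 3 by rewrite divr_gt0.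
  have /fine_cvgP[sfin /cvgrPdist_le/(_ _ e20) sL'] := sL.
  have [N _ HN] := filterI sfin sL'.
  have H n : (N <= n)%N -> (\int[mu]_x `|s n x - f x|%:E <= (e / 3)%:E)%E.
    move=> /HN[n2 n3]; rewrite -[leLHS]fineK// lee_fin (le_trans (ler_norm _))//.
    by move: n3; rewrite /= sub0r normrN.
  exists (simple_integral mu (s N)); exists N => // n /= Nn.
  rewrite -ball_normE /ball_/=.
  have := simple_integral_norm mufin (simple_lin (-1) (ss n) (ss N)).
  rewrite simple_integral_lin// scaleN1r addrC.
  have -> : (\int[mu]_x `|-1 *: s n x + s N x|%:E = \int[mu]_x `|s N x - s n x|%:E)%E.
    by apply: eq_integral => x _; rewrite scaleN1r addrC.
  have ms n := simple_strongly_measurable (ss n).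
  move=> /le_trans/(_ (integral_norm_triangle mu (ms N) mf (ms n))).
  rewrite (integral_norm_sym mu f).
  move=> /le_trans/(_ (leeD (H _ (leqnn _)) (H _ Nn))).
  by rewrite -EFinD lee_fin => /le_lt_trans; apply; lra.
exists I, s; split => // n; split=> // y _; rewrite -ge0_fin_numE//.
by apply: finite_measure_fin_num => //; case: (ss n).
Qed.

(** * Bochner $L^p$ spaces *)

Section LpClasses.
Context d (T : measurableType d) (R : realType) (mu : {measure set T -> \bar R}).
Context (p : R) (p1 : 1 <= p) (X : normedModType R).
Implicit Types f g : T -> X.
Local Notation toLp := (@toLp _ T R mu p p1 X).
Local Notation Lp := (bochnerLp mu p1 X).

Let p_gt0 : 0 < p. Proof. exact: lt_le_trans p1. Qed.

(** The integral of the p-th power is the form to which integral lemmas apply directly; [memLpP]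
    ties it to [bLfun]. *)
Definition memLp f := strongly_measurable f /\
  (\int[mu]_x (`|f x| `^ p)%:E < +oo)%E.

Lemma measurable_norm_powR f : strongly_measurable f ->
  measurable_fun setT (fun x => (`|f x| `^ p)%:E).
Proof.
move=> mf; apply/measurable_EFinP; apply: (measurableT_comp (measurable_powR p)).
exact: strongly_measurable_norm.
Qed.

Let LnormE f : ('N[mu]_p%:E[EFin \o norm_fun f] =
  (\int[mu]_x (`|f x| `^ p)%:E) `^ p^-1)%E.
Proof.
rewrite unlock; under eq_integral => x _ do rewrite /= normr_id.
by [].
Qed.

Let finite_normE f : finite_norm mu p%:E (norm_fun f) =
  (\int[mu]_x (`|f x| `^ p)%:E < +oo)%E.
Proof.
rewrite /finite_norm LnormE; apply/idP/idP => [|]; last exact: poweR_lty.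
by apply: lty_poweRy; rewrite invr_eq0 gt_eqF.
Qed.

Lemma memLpP f : memLp f <-> f \in bLfun mu p1.
Proof. by split=> [[mf ff]|/bLfunP[mf ff]]; [apply/bLfunP|]; split; rewrite ?finite_normE// -finite_normE. Qed.

Lemma memLp_lin (a : R) f g : memLp f -> memLp g -> memLp (fun x => a *: f x + g x).
Proof.
move=> /memLpP mf /memLpP mg; apply/memLpP.
have [_ H] := @bLfun_submod_closed _ _ _ mu _ p1 X; exact: H.
Qed.

Lemma memLp0 : memLp (fun=> 0).
Proof. by apply/memLpP; have [H _] := @bLfun_submod_closed _ _ _ mu _ p1 X; exact: H. Qed.

Lemma memLpZ (a : R) f : memLp f -> memLp (fun x => a *: f x).
Proof.
move=> mf; have := memLp_lin a mf memLp0.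
by congr memLp; apply/funext => x; rewrite addr0.
Qed.

Lemma memLpD f g : memLp f -> memLp g -> memLp (fun x => f x + g x).
Proof.
move=> mf mg; have := memLp_lin 1 mf mg.
by congr memLp; apply/funext => x; rewrite scale1r.
Qed.

Lemma memLpB f g : memLp f -> memLp g -> memLp (fun x => f x - g x).
Proof.
move=> mf mg; have := memLp_lin (-1) mg mf.
by congr memLp; apply/funext => x; rewrite scaleN1r addrC.
Qed.

Lemma memLp_fun (F : Lp) : memLp F.
Proof. by apply/memLpP; exact: blfun_subproof. Qed.

Let toLpE f (mf : f \in bLfun mu p1) : toLp f = bochnerLp_class (BLfun mf).
Proof.
rewrite /Defs.toLp; case: pselect => [mf'|/(_ mf)//].
by congr bochnerLp_class; congr BLfun; exact: bool_irrelevance.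
Qed.

Lemma toLp_ae_eq f : memLp f -> \forall x \ae mu, toLp f x = f x.
Proof. by move=> /memLpP mf; rewrite toLpE; exact: bochnerLp_classK. Qed.

Lemma Lp_ext (F G : Lp) : (\forall x \ae mu, F x = G x) -> F = G.
Proof.
by move=> FG; rewrite -[F]bochnerLp_reprK -[G]bochnerLp_reprK; apply/bochnerLp_classP.
Qed.

Lemma eq_toLp f g : memLp f -> memLp g -> (\forall x \ae mu, f x = g x) ->
  toLp f = toLp g.
Proof.
move=> mf mg fg; apply: Lp_ext.
by apply: filterS3 (toLp_ae_eq mf) (toLp_ae_eq mg) fg => x -> -> ->.
Qed.

Lemma toLp_fun (F : Lp) : toLp F = F.
Proof. by apply: Lp_ext; apply: toLp_ae_eq; exact: memLp_fun. Qed.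

Lemma toLp_lin (a : R) f g : memLp f -> memLp g ->
  toLp (fun x => a *: f x + g x) = a *: toLp f + toLp g.
Proof.
move=> mf mg; have mfg := memLp_lin a mf mg.
move: mf mg mfg => /memLpP mf /memLpP mg /memLpP mfg.
rewrite !toLpE [_ *: _]bochnerLp_classZ -bochnerLp_classD.
by apply/bochnerLp_classP; exact: aeW.
Qed.

Lemma toLpD f g : memLp f -> memLp g ->
  toLp (fun x => f x + g x) = toLp f + toLp g.
Proof.
move=> mf mg; rewrite -[toLp f]scale1r -toLp_lin//; congr Defs.toLp.
by apply/funext => x; rewrite scale1r.
Qed.

Lemma toLpB f g : memLp f -> memLp g ->
  toLp (fun x => f x - g x) = toLp f - toLp g.
Proof.
move=> mf mg; rewrite [RHS]addrC -[- toLp g]scaleN1r -toLp_lin//; congr Defs.toLp.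
by apply/funext => x; rewrite scaleN1r addrC.
Qed.

Lemma toLp0 : toLp (fun=> 0) = 0.
Proof.
by have := toLpB memLp0 memLp0; rewrite !subrr.
Qed.

Lemma Lp_norm_pow (F : Lp) : ((`|F| `^ p)%:E = \int[mu]_x (`|F x| `^ p)%:E)%E.
Proof.
have [mF fF] := memLp_fun F.
have -> : `|F| = fine 'N[mu]_p%:E[EFin \o norm_fun F] by [].
rewrite -poweR_EFin fineK; last first.
  rewrite ge0_fin_numE ?Lnorm_ge0//.
  by have := finite_normE F; rewrite fF /finite_norm.
rewrite LnormE -poweRrM mulVf ?gt_eqF// poweRe1//.
by apply: integral_ge0 => x _; rewrite lee_fin powR_ge0.
Qed.

Lemma toLp_norm_pow f : memLp f ->
  ((`|toLp f| `^ p)%:E = \int[mu]_x (`|f x| `^ p)%:E)%E.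
Proof.
move=> mf; rewrite Lp_norm_pow; apply: ae_eq_integral => //.
- by apply: measurable_norm_powR; case: (memLp_fun (toLp f)).
- by apply: measurable_norm_powR; case: mf.
- by apply: filterS (toLp_ae_eq mf) => x -> _.
Qed.

Lemma toLp_norm_le f (c : R) : memLp f -> 0 <= c ->
  (\int[mu]_x (`|f x| `^ p)%:E <= (c `^ p)%:E)%E -> `|toLp f| <= c.
Proof.
move=> mf c0; rewrite -toLp_norm_pow// lee_fin => H.
rewrite leNgt; apply/negP => cf; move: H; rewrite leNgt => /negP; apply.
by rewrite gt0_ltr_powR// nnegrE.
Qed.

Hypothesis mufin : (mu setT < +oo)%E.

Lemma memLp_bounded f (M : R) : strongly_measurable f ->
  (forall x, `|f x| <= M) -> memLp f.
Proof.
move=> mf fM; split=> //.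
apply: (@le_lt_trans _ _ (\int[mu]_x (M `^ p)%:E)%E).
  apply: ge0_le_integral => //.
  - exact: measurable_norm_powR.
  - move=> x _; rewrite lee_fin ge0_ler_powR ?nnegrE ?(ltW p_gt0)//.
    exact: le_trans (fM x).
by rewrite integral_cst// lte_mul_pinfty// lee_fin powR_ge0.
Qed.

(** Its purpose is the gain [m ^ (1/p)] when the support is small: a merely bounded function
    contributes little on a thin strip. *)
Lemma toLp_norm_bounded f (A : set T) (M m : R) : measurable A ->
  strongly_measurable f -> 0 <= M -> (mu A <= m%:E)%E ->
  (forall x, A x -> `|f x| <= M) -> (forall x, ~ A x -> f x = 0) ->
  `|toLp f| <= M * m `^ p^-1.
Proof.
move=> mA mf M0 Am fM f0.
have m0 : 0 <= m by rewrite -lee_fin (le_trans _ Am).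
have mLf : memLp f.
  apply: (memLp_bounded (M := M)) => // x.
  by have [/fM//|/f0 ->] := pselect (A x); rewrite normr0.
apply: toLp_norm_le => //; first by rewrite mulr_ge0// powR_ge0.
rewrite powRM ?powR_ge0// -powRrM mulVf ?gt_eqF// powRr1//.
apply: (@le_trans _ _ (\int[mu]_x (M `^ p * \1_A x)%:E)%E).
  apply: ge0_le_integral => //.
  - exact: measurable_norm_powR.
  - by apply/measurable_EFinP; apply: measurable_funM => //; exact: measurable_indic.
  - move=> x _; rewrite lee_fin indicE.
    have [/set_mem xA|] := boolP (x \in A).
      by rewrite mulr1 ge0_ler_powR// ?nnegrE// ?fM// ltW.
    by rewrite notin_setE => /f0 ->; rewrite normr0 powR0 ?mulr0// gt_eqF.
rewrite (@integralZl_indic _ _ _ mu setT _ (fun=> A))//; last first.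
  by rewrite ltNge powR_ge0.
by rewrite integral_indic// setIT EFinM lee_wpmul2l// lee_fin powR_ge0.
Qed.

End LpClasses.

Lemma cvg_powR (R : realType) (p : R) (a : R^nat) (l : R) : 0 < p ->
  (forall n, 0 <= a n) -> 0 <= l -> a n @[n --> \oo] --> l ->
  a n `^ p @[n --> \oo] --> l `^ p.
Proof.
move=> p0 a0 l0 al.
move: l0; rewrite le_eqVlt => /predU1P[l0|l0].
  rewrite -l0 in al *; rewrite powR0 ?gt_eqF//.
  apply/cvgr0Pnorm_le => e e0.
  have e1 : 0 < e `^ p^-1 by rewrite powR_gt0.
  move/cvgr0Pnorm_le : al => /(_ _ e1); apply: filterS => n.
  rewrite !ger0_norm ?powR_ge0// => ae.
  have := ge0_ler_powR (ltW p0) _ _ ae; rewrite !nnegrE a0 powR_ge0 => /(_ isT isT).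
  by rewrite -powRrM mulVf ?gt_eqF// powRr1// ltW.
rewrite {2}/powR gt_eqF//.
have : expR (p * ln (a n)) @[n --> \oo] --> expR (p * ln l).
  apply: (@cvg_comp _ _ _ (fun n => p * ln (a n)) expR \oo (nbhs (p * ln l)));
    last exact: continuous_expR.
  apply: cvgMl_tmp.
  exact: (@cvg_comp _ _ _ a (@ln R) \oo (nbhs l) _ al (continuous_ln l0)).
apply: cvg_trans; apply: near_eq_cvg.
have /cvgr_gt/(_ _ l0) := al; apply: filterS => n an0.
by rewrite /powR gt_eqF.
Qed.

(** * Dominated convergence and density of simple functions in L^p *)

Section LpDensity.
Context d (T : measurableType d) (R : realType) (mu : {measure set T -> \bar R}).
Context (p : R) (p1 : 1 <= p) (X : normedModType R).
Hypothesis mufin : (mu setT < +oo)%E.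
Implicit Types f g : T -> X.
Local Notation toLp := (@toLp _ T R mu p p1 X).
Local Notation Lp := (bochnerLp mu p1 X).

Let p_gt0 : 0 < p. Proof. exact: lt_le_trans p1. Qed.

Lemma dominated_cvg_Lp (s : (T -> X)^nat) f (g : T -> R) :
  (forall n, memLp mu p (s n)) -> memLp mu p f ->
  (\forall x \ae mu, s n x @[n --> \oo] --> f x) ->
  (forall n x, `|s n x - f x| <= g x) ->
  mu.-integrable setT (fun x => (g x `^ p)%:E) ->
  toLp (s n) @[n --> \oo] --> toLp f.
Proof.
move=> ms mf sf sg ig.
have H1 : {ae mu, forall x, setT x ->
    (`|s n x - f x| `^ p)%:E @[n --> \oo] --> cst 0%E x}.
  apply: filterS sf => x sfx _; apply: cvg_EFin; first exact: nearW.
  rewrite -[X in _ --> X](_ : `|f x - f x| `^ p = 0).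
    apply: cvg_powR => //; apply: cvg_norm.
    by apply: cvgB; [exact: sfx|exact: cvg_cst].
  by rewrite subrr normr0 powR0// gt_eqF.
have H2 : {ae mu, forall x n, setT x -> (`|(`|s n x - f x| `^ p)%:E| <= (g x `^ p)%:E)%E}.
  apply: aeW => x n _; rewrite gee0_abs ?lee_fin ?powR_ge0//.
  by rewrite ge0_ler_powR ?nnegrE ?(ltW p_gt0)// (le_trans _ (sg n x)).
have [_ + _] := @dominated_convergence _ _ _ mu setT measurableT
  (fun n x => (`|s n x - f x| `^ p)%:E) (cst 0%E) (fun x => (g x `^ p)%:E)
  (fun n => measurable_norm_powR p (strongly_measurableB (ms n).1 mf.1))
  (measurable_cst _) H1 ig H2.
move=> cvg0.
apply/cvgrPdist_le => e e0.
have e1 : 0 < e `^ p by rewrite powR_gt0.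
have /fine_cvgP[sfin /cvgrPdist_le/(_ _ e1) sL'] := cvg0.
near=> n.
rewrite distrC -toLpB; [|exact: ms|exact: mf].
apply: (toLp_norm_le p1 (memLpB p1 (ms n) mf) (ltW e0)).
rewrite (_ : (\int[mu]_x (`|s n x - f x| `^ p)%:E)%E =
  (\int[mu]_x `|(`|s n x - f x| `^ p)%:E - cst 0%R x|)%E); last first.
  by apply: eq_integral => x _; rewrite -EFinB subr0 gee0_abs// lee_fin powR_ge0.
rewrite -[leLHS]fineK; last by near: n.
rewrite lee_fin (le_trans (ler_norm _))// -normrN -[X in `|X|]add0r.
by near: n.
Unshelve. all: by end_near. Qed.

Lemma simple_memLp (s : T -> X) : simple s -> memLp mu p s.
Proof.
move=> ss; have [r _ xr] := finite_range_seq ss.1.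
apply: (memLp_bounded p1 mufin (M := \sum_(y <- r) `|y|)).
  exact: simple_strongly_measurable.
by move=> x; rewrite (big_rem (s x))//= lerDl sumr_ge0.
Qed.

Lemma simple_dense_Lp (F : Lp) (e : R) : 0 < e ->
  exists2 s, simple s & `|F - toLp s| <= e.
Proof.
move=> e0; have mF := memLp_fun F.
have [s [ss sF sle]] := dominated_simple_approx mF.1.
have /cvgrPdist_le/(_ _ e0) [N _ HN] : toLp (s n) @[n --> \oo] --> toLp F.
  apply: (@dominated_cvg_Lp s F (fun x => `|3 *: F x|) (fun n => simple_memLp (ss n)) mF
      (aeW _ sF)).
  - move=> n x; rewrite (le_trans (ler_normB _ _))// normrZ ger0_norm//.
    by rewrite (le_trans (lerD (sle n x) (lexx _)))//; lra.
  - have [m3 f3] := memLpZ p1 3 mF.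
    apply/integrableP; split; first exact: measurable_norm_powR.
    by under eq_integral do rewrite gee0_abs ?lee_fin ?powR_ge0//.
by exists (s N) => //; have := HN N (leqnn N); rewrite toLp_fun.
Qed.

(* From [y <= a + y^p / a^(p-1)]. *)
Lemma L1_le_Lp f (a : R) : memLp mu p f -> 0 < a -> `|toLp f| <= a ->
  (\int[mu]_x `|f x|%:E <= (a * (fine (mu setT) + 1))%:E)%E.
Proof.
move=> mf a0 fa.
have muT : mu setT \is a fin_num by exact: finite_measure_fin_num.
apply: (@le_trans _ _ (\int[mu]_x (a%:E + ((a `^ (p - 1))^-1)%:E * (`|f x| `^ p)%:E))%E).
  apply: ge0_le_integral => //.
  - exact: measurable_EFin_norm mf.1.
  - apply: emeasurable_funD; first exact: measurable_cst.
    apply: emeasurable_funM; first exact: measurable_cst.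
    exact: measurable_norm_powR mf.1.
  - move=> x _; rewrite -EFinM -EFinD lee_fin.
    have [fxa|afx] := leP `|f x| a.
      by rewrite (le_trans fxa)// lerDl mulr_ge0 ?invr_ge0 ?powR_ge0.
    have fx0 : 0 < `|f x| by apply: lt_trans afx.
    rewrite (@le_trans _ _ ((a `^ (p - 1))^-1 * `|f x| `^ p))//; last by rewrite lerDr ltW.
    rewrite ler_pdivlMl ?powR_gt0//.
    have -> : `|f x| `^ p = `|f x| `^ (p - 1) * `|f x|.
      rewrite -{3}[`|f x|]powRr1 ?ltW// -powRD ?subrK//.
      by apply/implyP => _; rewrite gt_eqF.
    by rewrite ler_pM2r// ge0_ler_powR ?nnegrE ?subr_ge0// ltW.
rewrite ge0_integralD//; last 3 first.
- by move=> x _; rewrite lee_fin ltW.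
- by move=> x _; rewrite -EFinM lee_fin mulr_ge0 ?invr_ge0 ?powR_ge0.
- apply: emeasurable_funM; first exact: measurable_cst.
  exact: measurable_norm_powR mf.1.
rewrite integral_cst// ge0_integralZl//; last 2 first.
- exact: measurable_norm_powR mf.1.
- by rewrite lee_fin invr_ge0 powR_ge0.
rewrite -toLp_norm_pow// -[mu setT]fineK// -!EFinM -EFinD lee_fin fineK//.
rewrite mulrDr mulr1 lerD2l ler_pdivrMl ?powR_gt0//.
have -> : a `^ (p - 1) * a = a `^ p.
  rewrite -{2}[a]powRr1 ?ltW// -powRD ?subrK//.
  by apply/implyP => _; rewrite gt_eqF.
by rewrite ge0_ler_powR ?nnegrE ?(ltW p_gt0) ?(ltW a0).
Qed.

End LpDensity.

(** Two balls that belong to a proper filter meet, so centres of balls of radius [2^-n / 4] in the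
    filter have increments of at most [2^-n]; the limit of the centres is the limit of the
    filter. *)
Lemma cauchy_pow2_complete (R : realType) (V : normedModType R) :
  (forall u : V^nat, (forall n, `|u n.+1 - u n| <= 2^-1 ^+ n) -> cvgn u) ->
  forall F : set_system V, ProperFilter F -> cauchy F -> cvg F.
Proof.
move=> H F FF Fc.
have rp n : (0 : R) < 4^-1 * 2^-1 ^+ n by rewrite mulr_gt0// ?invr_gt0// exprn_gt0.
have /choice[u uF] : forall n, exists x, F (ball x (4^-1 * 2^-1 ^+ n : R)).
  by move=> n; exact: ((cauchyP F).1 Fc).
have ballE x (e : R) y : ball x e y -> `|x - y| < e by rewrite -ball_normE.
have uu n m : `|u n - u m| < 4^-1 * 2^-1 ^+ n + 4^-1 * 2^-1 ^+ m.
  have [y [/ballE h1 /ballE h2]] := filter_ex (filterI (uF n) (uF m)).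
  by rewrite (le_lt_trans (ler_distD y _ _))// ltrD// distrC.
have /H/cvg_ex[l ul] : forall n, `|u n.+1 - u n| <= 2^-1 ^+ n.
  move=> n; rewrite ltW// (lt_le_trans (uu _ _))// exprS.
  have : 0 <= (2^-1 : R) ^+ n by rewrite exprn_ge0.
  by lra.
apply/cvg_ex; exists l; apply/cvgrPdist_lt => e e0.
have e20 : 0 < e / 2 by rewrite divr_gt0.
have : (2^-1 ^+ n : R) @[n --> \oo] --> (0 : R).
  by apply: cvg_expr; rewrite ger0_norm ?invr_ge0// invf_lt1// ltr1n.
move=> /cvgr0Pnorm_lt/(_ _ e20) h1.
have /cvgrPdist_lt/(_ _ e20) h2 := ul.
have [n [n1 n2]] := filter_ex (filterI h1 h2).
apply: filterS (uF n) => y /ballE uy.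
rewrite (le_lt_trans (ler_distD (u n) _ _))// (splitr e) ltrD//.
move: n1; rewrite ger0_norm ?exprn_ge0// => n1.
have : 0 <= (2^-1 : R) ^+ n by rewrite exprn_ge0.
by lra.
Qed.

(** * Completeness of L^p *)

Section RieszFischer.
Context d (T : measurableType d) (R : realType) (mu : {measure set T -> \bar R}).
Context (p : R) (p1 : 1 <= p) (X : completeNormedModType R).
Hypothesis mufin : (mu setT < +oo)%E.
Local Notation toLp := (@toLp _ T R mu p p1 X).
Local Notation Lp := (bochnerLp mu p1 X).

Let p_gt0 : 0 < p. Proof. exact: lt_le_trans p1. Qed.

Lemma geometric_partial_sum (n m : nat) :
  \sum_(n <= k < n + m) (2^-1 ^+ k : R) <= 2 * 2^-1 ^+ n.
Proof.
suff -> : \sum_(n <= k < n + m) (2^-1 ^+ k : R) = 2 * 2^-1 ^+ n - 2 * 2^-1 ^+ (n + m).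
  by rewrite gerBl mulr_ge0// exprn_ge0.
elim: m => [|m IH]; first by rewrite addn0 big_geq// subrr.
rewrite addnS big_nat_recr ?leq_addr//= IH exprS; lra.
Qed.

(** The sum of the norms of the increments has a finite integral, hence is finite almost everywhere,
    and there the telescoping series converges absolutely. *)
Lemma simple_cauchy_cvg_ae (s : (T -> X)^nat) (C : R) :
  (forall n, simple (s n)) ->
  (forall n, (\int[mu]_x `|s n.+1 x - s n x|%:E <= (C * 2^-1 ^+ n)%:E)%E) ->
  \forall x \ae mu, cvgn (s ^~ x).
Proof.
move=> ss sC.
have ms n : strongly_measurable (s n) by exact: simple_strongly_measurable.
have md n : measurable_fun setT (fun x => `|s n.+1 x - s n x|%:E).
  by apply: measurable_EFin_norm; exact: strongly_measurableB.
have C0 : 0 <= C.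
  have := sC 0%N; rewrite expr0 mulr1 -lee_fin; apply: le_trans.
  exact: integral_ge0.
pose h x := (\sum_(n <oo) `|s n.+1 x - s n x|%:E)%E.
have mh : measurable_fun setT h.
  by apply: ge0_emeasurable_sum => // n x _ _; rewrite lee_fin.
have hfin : (\int[mu]_x h x < +oo)%E.
  rewrite integral_nneseries//.
  apply: (@le_lt_trans _ _ (C * 2)%:E); last exact: ltry.
  apply: lime_le; first by apply: is_cvg_nneseries => n _ _; exact: integral_ge0.
  apply: nearW => n.
  apply: (@le_trans _ _ (\sum_(0 <= k < n) (C * 2^-1 ^+ k)%:E)%E).
    by apply: lee_sum => k _; exact: sC.
  rewrite sumEFin lee_fin -mulr_sumr ler_wpM2l//.
  by have := geometric_partial_sum 0 n; rewrite add0n expr0 mulr1.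
have ih : mu.-integrable setT h.
  apply/integrableP; split => //.
  under eq_integral => x _.
    rewrite gee0_abs; last by apply: nneseries_ge0 => n _ _; rewrite lee_fin.
    over.
  exact: hfin.
apply: filterS (integrable_ae measurableT ih) => x /(_ Logic.I) hx.
have : cvgn [normed series (fun n => s n.+1 x - s n x)].
  have hc : (\sum_(0 <= k < n) `|s k.+1 x - s k x|%:E)%E @[n --> \oo] --> h x.
    by apply: is_cvg_nneseries => n _ _; rewrite lee_fin.
  apply/cvg_ex; exists (fine (h x)).
  rewrite -[h x]fineK// in hc; have /fine_cvgP[_ hc'] := hc.
  apply: cvg_trans hc'; apply: near_eq_cvg; apply: nearW => n /=.
  by rewrite sumEFin.
move=> /normed_cvg/cvg_ex[l sl]; apply/cvg_ex; exists (s 0%N x + l).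
have -> : s ^~ x = fun n => s 0%N x + series (fun n => s n.+1 x - s n x) n.
  by apply/funext => n; rewrite (eq_sum_telescope (s ^~ x)).
by apply: cvgD => //; exact: cvg_cst.
Qed.

(** Each class is first replaced by a simple function within [2^-n], so that the pointwise limit is
    strongly measurable by definition. Convergence in norm then comes from Fatou's lemma. *)
Lemma Lp_cvg_pow2 (u : Lp^nat) : (forall n, `|u n.+1 - u n| <= 2^-1 ^+ n) -> cvgn u.
Proof.
move=> uS.
have /choice[s su] : forall n, exists s : T -> X, simple s /\ `|u n - toLp s| <= 2^-1 ^+ n.
  move=> n; have [|s ss us] := @simple_dense_Lp _ _ _ _ _ p1 X mufin (u n) (2^-1 ^+ n).
    by rewrite exprn_gt0.
  by exists s.
have ss n : simple (s n) by case: (su n).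
have ms n := simple_memLp p1 mufin (ss n).
have dS n : `|toLp (s n.+1) - toLp (s n)| <= 3 * 2^-1 ^+ n.
  have -> : toLp (s n.+1) - toLp (s n) = (toLp (s n.+1) - u n.+1) + ((u n.+1 - u n) + (u n - toLp (s n))).
    by rewrite addrA subrKA subrKA.
  rewrite (le_trans (ler_normD _ _))//.
  have h1 : `|toLp (s n.+1) - u n.+1| <= 2^-1 ^+ n.
    rewrite distrC (le_trans (su n.+1).2)// exprS ler_piMl ?exprn_ge0//.
    by rewrite invf_le1// ler1n.
  rewrite (le_trans (lerD h1 (ler_normD _ _)))//.
  by rewrite (le_trans (lerD (lexx _) (lerD (uS n) (su n).2)))//; lra.
(* The 6 is 3 from consecutive terms times 2 from the geometric series; the final 7 adds the
   distance from [s n] to [u n]. *)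
have dsum n m : `|toLp (s (n + m)%N) - toLp (s n)| <= 6 * 2^-1 ^+ n.
  apply: (@le_trans _ _ (\sum_(n <= k < n + m) 3 * 2^-1 ^+ k)); last first.
    rewrite -mulr_sumr (le_trans (ler_wpM2l _ (geometric_partial_sum n m)))//.
    by rewrite mulrA -natrM.
  elim: m => [|m IH]; first by rewrite addn0 subrr normr0 big_geq.
  rewrite addnS big_nat_recr ?leq_addr//=.
  by rewrite (le_trans (ler_distD (toLp (s (n + m)%N)) _ _))// addrC lerD.
have [N [mN N0 sN]] : \forall x \ae mu, cvgn (s ^~ x).
  apply: (@simple_cauchy_cvg_ae _ (3 * (fine (mu setT) + 1))) => // n.
  have a0 : (0 : R) < 3 * 2^-1 ^+ n by rewrite mulr_gt0// exprn_gt0.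
  have := L1_le_Lp (p1 := p1) mufin (memLpB p1 (ms n.+1) (ms n)) a0.
  rewrite toLpB// => /(_ (dS n)) /le_trans; apply.
  by rewrite lee_fin mulrAC.
(* Zeroing on the null set keeps the functions simple and makes them converge at every point, as
   strong measurability demands. *)
pose t n x := if x \in N then 0 else s n x.
pose g x := lim (t n x @[n --> \oo]).
have tg x : t n x @[n --> \oo] --> g x.
  rewrite /g /t; case: (boolP (x \in N)) => xN; first exact: is_cvg_cst.
  by apply: contrapT => /sN; move: xN; rewrite notin_setE.
have st n : simple (t n).
  have := simple_comp2 (fun a (v : R^o) => if v == 0 then a else 0) (ss n)
   (simple_indic (1 : R^o) mN).
  congr simple; apply/funext => x /=; rewrite indicE /t.
  by case: (x \in N); rewrite /= ?scale1r ?scale0r ?oner_eq0 ?eqxx.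
have mt n := simple_memLp p1 mufin (st n).
have mg : strongly_measurable g by exists t.
have nN : \forall x \ae mu, x \notin N.
  by exists N; split => // x /=; rewrite notin_setE => /contrapT.
have tE n : toLp (t n) = toLp (s n).
  by apply: eq_toLp => //; apply: filterS nN => x /negbTE xN; rewrite /t xN.
(* Fatou's lemma as m tends to infinity in the differences of [t n] and [t (n + m)]. *)
have fat n : (\int[mu]_x (`|t n x - g x| `^ p)%:E <= ((6 * 2^-1 ^+ n) `^ p)%:E)%E.
  have mtt m : memLp mu p (fun x => t n x - t (n + m)%N x) by apply: memLpB.
  pose a m := (\int[mu]_x (`|t n x - t (n + m)%N x| `^ p)%:E)%E.
  have aC m : (a m <= ((6 * 2^-1 ^+ n) `^ p)%:E)%E.
    rewrite /a -(toLp_norm_pow p1 (mtt m)) lee_fin.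
    rewrite ge0_ler_powR ?nnegrE ?(ltW p_gt0) ?mulr_ge0 ?exprn_ge0//.
    by rewrite toLpB// !tE distrC.
  have := @fatou _ _ _ mu setT measurableT (fun m x => (`|t n x - t (n + m)%N x| `^ p)%:E).
  move=> /(_ _ _)/le_trans; rewrite (_ : (\int[mu]_x (`|t n x - g x| `^ p)%:E)%E =
    (\int[mu]_x limn_einf (fun m => (`|t n x - t (n + m)%N x| `^ p)%:E))%E); last first.
    apply: eq_integral => x _; apply/esym.
    apply: (cvg_limn_einf_sup _).1.
    apply: cvg_EFin; first exact: nearW.
    apply: cvg_powR => //; apply: cvg_norm; apply: cvgB; first exact: cvg_cst.
    rewrite (_ : (fun m => t (n + m)%N x) = fun m => t (m + n)%N x); last first.
      by apply/funext => m; rewrite addnC.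
    by rewrite (cvg_shiftn n (t ^~ x)); exact: tg.
  apply.
  - by move=> m; exact: measurable_norm_powR (mtt m).1.
  - by move=> m x _; rewrite lee_fin powR_ge0.
  rewrite limn_einf_lim; apply: lime_le; first exact: is_cvg_einfs.
  apply: nearW => m; apply: le_trans (aC m).
  by apply: ereal_inf_lbound; exists m => //=.
have mtg n : memLp mu p (fun x => t n x - g x).
  split; first exact: strongly_measurableB (mt n).1 mg.
  by apply: le_lt_trans (fat n) _; exact: ltry.
have mLg : memLp mu p g.
  have := memLpB p1 (mt 0%N) (mtg 0%N).
  by congr memLp; apply/funext => x; rewrite opprB addrC subrK.
apply/cvg_ex; exists (toLp g); apply/cvgrPdist_le => e e0.
have H n : `|toLp g - u n| <= 7 * 2^-1 ^+ n.
  rewrite (le_trans (ler_distD (toLp (s n)) _ _))//.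
  have h1 : `|toLp g - toLp (s n)| <= 6 * 2^-1 ^+ n.
    rewrite distrC -tE -(toLpB p1 (mt n) mLg).
    apply: toLp_norm_le; [exact: mtg| |exact: fat].
    by rewrite mulr_ge0 ?exprn_ge0.
  have h2 : `|toLp (s n) - u n| <= 2^-1 ^+ n by rewrite distrC (su n).2.
  by rewrite (le_trans (lerD h1 h2))//; lra.
have : (7 * 2^-1 ^+ n : R) @[n --> \oo] --> (7 * 0 : R).
  apply: cvgMl_tmp; apply: cvg_expr.
  by rewrite ger0_norm ?invr_ge0// invf_lt1// ltr1n.
rewrite mulr0 => /cvgr0Pnorm_le/(_ _ e0); apply: filterS => n.
by rewrite ger0_norm ?mulr_ge0 ?exprn_ge0//; exact: le_trans.
Qed.

End RieszFischer.

(** * The delay measure and weak derivatives *)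

Section AlmostEverywhere.
Context d (T : measurableType d) (R : realType) (mu : {measure set T -> \bar R}).

Lemma aeS (P Q : T -> Prop) : (forall x, P x -> Q x) ->
  (\forall x \ae mu, P x) -> \forall x \ae mu, Q x.
Proof. by move=> PQ; exact: (@filterS _ _ (ae_filter_ringOfSetsType mu)). Qed.

Lemma aeS2 (P Q U : T -> Prop) : (forall x, P x -> Q x -> U x) ->
  (\forall x \ae mu, P x) -> (\forall x \ae mu, Q x) -> \forall x \ae mu, U x.
Proof. by move=> PQ; exact: (@filterS2 _ _ (ae_filter_ringOfSetsType mu)). Qed.

End AlmostEverywhere.

Section MemLpAe.
Context d (T : measurableType d) (R : realType) (mu : {measure set T -> \bar R}).
Context (p : R) (X : normedModType R).

Lemma memLp_ae (f g : T -> X) : memLp mu p f -> strongly_measurable g ->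
  (\forall x \ae mu, f x = g x) -> memLp mu p g.
Proof.
move=> [mf ff] mg fg; split; first exact: mg.
have E := @ae_eq_integral _ _ _ mu setT (fun x => (`|g x| `^ p)%:E)
  (fun x => (`|f x| `^ p)%:E) measurableT (measurable_norm_powR p mf)
  (measurable_norm_powR p mg).
have {}E : (\int[mu]_x (`|f x| `^ p)%:E)%E = (\int[mu]_x (`|g x| `^ p)%:E)%E.
  by apply: E; apply: filterS fg => x ->.
by rewrite -E.
Qed.

End MemLpAe.

Section Translation.
Context (R : realType).
Local Notation lambda := (@lebesgue_measure R).
Local Notation mu := (lebesgue_delay R).

Lemma measurable_translation (s : R) :
  measurable_fun setT ((fun t => s + t) : measurableTypeR R -> measurableTypeR R).
Proof. by apply: measurable_funD => //; exact: measurable_cst. Qed.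

(** The pushforward under a translation agrees with Lebesgue measure on half-open intervals, which
    determine it. *)
Lemma lebesgue_translation (s : R) (A : set (measurableTypeR R)) : measurable A ->
  lambda ((fun t => s + t) @^-1` A) = lambda A.
Proof.
move=> mA; apply/esym.
pose nu := measure_function_pushforward__canonical__measure_function_Measure
  lambda (measurable_translation s).
have := @lebesgue_measure_unique R nu; apply => // _ [[a b]] _ <-.
rewrite /nu/= /pushforward.
rewrite (_ : _ @^-1` _ = `]a - s, b - s]%classic); last first.
  by apply/seteqP; split=> t /=; rewrite !in_itv/= ltrBlDl lerBrDl.
rewrite !lebesgue_measure_itv/= !lte_fin ltrD2r.
by case: ifPn => // _; rewrite -!EFinB opprB addrA subrK.
Qed.

Lemma delay_measureE (A : set (measurableTypeR R)) : mu A = lambda (A `&` `[-1, 0]).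
Proof. by []. Qed.

Lemma delay_measureT : mu setT = 1%E.
Proof.
rewrite delay_measureE setTI lebesgue_measure_itv/= lte_fin.
by rewrite ltrN10 -EFinB opprK add0r.
Qed.

Lemma delay_measure_fin : (mu setT < +oo)%E.
Proof. by rewrite delay_measureT ltry. Qed.

Lemma delay_ae_itv : \forall t \ae mu, t \in `[-1, 0].
Proof.
exists (~` `[-1, 0]%classic); split.
- by apply: measurableC; exact: measurable_itv.
- by rewrite delay_measureE setICl measure0.
- by move=> t.
Qed.

(** A point of [[-1, 0]] moved to the right by s and still at most 0 lies in [[-1, 0]] again. This
    is why the nilpotent left shift is well defined on classes and a contraction. *)
Lemma delay_measure_shift (s : R) (A : set (measurableTypeR R)) : 0 <= s ->
  measurable A ->
  (mu ((fun t => s + t)%R @^-1` (A `&` `]-oo, 0%R])) <= mu (A `&` `]-oo, 0%R]))%E.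
Proof.
move=> s0 mA; rewrite !delay_measureE.
have mI (i : interval R) : measurable ([set` i] : set (measurableTypeR R)) by exact: measurable_itv.
rewrite -[leRHS](lebesgue_translation s); last by apply: measurableI => //; exact: measurableI.
apply: le_measure; rewrite ?inE.
- apply: measurableI => //; rewrite -[X in measurable X]setTI.
  by apply: (measurable_translation s) => //; exact: measurableI.
- rewrite -[X in measurable X]setTI.
  by apply: (measurable_translation s) => //; apply: measurableI => //; exact: measurableI.
- move=> t /= [[At]]; rewrite !in_itv/= => st0 /andP[t1 t0]; split; first by split.
  by rewrite st0 (le_trans t1)// lerDr.
Qed.

Lemma delay_ae_shift (s : R) (P : R -> Prop) : 0 <= s -> (\forall t \ae mu, P t) ->
  \forall t \ae mu, s + t <= 0 -> P (s + t).
Proof.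
move=> s0 [N [mN N0 PN]].
exists ((fun t => s + t) @^-1` (N `&` `]-oo, 0])); split.
- rewrite -[X in measurable X]setTI; apply: (measurable_translation s) => //.
  by apply: measurableI => //; exact: measurable_itv.
- apply/eqP; rewrite -measure_le0 (le_trans (delay_measure_shift s0 mN))//.
  rewrite -N0; apply: le_measure; rewrite ?inE//.
  by apply: measurableI => //; exact: measurable_itv.
- move=> t /= /not_implyP[st0 nP]; split; first exact: PN.
  by rewrite /= in_itv.
Qed.

Lemma integral_delay_shift (s : R) (h : R -> \bar R) : 0 <= s ->
  (forall t, (0 <= h t)%E) -> measurable_fun setT (h : measurableTypeR R -> _) ->
  (\int[mu]_t (if (s + t <= 0)%R then h (s + t)%R else 0) <= \int[mu]_t h t)%E.
Proof.
move=> s0 h0 mh.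
have mI : measurable (`]-oo, (0 : R)]%classic : set (measurableTypeR R)) by exact: measurable_itv.
pose nu := measure_function_pushforward__canonical__measure_function_Measure
  mu (measurable_translation s).
have -> : (\int[mu]_t (if (s + t <= 0)%R then h (s + t)%R else 0) =
    \int[nu]_(y in `]-oo, 0%R]) h y)%E.
  rewrite ge0_integral_pushforward//; [|exact: measurable_translation|
    exact: measurable_funTS].
  rewrite [RHS]integral_mkcond; apply: eq_integral => t _.
  rewrite patchE; have [st|st] := boolP (s + t <= 0).
    by rewrite mem_set//= in_itv.
  by rewrite memNset//= in_itv; exact/negP.
apply: (@le_trans _ _ (\int[mu]_(y in `]-oo, 0%R]) h y)%E); last first.
  by apply: ge0_subset_integral.
rewrite (@eq_measure_integral _ _ _ _ (mrestr nu mI)); last first.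
  by move=> A mA AI; rewrite /= /mrestr setIidl.
rewrite [leRHS](@eq_measure_integral _ _ _ _ (mrestr mu mI)); last first.
  by move=> A mA AI; rewrite -[in LHS](setIidl AI).
apply: ge0_le_measure_integral => // A mA.
exact: delay_measure_shift.
Qed.

End Translation.

Lemma continuous_bounded_itv (R : realType) (V : normedModType R) (k : R -> V) (a b : R) :
  continuous k -> exists2 M, 0 < M & forall t, a <= t <= b -> `|k t| <= M.
Proof.
move=> ck.
have cI : {within `[a, b], continuous k} by exact: continuous_subspaceT.
have /compact_bounded[M [_ HM]] := continuous_compact cI (@segment_compact R a b).
exists (`|M| + 1) => [|t tab]; first by rewrite ltr_wpDl.
apply: HM; first by rewrite (le_lt_trans (ler_norm M))// ltrDl.
by exists t => //=; rewrite in_itv.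
Qed.

(** * Antiderivatives of continuous curves and the fundamental theorem of calculus *)

Section Antiderivative.
Context (R : realType) (X : completeNormedModType R) (c : R -> X) (a b : R).
Hypothesis cc : continuous c.
Hypothesis ab : a <= b.
Local Notation lambda := (@lebesgue_measure R).
Variable mu : {measure set (measurableTypeR R) -> \bar R}.
Hypothesis muE : forall A, mu A = lambda (A `&` `[a, b]).

Let mufin : (mu setT < +oo)%E.
Proof.
rewrite muE setTI lebesgue_measure_itv/= lte_fin.
by case: ifPn => _; rewrite ?ltry// -EFinB ltry.
Qed.

Let ae_ab : \forall t \ae mu, t \in `[a, b].
Proof.
exists (~` `[a, b]%classic); split.
- by apply: measurableC; exact: measurable_itv.
- by rewrite muE setICl measure0.
- by move=> t.
Qed.

Let mu_itv s t : a <= s -> s <= t -> t <= b -> mu `]s, t]%classic = (t - s)%:E.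
Proof.
move=> as_ st tb; rewrite muE setIidl; last first.
  by move=> r /=; rewrite !in_itv/= => /andP[sr rt]; rewrite (ltW (le_lt_trans as_ sr)) (le_trans rt).
rewrite lebesgue_measure_itv/= lte_fin; case: ifPn => [_|]; first by rewrite -EFinB.
by rewrite -leNgt => ts; rewrite (@le_anti _ _ t s) ?subrr// ts.
Qed.

Let mI (i : interval R) : measurable ([set` i] : set (measurableTypeR R)).
Proof. exact: measurable_itv. Qed.

Let mc : strongly_measurable (c : measurableTypeR R -> X).
Proof.
apply: (@strongly_measurable_continuous _ (measurableTypeR R) R X c id cc).
exact: measurable_id.
Qed.

Let msc (A : set (measurableTypeR R)) : measurable A ->
  strongly_measurable (fun t : measurableTypeR R => \1_A t *: c t).
Proof.
by move=> mA; apply: (strongly_measurable_scale _ mc); exact: measurable_indic.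
Qed.

Let primitive_exists t : exists I, is_bochner_integral mu
  (fun r : measurableTypeR R => \1_(`]-oo, t]%classic : set R) r *: c r) I.
Proof.
have [M M0 HM] := continuous_bounded_itv a b cc.
apply: bochner_exists => //; first exact: msc.
apply: (@le_lt_trans _ _ (\int[mu]_r M%:E)%E).
  apply: ae_ge0_le_integral => //.
  - by apply: measurable_EFin_norm; exact: msc.
  - by move=> r _; rewrite lee_fin ltW.
  - apply: aeS ae_ab => r rab _; rewrite lee_fin normrZ indicE.
    by case: (r \in _); rewrite /= ?normr1 ?mul1r ?normr0 ?mul0r ?(ltW M0)// HM// -in_itv.
by rewrite integral_cst// lte_mul_pinfty// lee_fin ltW.
Qed.

(** [J t] is the Bochner integral of [c] up to t. The estimate with a free vector [v] serves several
    ends: [v = c s] gives the right derivative, [v = 0] a Lipschitz bound, and for real [c] half an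
    upper bound gives monotonicity. *)
Lemma antiderivative : exists J : R -> X, [/\ J a = 0,
  is_bochner_integral mu c (J b) &
  forall s t v e, a <= s -> s <= t -> t <= b ->
    (forall r, s <= r -> r <= t -> `|c r - v| <= e) ->
    `|J t - J s - (t - s) *: v| <= e * (t - s)].
Proof.
have /choice[J HJ] := primitive_exists.
have incr s t v e : a <= s -> s <= t -> t <= b ->
    (forall r, s <= r -> r <= t -> `|c r - v| <= e) ->
    `|J t - J s - (t - s) *: v| <= e * (t - s).
  move=> as_ st tb ce.
  have e0 : 0 <= e by apply: le_trans (ce s _ st).
  have h1 := bochner_lin mufin (-1) (HJ s) (HJ t).
  have h2 := bochner_indic mufin v (mI `]s, t]).
  rewrite -lee_fin (_ : J t - J s - (t - s) *: v =
    -1 *: (fine (mu `]s, t]%classic) *: v) + (-1 *: J s + J t)); last first.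
    by rewrite mu_itv//= !scaleN1r [RHS]addrC (addrC (- J s)).
  apply: le_trans (bochner_norm mufin (bochner_lin mufin (-1) h2 h1)) _.
  apply: (@le_trans _ _ (\int[mu]_r (e * \1_(`]s, t]%classic : set R) r)%:E)%E).
    apply: ge0_le_integral => //.
    - apply: measurable_EFin_norm.
      apply: (strongly_measurable_lin (-1)); first exact: (bochner_strongly_measurable h2).
      exact: (bochner_strongly_measurable h1).
    - by apply/measurable_EFinP; apply: measurable_funM => //; exact: measurable_indic.
    - move=> r _; rewrite lee_fin !indicE.
      have mE (x y : R) : (r \in (`]-oo, x]%classic : set R)) = (r <= x).
        by rewrite mem_setE in_itv.
      rewrite !(mE _ 0) mem_setE in_itv/=.
      have [sr|rs] := ltP s r; have [rt|tr] := leP r t; rewrite /= ?mulr1 ?mulr0.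
      + by rewrite !scale1r scale0r scaler0 add0r scaleN1r addrC ce// ltW.
      + by rewrite !scale0r !scaler0 !addr0 normr0.
      + by rewrite !scale1r scale0r scaler0 add0r scaleN1r addNr normr0.
      + by move: (lt_le_trans tr rs); rewrite ltNge st.
  rewrite (@integralZl_indic _ _ _ mu setT _ (fun=> `]s, t]%classic))//; last first.
    by rewrite ltNge e0.
  by rewrite integral_indic// setIT mu_itv// -EFinM.
exists J; split => //.
- have := bochner_norm mufin (HJ a); rewrite (_ : (\int[mu]_r _ = 0)%E).
    by rewrite lee_fin normr_le0 => /eqP.
  rewrite -[RHS](@integral0 _ _ _ mu setT); apply: ae_eq_integral => //.
    by apply: measurable_EFin_norm; exact: msc.
  exists `]-oo, a]%classic; split => //.
    rewrite muE (_ : _ `&` _ = [set a]) ?lebesgue_measure_set1//.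
    apply/seteqP; split=> r /=; rewrite !in_itv/=.
      by move=> [ra /andP[ar _]]; apply/le_anti; rewrite ra.
    by move=> ->; rewrite lexx ab.
  move=> r /= /not_implyP[_ H]; apply: contrapT => ra; apply: H.
  by rewrite indicE memNset// scale0r normr0.
- apply: bochner_ae (HJ b) _ _ => //; apply: aeS ae_ab => r.
  rewrite in_itv/= => /andP[_ rb]; rewrite indicE mem_set ?scale1r//=.
Qed.

Lemma FTC_right_C1 (k : R -> X) : right_C1 k c ->
  is_bochner_integral mu c (k b - k a).
Proof.
move=> kc; have [ck _ _] := kc; have [J [Ja Jb HJ]] := antiderivative.
suff -> : k b - k a = J b by [].
have [M M0 HM] := continuous_bounded_itv a b cc.
(* The difference [J - k] has right derivative 0, so the zero majorant shows that it is constant. *)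
suff : `|(J b - k b) - (J a - k a)| <= 0 - 0.
  rewrite subrr normr_le0 Ja sub0r opprK -addrA addr_eq0 opprD opprK.
  by move=> /eqP ->.
apply: (@increment_bound _ _ (J \- k) (fun=> 0)) => //.
- move=> s as_ sb; apply: cvgB; last by apply: cvg_at_left_filter; exact: ck.
  apply/cvgrPdist_le => e e0; near=> r.
  have rs : r <= s by near: r; exact: nbhs_left_le.
  have ar : a <= r by near: r; exact: nbhs_left_ge.
  have H0 : `|J s - J r| <= M * (s - r).
    have := @HJ r s 0 M ar rs sb; rewrite scaler0 subr0; apply => u ru us.
    by rewrite subr0 HM// (le_trans ar)//= (le_trans us).
  rewrite (le_trans H0)//.
  rewrite mulrC -ler_pdivlMr// lerBlDr -lerBlDl ltW//.
  by near: r; apply: nbhs_left_gt; rewrite ltrBlDr ltrDl divr_gt0.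
- move=> s e as_ sb e0.
  have e20 : 0 < e / 2 by rewrite divr_gt0.
  have /cvgrPdist_le/(_ _ e20)/nbhs_ballP[d /= d0 Hd] := @cc s.
  near=> h.
  have h0 : 0 < h by near: h; exact: nbhs_right_gt.
  have hd : h < d by near: h; exact: nbhs_right_lt.
  have hb : s + h <= b.
    by rewrite -lerBrDl; near: h; apply: nbhs_right_le; rewrite subr_gt0.
  have ce r : s <= r -> r <= s + h -> `|c r - c s| <= e / 2.
    move=> sr rh; rewrite distrC; apply: Hd; rewrite /ball/= distrC ger0_norm ?subr_ge0//.
    by rewrite ltrBlDl (le_lt_trans rh)// ltrD2l.
  have sh : s + h - s = h by rewrite addrC addKr.
  have h1 : `|J (s + h) - J s - h *: c s| <= e / 2 * h.
    have := @HJ s (s + h) (c s) (e / 2) as_ _ hb ce.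
    by rewrite sh; apply; rewrite lerDl ltW.
  have h2 : `|k (s + h) - k s - h *: c s| <= e / 2 * h.
    have := @right_C1_mean _ _ k c s (s + h) (c s) (e / 2) kc _ ce.
    by rewrite sh; apply; rewrite lerDl ltW.
  rewrite /= subrr add0r.
  rewrite (_ : J (s + h) - k (s + h) - (J s - k s) =
    (J (s + h) - J s - h *: c s) - (k (s + h) - k s - h *: c s)).
    by rewrite (le_trans (ler_normB _ _))// (le_trans (lerD h1 h2))//; lra.
  rewrite [in RHS](opprB (k (s + h) - k s)) [in RHS]addrA [in RHS]subrK !opprB.
  by rewrite [k s - J s]addrC addrACA [- k (s + h) + _]addrC.
Unshelve. all: by end_near. Qed.

End Antiderivative.

Section DelayLp.
Context (R : realType) (X : completeNormedModType R) (p : R) (p1 : 1 <= p).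
Local Notation mu := (lebesgue_delay R).
Local Notation toLp := (@toLp _ (measurableTypeR R) R mu p p1 X).
Implicit Types f g : measurableTypeR R -> X.

Let mufin : (mu setT < +oo)%E. Proof. exact: delay_measure_fin. Qed.

Lemma memLp_delay f (M : R) : strongly_measurable f ->
  (forall t, t \in `[-1, 0] -> `|f t| <= M) -> memLp mu p f.
Proof.
move=> mf fM.
have mf' : strongly_measurable (fun t : measurableTypeR R => \1_`[-1, 0]%classic t *: f t).
  by apply: strongly_measurable_scale => //; exact: measurable_indic.
apply: (@memLp_ae _ (measurableTypeR R) R mu p X
  (fun t => \1_`[-1, 0]%classic t *: f t)) => //.
  apply: (memLp_bounded p1 mufin (M := `|M|)) => // t.
  rewrite normrZ indicE; have [/set_mem tI|tI] := boolP (t \in _).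
    by rewrite normr1 mul1r (le_trans (fM _ tI))// ler_norm.
  by rewrite normr0 mul0r.
by apply: aeS (delay_ae_itv R) => t tI; rewrite indicE mem_set// scale1r.
Qed.

Lemma delay_toLpE f : memLp mu p f -> delay_toLp p1 f = toLp f.
Proof.
move=> mf; have E : \forall t \ae mu, f t = (f \_ `[-1, 0]) t.
  by apply: aeS (delay_ae_itv R) => t tI; rewrite patchE mem_set.
have mf' : memLp mu p (f \_ `[-1, 0]).
  by apply: (memLp_ae mf _ E); apply: strongly_measurable_patch => //; case: mf.
exact: esym (eq_toLp p1 mf mf' E).
Qed.

Lemma strongly_measurable_curve (c : R -> X) : continuous c ->
  strongly_measurable (c : measurableTypeR R -> X).
Proof.
move=> cc; apply: (@strongly_measurable_continuous _ (measurableTypeR R) R X c id cc).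
exact: measurable_id.
Qed.

Lemma memLp_curve (c : R -> X) : continuous c -> memLp mu p c.
Proof.
move=> cc; have [M M0 HM] := continuous_bounded_itv (-1) 0 cc.
by apply: (memLp_delay (M := M)) => //; exact: strongly_measurable_curve.
Qed.

Lemma delay_norm_set f (A : set (measurableTypeR R)) (M m : R) :
  measurable A -> strongly_measurable f -> 0 <= M -> (mu A <= m%:E)%E ->
  (forall t, t \in `[-1, 0] -> A t -> `|f t| <= M) ->
  (forall t, t \in `[-1, 0] -> ~ A t -> f t = 0) ->
  `|delay_toLp p1 f| <= M * m `^ p^-1.
Proof.
move=> mA mf M0 Am fM f0.
have mLf : memLp mu p f.
  apply: (memLp_delay (M := M)) => // t tI.
  by have [/(fM _ tI)//|/(f0 _ tI) ->] := pselect (A t); rewrite normr0.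
have mf' : strongly_measurable (fun t : measurableTypeR R => \1_`[-1, 0]%classic t *: f t).
  by apply: strongly_measurable_scale => //; exact: measurable_indic.
have E : \forall t \ae mu, f t = \1_`[-1, 0]%classic t *: f t.
  by apply: aeS (delay_ae_itv R) => t tI; rewrite indicE mem_set// scale1r.
rewrite delay_toLpE// (eq_toLp p1 mLf (memLp_ae mLf mf' E) E).
apply: (toLp_norm_bounded p1 mufin mA) => // t At; rewrite indicE.
  have [/set_mem tI|tI] := boolP (t \in _); last by rewrite scale0r normr0.
  by rewrite scale1r; exact: fM.
have [/set_mem tI|tI] := boolP (t \in _); last by rewrite scale0r.
by rewrite scale1r; exact: f0.
Qed.

Lemma delay_norm_le f (M : R) : strongly_measurable f -> 0 <= M ->
  (forall t, t \in `[-1, 0] -> `|f t| <= M) -> `|delay_toLp p1 f| <= M.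
Proof.
move=> mf M0 fM.
have -> : M = M * 1 `^ p^-1 by rewrite powR1 mulr1.
apply: (delay_norm_set measurableT) => // [|t tI _|t _ []//]; last exact: fM.
by rewrite delay_measureT.
Qed.

Lemma delay_toLpB f g : memLp mu p f -> memLp mu p g ->
  delay_toLp p1 (fun t => f t - g t) = delay_toLp p1 f - delay_toLp p1 g.
Proof.
move=> mf mg; rewrite (delay_toLpE mf) (delay_toLpE mg) -(toLpB p1 mf mg).
exact: delay_toLpE (memLpB p1 mf mg).
Qed.

Lemma delay_toLp_lin (a : R) f g : memLp mu p f -> memLp mu p g ->
  delay_toLp p1 (fun t => a *: f t + g t) = a *: delay_toLp p1 f + delay_toLp p1 g.
Proof.
move=> mf mg; rewrite (delay_toLpE mf) (delay_toLpE mg) -(toLp_lin p1 a mf mg).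
exact: delay_toLpE (memLp_lin p1 a mf mg).
Qed.

Lemma delay_toLp_ae f : memLp mu p f -> \forall t \ae mu, delay_toLp p1 f t = f t.
Proof. by move=> mf; rewrite delay_toLpE//; exact: toLp_ae_eq. Qed.

End DelayLp.

Section TestFunctions.
Context (R : realType).

Lemma derivable_right (phi : R -> R) (t : R) : derivable phi t 1 ->
  h^-1 * (phi (t + h) - phi t) @[h --> 0^'+] --> derive1 phi t.
Proof.
move=> dphi; apply: cvg_dnbhs_at_right; rewrite derive1E.
rewrite -(_ : (fun h => h^-1 *: ((phi \o shift t) (h *: 1) - phi t)) =
  fun h => h^-1 * (phi (t + h) - phi t)); first exact: dphi.
by apply/funext => h /=; rewrite [h%:A]mulr1 (addrC t).
Qed.

Context (X : normedModType R).

Lemma test_right_C1 (phi : R -> R) (k k' : R -> X) :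
  test_function phi -> right_C1 k k' ->
  right_C1 (fun t => phi t *: k t) (fun t => derive1 phi t *: k t + phi t *: k' t).
Proof.
move=> [dphi cphi _] [ck ck' dk].
have cf : continuous phi.
  by move=> t; apply: differentiable_continuous; apply/derivable1_diffP.
have cZ (a : R -> R) (v : R -> X) : continuous a -> continuous v ->
    continuous (fun t => a t *: v t).
  by move=> ca cv t; apply: cvgZ; [exact: ca|exact: cv].
split; [exact: cZ| |].
  by move=> t; apply: cvgD; [exact: cZ|exact: cZ].
move=> t.
have -> : (fun h => h^-1 *: (phi (t + h) *: k (t + h) - phi t *: k t)) =
    (fun h => (h^-1 * (phi (t + h) - phi t)) *: k (t + h) +
      phi t *: (h^-1 *: (k (t + h) - k t))).
  apply/funext => h; rewrite [phi t *: (h^-1 *: _)]scalerA [phi t * h^-1]mulrC -!scalerA -scalerDr.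
  by congr (_ *: _); rewrite scalerBl scalerBr addrA subrK.
apply: cvgD; last by apply: cvgZl_tmp; exact: dk.
apply: cvgZ; first exact: derivable_right.
have : k (t + h) @[h --> (0 : R)] --> k t.
  rewrite -{2}[t]addr0; apply: continuous_comp; last exact: ck.
  by apply: cvgD; [exact: cvg_cst|exact: cvg_id].
exact: cvg_at_right_filter.
Qed.

End TestFunctions.

Section WeakDerivative.
Context (R : realType) (X : completeNormedModType R) (p : R) (p1 : 1 <= p).
Local Notation mu := (lebesgue_delay R).

Let mufin : (mu setT < +oo)%E. Proof. exact: delay_measure_fin. Qed.

(** Integration by parts: the integral of the derivative of [phi *: k] is its increment over
    [[-1, 0]], which is 0 because [phi] vanishes at both ends. *)
Lemma weak_derivative_right_C1 (k k' : R -> X) : right_C1 k k' ->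
  weak_derivative (delay_toLp p1 k) (delay_toLp p1 k').
Proof.
move=> kk' phi tphi; have [ck ck' _] := kk'; have [dphi cphi [a [b [a1 b0 phi0]]]] := tphi.
have cf : continuous phi.
  by move=> t; apply: differentiable_continuous; apply/derivable1_diffP.
have cZ (u : R -> R) (v : R -> X) : continuous u -> continuous v ->
    continuous (fun t => u t *: v t).
  by move=> cu cv t; apply: cvgZ; [exact: cu|exact: cv].
have bex (c : R -> X) : continuous c -> exists I, is_bochner_integral mu c I.
  move=> cc; apply: bochner_exists => //; first exact: strongly_measurable_curve.
  have [_] := @memLp_curve R X 1 (lexx 1) c cc.
  by under eq_integral do rewrite powRr1//.
have [I1 HI1] := bex _ (cZ _ _ cphi ck).
have [I2 HI2] := bex _ (cZ _ _ cf ck').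
have csum : continuous (fun t => derive1 phi t *: k t + phi t *: k' t).
  by move=> t; apply: cvgD; [exact: cZ|exact: cZ].
have N10 : (-1 : R) <= 0 by rewrite lerN10.
have := FTC_right_C1 csum N10 (fun A => erefl (mu A)) (test_right_C1 tphi kk').
have ph0 t : t \notin `]-1, 0[ -> phi t = 0.
  move=> tN; apply: phi0; apply: contra tN; rewrite !in_itv/= => /andP[at_ tb].
  by rewrite (lt_le_trans a1 at_) (le_lt_trans tb b0).
have -> : phi 0 *: k 0 - phi (-1) *: k (-1) = 0.
  by rewrite !ph0 ?in_itv/= ?ltxx ?andbF// !scale0r subrr.
move=> H0.
have I12 : I1 + I2 = 0.
  have := bochner_lin mufin 1 HI1 HI2; rewrite scale1r.
  under [X in is_bochner_integral _ X]eq_fun do rewrite scale1r.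
  by move=> /(bochner_uniq mufin); apply; exact: H0.
have mLk := memLp_curve p1 ck; have mLk' := memLp_curve p1 ck'.
have mcont (u : R -> R) : continuous u ->
    measurable_fun setT (u : measurableTypeR R -> measurableTypeR R).
  by move=> cu; exact: continuous_measurable_fun.
exists I1.
- apply: bochner_ae HI1 _ _ => //.
    apply: strongly_measurable_scale; first exact: mcont.
    exact: (memLp_fun _).1.
  by apply: aeS (delay_toLp_ae p1 mLk) => t ->.
- have -> : - I1 = I2 by apply/eqP; rewrite eq_sym -addr_eq0 addrC I12.
  apply: bochner_ae HI2 _ _ => //.
    apply: strongly_measurable_scale; first exact: mcont.
    exact: (memLp_fun _).1.
  by apply: aeS (delay_toLp_ae p1 mLk') => t ->.
Qed.

End WeakDerivative.

(** * Test functions and uniqueness of weak derivatives *)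

Section SmoothSteps.
Context (R : realType).

Definition C1_real (f f' : R -> R) :=
  (forall t, is_derive t (1 : R) f (f' t)) /\ continuous f'.

Lemma C1_real_continuous (f f' : R -> R) : C1_real f f' -> continuous f.
Proof.
move=> [df _] t; apply: differentiable_continuous; apply/derivable1_diffP.
by have [] := df t.
Qed.

Lemma C1_realZ (a : R) (f f' : R -> R) : C1_real f f' ->
  C1_real (fun t => a * f t) (fun t => a * f' t).
Proof.
move=> [df cf]; split; last by move=> t; apply: cvgMl_tmp; exact: cf.
by move=> t; have := df t => ?; exact: is_deriveZ.
Qed.

Lemma C1_realD (f f' g g' : R -> R) : C1_real f f' -> C1_real g g' ->
  C1_real (fun t => f t + g t) (fun t => f' t + g' t).
Proof.
move=> [df cf] [dg cg]; split.
  by move=> t; have := df t; have := dg t => ? ?; exact: is_deriveD.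
by move=> t; apply: cvgD; [exact: cf|exact: cg].
Qed.

Lemma C1_realM (f f' g g' : R -> R) : C1_real f f' -> C1_real g g' ->
  C1_real (fun t => f t * g t) (fun t => f t * g' t + g t * f' t).
Proof.
move=> hf hg; have cf := C1_real_continuous hf; have cg := C1_real_continuous hg.
case: hf => df cf'; case: hg => dg cg'; split.
  by move=> t; have := df t; have := dg t => ? ?; exact: is_deriveM.
by move=> t; apply: cvgD; apply: cvgM; [exact: cf|exact: cg'|exact: cg|exact: cf'].
Qed.

(** A squared positive part is C^1 across its kink, so that three of them combine into a C^1
    step. *)
Definition ramp2 (a b t : R) := Num.max (a * t + b) 0 ^+ 2.

(** A first-order expansion whose quadratic remainder is uniform across the kink; it yields the
    derivative at every point without separating cases. *)
Lemma ramp2_taylor (x h : R) :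
  `|Num.max (x + h) 0 ^+ 2 - Num.max x 0 ^+ 2 - 2 * Num.max x 0 * h| <= h ^+ 2.
Proof.
rewrite !maxEle; have [x0|x0] := leP x 0; have [xh|xh] := leP (x + h) 0.
- by rewrite expr0n/= subrr mulr0 mul0r subrr normr0 sqr_ge0.
- by rewrite expr0n/= subr0 mulr0 mul0r subr0 ger0_norm ?sqr_ge0//; nra.
- by rewrite ler_norml; apply/andP; split; nra.
- by rewrite ler_norml; apply/andP; split; nra.
Qed.

Lemma continuous_max0 (f : R -> R) : continuous f -> continuous (fun t => Num.max (f t) 0).
Proof.
move=> cf t; apply/cvgrPdist_lt => e e0.
have /cvgrPdist_lt/(_ _ e0) := cf t; apply: filterS => s; apply: le_lt_trans.
rewrite !maxEle; have [x0|x0] := leP (f t) 0; have [y0|y0] := leP (f s) 0.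
- by rewrite subrr normr0.
- by rewrite sub0r normrN distrC ger0_norm ?(ltW y0)// ger0_norm; lra.
- by rewrite subr0 ger0_norm ?(ltW x0)// ger0_norm; lra.
- by [].
Qed.

Lemma C1_ramp2 (a b : R) :
  C1_real (ramp2 a b) (fun t => 2 * a * Num.max (a * t + b) 0).
Proof.
have ca : continuous (fun t : R => a * t + b).
  by move=> t; apply: cvgD; [apply: cvgMl_tmp; exact: cvg_id|exact: cvg_cst].
split; last by move=> t; apply: cvgMl_tmp; exact: (continuous_max0 ca).
move=> t.
have H : (fun h => h^-1 *: ((ramp2 a b \o shift t) (h *: (1 : R)) - ramp2 a b t)) @ 0^' -->
    2 * a * Num.max (a * t + b) 0.
  apply/cvgrPdist_le => e e0.
  have a1 : 0 < a ^+ 2 + 1 by rewrite ltr_wpDl// sqr_ge0.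
  near=> h.
  have he : `|h| <= e / (a ^+ 2 + 1) by near: h; apply: dnbhs0_le; rewrite divr_gt0.
  have h0 : h != 0 by near: h; exact: nbhs_dnbhs_neq.
  have := ramp2_taylor (a * t + b) (a * h).
  rewrite /ramp2/= [h%:A]mulr1 (_ : a * t + b + a * h = a * (h + t) + b); last by lra.
  set U := Num.max _ _; set W := Num.max (a * t + b) 0 => H.
  have -> : 2 * a * W - h^-1 *: (U ^+ 2 - W ^+ 2) =
      - (h^-1 * (U ^+ 2 - W ^+ 2 - 2 * W * (a * h))).
    by rewrite (_ : h^-1 *: (U ^+ 2 - W ^+ 2) = h^-1 * (U ^+ 2 - W ^+ 2))//; field.
  rewrite normrN normrM normfV ler_pdivrMl ?normr_gt0//.
  rewrite (le_trans H)//.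
  have {}he : a ^+ 2 * `|h| <= e.
    have e1 : e / (a ^+ 2 + 1) * (a ^+ 2 + 1) = e by rewrite divfK// gt_eqF.
    by rewrite -[leRHS]e1 mulrC ler_pM ?sqr_ge0// lerDl.
  rewrite exprMn -[h ^+ 2](ger0_norm (sqr_ge0 _)) normrX expr2 -/(a ^+ 2).
  by rewrite [`|h| ^+ 2]expr2 mulrA mulrC ler_wpM2l.
split; first by apply/cvg_ex; eexists; exact: H.
by apply: cvg_lim H.
Unshelve. all: by end_near. Qed.

(* With [u := a * t + b], it is 0 for u <= 0, 2 u^2 up to u = 1/2, 1 - 2 (1 - u)^2
   up to u = 1, and 1 from there on. *)
Definition smooth_step (a b t : R) :=
  2 * ramp2 a b t + (-4 * ramp2 a (b - 2^-1) t + 2 * ramp2 a (b - 1) t).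

Lemma C1_smooth_step (a b : R) : exists f', C1_real (smooth_step a b) f'.
Proof.
eexists; apply: C1_realD; first exact: C1_realZ (C1_ramp2 a b).
apply: C1_realD; first exact: C1_realZ (C1_ramp2 a _).
exact: C1_realZ (C1_ramp2 a _).
Qed.

Lemma smooth_step0 (a b t : R) : a * t + b <= 0 -> smooth_step a b t = 0.
Proof.
move=> h; rewrite /smooth_step /ramp2 !maxEle h !ifT; [|lra|lra].
by rewrite expr0n/= !mulr0 !addr0.
Qed.

Lemma smooth_step1 (a b t : R) : 1 <= a * t + b -> smooth_step a b t = 1.
Proof.
move=> h; rewrite /smooth_step /ramp2.
by rewrite !max_l; [field|lra|lra|lra].
Qed.

Lemma smooth_step_itv (a b t : R) : 0 <= smooth_step a b t <= 1.
Proof.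
rewrite /smooth_step /ramp2 !addrA.
set x := a * t + b.
rewrite !maxEle; have [x0|x0] := leP x 0; have [x1|x1] := leP (x - 2^-1) 0;
  have [x2|x2] := leP (x - 1) 0; apply/andP; split; nra.
Qed.

End SmoothSteps.

(** * From test functions to indicators of measurable sets *)

Section MonotoneClass.
Context (R : realType).
Local Notation mu := (lebesgue_delay R).

(* A test function that vanishes outside of [a + 1/n, - 1/n] and is 1 on
   [a + 2/n, - 2/n]. *)
Definition bump (a n t : R) :=
  smooth_step n (- (n * a) - 1) t * smooth_step (- n) (- 1) t.

Lemma bump_itv (a n t : R) : 0 <= bump a n t <= 1.
Proof.
rewrite /bump; have /andP[u0 u1] := smooth_step_itv n (- (n * a) - 1) t.
have /andP[v0 v1] := smooth_step_itv (- n) (- 1) t.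
by rewrite mulr_ge0// mulr_ile1.
Qed.

Lemma bump_test (a n : R) : -1 <= a -> 0 < n -> test_function (bump a n).
Proof.
move=> a1 n0.
have [f' hf] := C1_smooth_step n (- (n * a) - 1).
have [g' hg] := C1_smooth_step (- n) (- 1).
have [dfg cfg] := C1_realM hf hg; split.
- by move=> t; have [] := dfg t.
- rewrite (_ : derive1 _ = fun t => smooth_step n (- (n * a) - 1) t * g' t +
    smooth_step (- n) (-1) t * f' t)//.
  by apply/funext => t; rewrite derive1E; have [_] := dfg t.
- exists (a + n^-1), (- n^-1).
  have ni : 0 < n^-1 by rewrite invr_gt0.
  split; [by lra|by lra|] => t; rewrite in_itv/= negb_and -!ltNge => /orP[ta|tb].
    rewrite /bump smooth_step0 ?mul0r//.
    have : n * (t - a) <= n * n^-1 by rewrite ler_pM2l//; lra.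
    by rewrite mulfV ?gt_eqF//; lra.
  rewrite /bump [X in _ * X]smooth_step0 ?mulr0//.
  have : n * - n^-1 <= n * t by rewrite ler_pM2l//; lra.
  by rewrite mulrN mulfV ?gt_eqF//; lra.
Qed.

Lemma bump_cvg (a t : R) : bump a n.+1%:R t @[n --> \oo] --> (\1_`]a, 0[%classic t : R).
Proof.
rewrite indicE; have [|tI] := boolP (t \in `]a, 0[%classic); last first.
  rewrite (_ : (fun n => _) = fun=> 0); first exact: cvg_cst.
  apply/funext => n; move: tI; rewrite mem_setE in_itv/= negb_and -!leNgt => /orP[ta|t0].
    rewrite /bump smooth_step0 ?mul0r//.
    have : n.+1%:R * (t - a) <= 0 by rewrite pmulr_rle0// subr_le0.
    by lra.
  rewrite /bump [X in _ * X]smooth_step0 ?mulr0//.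
  have : 0 <= n.+1%:R * t by rewrite mulr_ge0.
  by lra.
rewrite mem_setE in_itv/= => /andP[at_ t0].
pose d := Num.min (t - a) (- t).
have d0 : 0 < d by rewrite lt_min subr_gt0 at_ oppr_gt0.
apply: cvg_near_cst; near=> n.
have nd : 2 <= n.+1%:R * d.
  rewrite -ler_pdivrMr// (@le_trans _ _ n%:R)//; last by rewrite ler_nat.
  by near: n; exact: nbhs_infty_ger.
have [d1 d2] : d <= t - a /\ d <= - t by split; rewrite ge_min lexx ?orbT.
have h1 : n.+1%:R * d <= n.+1%:R * (t - a) by rewrite ler_pM2l.
have h2 : n.+1%:R * d <= n.+1%:R * - t by rewrite ler_pM2l.
by rewrite /bump !smooth_step1 ?mulr1//; lra.
Unshelve. all: by end_near. Qed.

Lemma continuous_measurable (f : R -> R) : continuous f ->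
  measurable_fun setT (f : measurableTypeR R -> measurableTypeR R).
Proof. by move=> cf; exact: continuous_measurable_fun. Qed.

(** The sets whose indicator satisfies [L] form a Dynkin system. It contains the open rays, which on
    [[-1, 0]] are almost everywhere limits of bumps; these are stable under intersection and
    generate the Borel sets. *)
Lemma delay_monotone_class (L : (R -> R) -> Prop) :
  (forall phi, test_function phi -> L phi) ->
  (forall a u v, L u -> L v -> L (fun t => a * u t + v t)) ->
  (forall (u : nat -> R -> R) (v : R -> R), (forall n, L (u n)) ->
     (forall n, measurable_fun setT (u n : measurableTypeR R -> _)) ->
     measurable_fun setT (v : measurableTypeR R -> _) ->
     (forall n t, `|u n t| <= 1) -> (forall t, `|v t| <= 1) ->
     (\forall t \ae mu, u n t @[n --> \oo] --> v t) -> L v) ->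
  forall B : set (measurableTypeR R), measurable B -> L \1_B.
Proof.
move=> Ltest Llin Llim.
have indic1 (B : set R) t : `|\1_B t : R| <= 1.
  by rewrite indicE; case: (t \in B); rewrite ?normr1// normr0.
have mind (B : set (measurableTypeR R)) : measurable B ->
    measurable_fun setT (\1_B : measurableTypeR R -> measurableTypeR R).
  exact: measurable_indic.
have ray (a : R) : measurable (`]a, +oo[%classic : set (measurableTypeR R)) /\
    L \1_`]a, +oo[%classic.
  split; first exact: measurable_itv.
  (* Bumps must be supported in []-1, 0[], and the measure does not see the rest of the ray. *)
  pose a' := Num.max a (-1).
  have a'1 : -1 <= a' by rewrite le_max lexx orbT.
  apply: (Llim (fun n => bump a' n.+1%:R)) => //.
  - by move=> n; apply: Ltest; exact: bump_test.
  - move=> n; apply: continuous_measurable.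
    have [dphi _ _] := @bump_test a' n.+1%:R a'1 (ltr0Sn _ _).
    by move=> t; apply: differentiable_continuous; apply/derivable1_diffP.
  - by move=> n t; have /andP[u0 u1] := bump_itv a' n.+1%:R t; rewrite ger0_norm.
  - have H x : \forall t \ae mu, t != x.
      exists [set x]; split; first exact: measurable_set1.
        have : (lebesgue_measure ([set x] `&` `[(-1)%R, 0%R]) <=
            lebesgue_measure [set x])%E.
          apply: le_measure; rewrite ?inE; last exact: subIsetl.
            by apply: measurableI; [exact: measurable_set1|exact: measurable_itv].
          exact: measurable_set1.
        by rewrite lebesgue_measure_set1 measure_le0 => /eqP.
      by move=> t /= /negP; rewrite negbK => /eqP.
    have H01 : \forall t \ae mu, t != 0 /\ t != -1.
      by apply: (aeS2 _ (H 0) (H (-1))) => t t0 t1; split.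
    apply: (aeS2 _ H01 (delay_ae_itv R)) => t [t0 t1] tI.
    have := @bump_cvg a' t.
    have -> // : \1_`]a', 0[%classic t = \1_`]a, +oo[%classic t :> R.
    rewrite !indicE !mem_setE !in_itv/= andbT.
    move: tI; rewrite in_itv/= => /andP[t1' t0'].
    have tl : (t : R) < 0 by rewrite lt_neqAle t0' andbT.
    have tg : -1 < (t : R) by rewrite lt_neqAle t1' andbT eq_sym.
    by rewrite tl /a' gt_max tg !andbT.
have comp (B : set (measurableTypeR R)) : L (\1_B) -> L (\1_(~` B)).
  have LT : L (fun=> 1).
    (* The ray from -2 contains [[-1, 0]], so its indicator is 1 almost everywhere. *)
    apply: (Llim (fun=> \1_(`]-2, +oo[%classic : set R)) (fun=> 1)) => //.
    - by move=> _; case: (ray (-2)).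
    - by move=> t; rewrite normr1.
    - apply: aeS (delay_ae_itv R) => t; rewrite in_itv/= => /andP[t1 _].
      apply: cvg_near_cst; apply: nearW => n.
      rewrite indicE mem_setE in_itv/= andbT (lt_le_trans _ t1)//.
      by rewrite ltrN2 ltr1n.
  move=> LB; have := Llin (-1) _ _ LB LT.
  congr L; apply/funext => t; rewrite !indicE in_setC.
  by case: (t \in B); rewrite /= ?mulr1 ?mulr0 ?addNr ?add0r.
have bigU (F : nat -> set (measurableTypeR R)) : trivIset setT F ->
    (forall n, measurable (F n)) -> (forall n, L (\1_(F n))) ->
    L (\1_(\bigcup_n F n)).
  move=> tF mF LF.
  have mU n : measurable (\big[setU/set0]_(i < n) F i).
    by apply: bigsetU_measurable => i _.
  apply: (Llim (fun n => \1_(\big[setU/set0]_(i < n) F i))) => //.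
  - elim=> [|n IH].
      rewrite big_ord0; have := Llin (-1) _ _ (LF 0%N) (LF 0%N).
      by congr L; apply/funext => t; rewrite indic0 mulN1r addNr.
    have := Llin 1 _ _ IH (LF n); congr L; apply/funext => t.
    rewrite big_ord_recr/= mul1r !indicE in_setU.
    have [tn|tn] := boolP (t \in F n); last by rewrite orbF addr0.
    rewrite orbT memNset ?add0r//.
    rewrite -bigcup_mkord => -[i /= ltin Fi].
    have Fin : F i `&` F n !=set0 by exists t; split=> //; exact: set_mem.
    by move: ltin; rewrite (tF i n Logic.I Logic.I Fin) ltnn.
  - by apply: (mind (\bigcup_n F n)); exact: bigcup_measurable.
  - apply: aeW => t; apply: cvg_near_cst.
    have [[N _ FN]|nF] := pselect ((\bigcup_n F n) t).
      exists N.+1 => // n /= Nn; rewrite !indicE !mem_set//; first by exists N.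
      by rewrite -bigcup_mkord; exists N.
    apply: nearW => n; rewrite !indicE !memNset//.
    by rewrite -bigcup_mkord => -[i _ Fi]; apply: nF; exists i.
have IC : setI_closed (@RGenOInfty.G R).
  move=> _ _ [x ->] [y ->]; exists (Num.max x y).
  by apply/seteqP; split=> t /=; rewrite !in_itv/= !andbT gt_max => /andP.
move=> B mB.
have : <<s (@RGenOInfty.G R) >> B by have := mB; rewrite -[X in X B]/((@ocitv R).-sigma.-measurable) RGenOInfty.measurableE.
rewrite -setI_closed_g_dynkin_g_sigma_algebra// => /(_ [set B | measurable B /\ L \1_B]).
case=> //; split=> [|_ [a ->]]; last exact: ray.
split.
(* The whole line is obtained as a ray together with its complement. *)
- split=> //; have [_ h0] := ray 0; have := Llin (1) _ _ h0 (comp _ h0).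
  congr L; apply/funext => t; rewrite mul1r !indicE in_setC in_setT.
  by case: (t \in _); rewrite /= ?addr0 ?add0r.
- by move=> A [mA LA]; split; [exact: measurableC|exact: comp].
- move=> F tF FmL; split; first by apply: bigcup_measurable => n _; case: (FmL n).
  by apply: bigU => // n; case: (FmL n).
Qed.

End MonotoneClass.

(** * Uniqueness of weak derivatives *)

Section WeakUniqueness.
Context (R : realType) (X : completeNormedModType R) (p : R) (p1 : 1 <= p).
Local Notation mu := (lebesgue_delay R).
Local Notation Lp := (delayLp p1 X).

Let mufin : (mu setT < +oo)%E. Proof. exact: delay_measure_fin. Qed.

(** On the set where d is within [|y| / 2] of a nonzero y, the integral of [d - y] is minus the
    measure times y, while its norm is at most half of that; so the set is null. Countably many y
    suffice, namely the values of the approximating simple functions. *)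
Lemma bochner_indic0_eq0 (d : measurableTypeR R -> X) : strongly_measurable d ->
  (forall B : set (measurableTypeR R), measurable B ->
    is_bochner_integral mu (fun t => \1_B t *: d t) 0) ->
  \forall t \ae mu, d t = 0.
Proof.
move=> md H; have [s ss sd] := md.
pose N (y : X) := [set t : measurableTypeR R | y != 0 /\ `|d t - y| <= `|y| / 2].
have mN y : measurable (N y).
  have [->|y0] := eqVneq y 0.
    by rewrite (_ : N 0 = set0)//; apply/seteqP; split=> t // [] /eqP.
  rewrite (_ : N y = setT `&` [set t | `|d t - y| <= `|y| / 2]); last first.
    by apply/seteqP; split=> t [].
  apply: measurable_fun_le => //.
  have := strongly_measurable_norm (strongly_measurableB md
    (strongly_measurable_cst (measurableTypeR R) y)).
  by [].
have N0 y : mu.-negligible (N y).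
  apply/negligibleP => //.
  have [->|y0] := eqVneq y 0.
    by rewrite (_ : N 0 = set0)//; apply/seteqP; split=> t // [] /eqP.
  have b1 := bochner_lin mufin (-1) (H _ (mN y)) (bochner_indic mufin y (mN y)).
  have B := bochner_norm mufin b1.
  rewrite scaler0 add0r normrZ ger0_norm ?fine_ge0// in B.
  have intN : (\int[mu]_t (`|y| / 2 * \1_(N y) t)%:E = (`|y| / 2)%:E * mu (N y))%E.
    rewrite (@integralZl_indic _ _ _ mu setT _ (fun=> N y))//; last first.
      by rewrite ltNge divr_ge0.
    by rewrite integral_indic// setIT.
  have muN : mu (N y) \is a fin_num by exact: finite_measure_fin_num.
  have H1 : fine (mu (N y)) * `|y| <= `|y| / 2 * fine (mu (N y)).
    rewrite -lee_fin; apply: le_trans B _; rewrite EFinM fineK// -intN.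
    apply: ge0_le_integral => //.
    - apply: measurable_EFin_norm; apply: (strongly_measurable_lin (-1)).
        by have := bochner_strongly_measurable (H _ (mN y)).
      by apply: simple_strongly_measurable; exact: simple_indic.
    - by apply/measurable_EFinP; apply: measurable_funM.
    - move=> t _; rewrite lee_fin indicE.
      have [/set_mem [_ tN]|tN] := boolP (t \in N y).
        by rewrite mulr1 !scale1r scaleN1r addrC distrC.
      by rewrite !scale0r scaler0 addr0 normr0 mulr0.
  have ny : 0 < `|y| by rewrite normr_gt0.
  have f0 : 0 <= fine (mu (N y)) by rewrite fine_ge0.
  suff fE : fine (mu (N y)) = 0 by transitivity (fine (mu (N y)))%:E; [rewrite fineK|rewrite fE].
  apply/le_anti; rewrite f0 andbT.
  have H2 : `|y| * (2 * fine (mu (N y))) <= `|y| * fine (mu (N y)) by lra.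
  by move: H2; rewrite ler_pM2l//; lra.
have /choice[r rs] : forall n, exists r : seq X, forall t, s n t \in r.
  by move=> n; have [r _ rs] := finite_range_seq (ss n).1; exists r.
have : mu.-negligible (\bigcup_n \bigcup_i N (nth 0 (r n) i)).
  by apply: negligible_bigcup => n; apply: negligible_bigcup => i.
apply: negligibleS => t /= dt0.
(* An approximant within a third of [|d t|] has norm above two thirds of it, hence is at distance at
   most half its own norm. *)
have nd : 0 < `|d t| / 3 by rewrite divr_gt0// normr_gt0; exact/eqP.
have /cvgrPdist_lt/(_ _ nd)/filter_ex[n dsn] := sd t.
exists n => //; exists (index (s n t) (r n)) => //.
rewrite nth_index//.
have dn : `|d t| <= `|d t - s n t| + `|s n t| by rewrite -{1}[d t](subrK (s n t)) ler_normD.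
split; last by lra.
by rewrite -normr_gt0; move: nd dsn dn; lra.
Qed.

(* A function orthogonal to all test functions is orthogonal to all indicators,
   by the monotone class argument. *)
Lemma weak_derivative_uniq (f g g' : Lp) :
  weak_derivative f g -> weak_derivative f g' -> g = g'.
Proof.
move=> fg fg'; apply: Lp_ext.
pose d (t : measurableTypeR R) := g t - g' t.
have [mg _] := memLp_fun g; have [mg' _] := memLp_fun g'.
have [md fd] : memLp mu p d by apply: memLpB => //; exact: memLp_fun.
have d1 : (\int[mu]_t `|d t|%:E < +oo)%E.
  have a0 : 0 < `|toLp mu p1 d| + 1 by rewrite ltr_wpDl.
  apply: le_lt_trans (L1_le_Lp (p1 := p1) mufin (conj md fd) a0 _) _.
    by rewrite lerDl.
  by rewrite ltry.
suff : \forall t \ae mu, d t = 0.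
  by apply: aeS => t /eqP; rewrite subr_eq0 => /eqP.
apply: bochner_indic0_eq0 => //.
apply: (delay_monotone_class (L := fun u => is_bochner_integral mu
  (fun t : measurableTypeR R => u t *: d t) 0)).
- move=> phi tphi; have [I I1 I2] := fg phi tphi; have [I' I1' I2'] := fg' phi tphi.
  have II' := bochner_uniq mufin I1 I1'; rewrite -II' in I2'.
  have := bochner_lin mufin (-1) I2' I2; rewrite scaleN1r opprK subrr.
  by congr is_bochner_integral; apply/funext => t; rewrite scaleN1r scalerBr addrC.
- move=> a u v Lu Lv; have := bochner_lin mufin a Lu Lv; rewrite scaler0 addr0.
  by congr is_bochner_integral; apply/funext => t; rewrite scalerA scalerDl.
- move=> u v Lu mu_ mv u1 v1 uv.
  have mvd : strongly_measurable (fun t : measurableTypeR R => v t *: d t).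
    exact: strongly_measurable_scale.
  have mud n : strongly_measurable (fun t : measurableTypeR R => u n t *: d t).
    exact: strongly_measurable_scale.
  have [|I HI] := bochner_exists mufin mvd.
    apply: le_lt_trans d1; apply: ge0_le_integral => //.
    - exact: measurable_EFin_norm.
    - exact: measurable_EFin_norm.
    - by move=> t _; rewrite lee_fin normrZ ler_piMl.
  suff -> : 0 = I by [].
  apply/esym/eqP; rewrite -normr_le0 -lee_fin; apply/lee_addgt0Pr => e e0.
  rewrite add0e.
  have H0 : (\int[mu]_t `|u n t *: d t - v t *: d t|%:E)%E @[n --> \oo] --> 0%E.
    apply: (dominated_cvg_L1 (g := fun t => 2 * `|d t|)) => //.
    - by apply: aeS uv => t uvt; apply: cvgZr_tmp.
    - rewrite (_ : _ \o _ = fun t => (2%:E * `|d t|%:E)%E); last first.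
        by apply/funext => t; rewrite /= EFinM.
      apply: integrableZl => //; apply/integrableP; split.
        exact: measurable_EFin_norm.
      by under eq_integral do rewrite gee0_abs//.
    - move=> n t; rewrite -scalerBl normrZ ler_wpM2r//.
      by rewrite (le_trans (ler_normB _ _))// (le_trans (lerD (u1 n t) (v1 t))).
  have /fine_cvgP[sfin /cvgrPdist_le/(_ _ e0) H0'] := H0.
  have [n [n1 n2]] := filter_ex (filterI sfin H0').
  have := bochner_norm mufin (bochner_lin mufin (-1) (Lu n) HI).
  rewrite scaler0 add0r => /le_trans; apply.
  have -> : (\int[mu]_t `|-1 *: (u n t *: d t) + v t *: d t|%:E =
      \int[mu]_t `|u n t *: d t - v t *: d t|%:E)%E.
    by apply: eq_integral => t _; rewrite scaleN1r addrC distrC.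
  rewrite -[leLHS]fineK// lee_fin (le_trans (ler_norm _))//.
  by move: n2; rewrite /= sub0r normrN.
Qed.

(** [derivative] is a chosen weak derivative; uniqueness identifies it with the classical one. *)
Lemma derivative_right_C1 (k k' : R -> X) : right_C1 k k' ->
  W1p (delay_toLp p1 k) /\ derivative (delay_toLp p1 k) = delay_toLp p1 k'.
Proof.
move=> kk'; have wk := weak_derivative_right_C1 p1 kk'.
split; first by eexists; exact: wk.
apply: (weak_derivative_uniq _ wk).
by apply: (@xgetPex _ 0 (weak_derivative (delay_toLp p1 k))); eexists; exact: wk.
Qed.

End WeakUniqueness.

(** * Density of smooth curves *)

Section TestDensity.
Context (R : realType) (X : completeNormedModType R) (p : R) (p1 : 1 <= p).
Local Notation mu := (lebesgue_delay R).
Local Notation Lp := (delayLp p1 X).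

Let mufin : (mu setT < +oo)%E. Proof. exact: delay_measure_fin. Qed.

(** Adding such a curve changes only the history: the value at 0 and the orbit at positive times are
    kept. *)
Definition vanishing_C1 (k k' : R -> X) :=
  right_C1 k k' /\ forall t, 0 <= t -> k t = 0 /\ k' t = 0.

Definition approximable (F : Lp) := forall e : R, 0 < e ->
  exists k k', vanishing_C1 k k' /\ `|F - delay_toLp p1 k| <= e.

Lemma vanishing_C1_lin (a : R) (k k' l l' : R -> X) : vanishing_C1 k k' ->
  vanishing_C1 l l' ->
  vanishing_C1 (fun t => a *: k t + l t) (fun t => a *: k' t + l' t).
Proof.
move=> [kk k0] [ll l0]; split; first exact: right_C1D (right_C1Z a kk) ll.
move=> t t0; have [-> ->] := k0 t t0; have [-> ->] := l0 t t0.
by rewrite scaler0 addr0.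
Qed.

Lemma approximable_lin (a : R) (F G : Lp) : approximable F -> approximable G ->
  approximable (a *: F + G).
Proof.
move=> hF hG e e0.
have a0 : 0 < `|a| + 1 by rewrite ltr_wpDl.
have e20 : 0 < e / 2 by rewrite divr_gt0.
have [k [k' [kk Fk]]] := hF (e / 2 / (`|a| + 1)) (divr_gt0 e20 a0).
have [l [l' [ll Gl]]] := hG (e / 2) e20.
exists (fun t => a *: k t + l t), (fun t => a *: k' t + l' t).
split; first exact: vanishing_C1_lin.
have [[ck _ _] _] := kk; have [[cl _ _] _] := ll.
rewrite (delay_toLp_lin p1 a (memLp_curve p1 ck) (memLp_curve p1 cl)).
rewrite opprD addrACA -scalerBr (le_trans (ler_normD _ _))// [leRHS](splitr e) lerD//.
rewrite normrZ (@le_trans _ _ (`|a| * (e / 2 / (`|a| + 1))))//; first exact: ler_wpM2l.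
rewrite mulrCA ger_pMr ?divr_gt0// ler_pdivrMr// mul1r.
by rewrite lerDl.
Qed.

Lemma approximable_closed (F : Lp) :
  (forall e : R, 0 < e -> exists2 G, approximable G & `|F - G| <= e) -> approximable F.
Proof.
move=> H e e0; have e20 : 0 < e / 2 by rewrite divr_gt0.
have [G hG FG] := H _ e20; have [k [k' [kk Gk]]] := hG _ e20.
exists k, k'; split=> //.
by rewrite (le_trans (ler_distD G _ _))// (splitr e) lerD.
Qed.

Lemma test_vanishing (phi : R -> R) (y : X) : test_function phi ->
  vanishing_C1 (fun t => phi t *: y) (fun t => derive1 phi t *: y + phi t *: 0).
Proof.
move=> tphi; split; first exact: test_right_C1 (right_C1_cst y).
have [dphi _ [a [b [a1 b0 phi0]]]] := tphi.
have p0 t : 0 <= t -> phi t = 0.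
  move=> t0; apply: phi0; rewrite in_itv/= negb_and -!ltNge.
  by rewrite (lt_le_trans b0 t0) orbT.
move=> t t0; rewrite p0// !scale0r addr0; split=> //.
have -> : derive1 phi t = 0; last by rewrite scale0r.
apply: cvg_unique (derivable_right (dphi t)) _; first exact: norm_hausdorff.
apply: cvg_near_cst; near=> h; rewrite !p0 ?subrr ?mulr0//.
by rewrite addr_ge0.
Unshelve. all: by end_near. Qed.

(** The monotone class argument carries membership in L^p along with approximability, because [toLp]
    is linear only on members. *)
Lemma approximable_indic (B : set (measurableTypeR R)) (y : X) : measurable B ->
  approximable (toLp mu p1 (fun t : measurableTypeR R => \1_B t *: y)).
Proof.
move=> mB.
suff : memLp mu p (fun t : measurableTypeR R => \1_B t *: y) /\
  approximable (toLp mu p1 (fun t : measurableTypeR R => \1_B t *: y)) by case.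
apply: (@delay_monotone_class R (fun u => memLp mu p (fun t : measurableTypeR R => u t *: y) /\
  approximable (toLp mu p1 (fun t : measurableTypeR R => u t *: y)))) mB.
- move=> phi tphi; have vphi := test_vanishing y tphi.
  have [[cphi _ _] _] := vphi; have mphi := memLp_curve p1 cphi; split=> // e e0.
  exists (fun t => phi t *: y), (fun t => derive1 phi t *: y + phi t *: 0); split=> //.
  by rewrite (delay_toLpE p1 mphi) subrr normr0 ltW.
- move=> a u v [mu_ hu] [mv hv].
  have E : (fun t : measurableTypeR R => (a * u t + v t) *: y) =
      fun t : measurableTypeR R => a *: (u t *: y) + v t *: y.
    by apply/funext => t; rewrite scalerDl scalerA.
  rewrite E; split; first exact: (memLp_lin p1 a mu_ mv).
  by rewrite (toLp_lin p1 a mu_ mv); exact: approximable_lin.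
- move=> u v hu mu_ mv u1 v1 uv.
  have mvy : memLp mu p (fun t : measurableTypeR R => v t *: y).
    apply: (memLp_bounded p1 mufin (M := `|y|)).
      by apply: strongly_measurable_scale => //; exact: strongly_measurable_cst.
    by move=> t; rewrite normrZ ler_piMl.
  split=> //; apply: approximable_closed => e e0.
  have : toLp mu p1 (fun t : measurableTypeR R => u n t *: y) @[n --> \oo] -->
      toLp mu p1 (fun t : measurableTypeR R => v t *: y).
    apply: (@dominated_cvg_Lp _ (measurableTypeR R) R mu p p1 X
      (fun n t => u n t *: y) (fun t => v t *: y) (fun=> 2 * `|y|)).
    + by move=> n; case: (hu n).
    + exact: mvy.
    + by apply: aeS uv => t uvt; apply: cvgZr_tmp.
    + move=> n t; rewrite -scalerBl normrZ ler_wpM2r//.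
      by rewrite (le_trans (ler_normB _ _))// (le_trans (lerD (u1 n t) (v1 t))).
    + apply/integrableP; split; first exact: measurable_cst.
      rewrite (_ : (fun t : measurableTypeR R => _) =
        cst ((2 * `|y|) `^ p)%:E); last first.
        by apply/funext => t; rewrite /= ger0_norm// powR_ge0.
      by rewrite integral_cst// lte_mul_pinfty// lee_fin powR_ge0.
  move=> /cvgrPdist_le/(_ _ e0)/filter_ex[n un].
  by eexists; last exact: un; case: (hu n).
Qed.

Lemma approximableT (F : Lp) : approximable F.
Proof.
apply: approximable_closed => e e0.
have [s ss Fs] := simple_dense_Lp mufin F e0; exists (toLp mu p1 s) => //.
have [r ur rs] := finite_range_seq ss.1.
have -> : s = fun t : measurableTypeR R => \sum_(y <- r) \1_(s @^-1` [set y]) t *: y.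
  apply/funext => t; rewrite (bigD1_seq (s t))//= indicE mem_set// scale1r.
  rewrite big1 ?addr0// => y yst; rewrite indicE memNset ?scale0r//=.
  by move=> /esym/eqP; rewrite (negbTE yst).
have mB y : measurable (s @^-1` [set y]) by case: ss.
suff : memLp mu p (fun t : measurableTypeR R => \sum_(y <- r) \1_(s @^-1` [set y]) t *: y) /\
  approximable (toLp mu p1 (fun t : measurableTypeR R =>
    \sum_(y <- r) \1_(s @^-1` [set y]) t *: y)) by case.
elim: (r) => [|y r' [IH1 IH2]].
  have -> : (fun t : measurableTypeR R => \sum_(y <- [::]) \1_(s @^-1` [set y]) t *: y) = fun=> 0.
    by apply/funext => t; rewrite big_nil.
  split; first exact: memLp0.
  rewrite toLp0 => d d0; exists (fun=> 0), (fun=> 0); split.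
    by split=> //; exact: right_C1_cst.
  have -> : delay_toLp p1 (fun _ : R => (0 : X)) = 0.
    exact: etrans (delay_toLpE p1 (memLp0 mu p1 X)) (toLp0 mu p1 X).
  by rewrite subrr normr0 ltW.
have -> : (fun t : measurableTypeR R => \sum_(y0 <- y :: r') \1_(s @^-1` [set y0]) t *: y0) =
    fun t : measurableTypeR R => 1 *: (\1_(s @^-1` [set y]) t *: y) +
      \sum_(y0 <- r') \1_(s @^-1` [set y0]) t *: y0.
  by apply/funext => t; rewrite big_cons scale1r.
have m1 : memLp mu p (fun t : measurableTypeR R => \1_(s @^-1` [set y]) t *: y).
  by apply: (simple_memLp p1 mufin); exact: simple_indic.
split; first exact: (memLp_lin p1 1 m1 IH1).
rewrite (toLp_lin p1 1 m1 IH1); apply: approximable_lin => //.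
exact: approximable_indic.
Qed.

End TestDensity.

(** * Shift and history operators *)

Section ShiftHistory.
Context (R : realType) (X : completeNormedModType R) (p : R) (p1 : 1 <= p).
Local Notation mu := (lebesgue_delay R).
Local Notation Lp := (delayLp p1 X).

Let p_gt0 : 0 < p. Proof. exact: lt_le_trans p1. Qed.

Let shifted (s : R) (f : R -> X) : measurableTypeR R -> X :=
  fun t => if s + t <= 0 then f (s + t) else 0.

Lemma memLp_shifted (s : R) (f : measurableTypeR R -> X) : 0 <= s -> memLp mu p f ->
  memLp mu p (shifted s f) /\
  (\int[mu]_t (`|shifted s f t| `^ p)%:E <= \int[mu]_t (`|f t| `^ p)%:E)%E.
Proof.
move=> s0 [mf ff].
have mI : measurable ([set t | s + t <= 0] : set (measurableTypeR R)).
  rewrite (_ : [set t | s + t <= 0] = `]-oo, - s]%classic); first exact: measurable_itv.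
  by apply/seteqP; split=> t /=; rewrite in_itv/=; lra.
have ms : strongly_measurable (shifted s f).
  have := strongly_measurable_if mI
    (strongly_measurable_comp (measurable_translation s) mf)
    (strongly_measurable_cst (measurableTypeR R) 0).
  congr strongly_measurable; apply/funext => t; rewrite /shifted.
  have [st|st] := boolP (s + t <= 0); first by rewrite mem_set.
  by rewrite memNset//=; exact/negP.
have := @integral_delay_shift R s (fun t => (`|f t| `^ p)%:E) s0.
have -> : (\int[mu]_t (if (s + t <= 0)%R then (`|f (s + t)%R| `^ p)%:E else 0) =
    \int[mu]_t (`|shifted s f t| `^ p)%:E)%E.
  apply: eq_integral => t _; rewrite /shifted; case: ifP => // _.
  by rewrite normr0 powR0// gt_eqF.
move=> /(_ _ _)H.
have {}H : (\int[mu]_t (`|shifted s f t| `^ p)%:E <= \int[mu]_t (`|f t| `^ p)%:E)%E.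
  apply: H; first by move=> t; rewrite lee_fin powR_ge0.
  exact: measurable_norm_powR.
exact: conj (conj ms (le_lt_trans H ff)) H.
Qed.

(** The shift evaluates a chosen representative of the class; [k] may replace it since an almost
    everywhere identity is preserved by the shift. *)
Lemma nilpotent_shiftE (s : R) (k : R -> X) : 0 <= s -> continuous k ->
  nilpotent_shift s (delay_toLp p1 k) = toLp mu p1 (shifted s k) /\
  memLp mu p (shifted s k).
Proof.
move=> s0 ck; have mk := memLp_curve p1 ck.
have [m1 _] := memLp_shifted s0 (memLp_fun (delay_toLp p1 k)).
have [m2 _] := memLp_shifted s0 mk; split=> //.
rewrite /nilpotent_shift (delay_toLpE p1 m1); apply: (eq_toLp p1 m1 m2).
apply: aeS (delay_ae_shift s0 (delay_toLp_ae p1 mk)) => t H.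
by rewrite /shifted; case: ifPn => // /H.
Qed.

Lemma nilpotent_shift_norm (s : R) (F : Lp) : 0 <= s -> `|nilpotent_shift s F| <= `|F|.
Proof.
move=> s0; have [m1 H] := memLp_shifted s0 (memLp_fun F).
rewrite /nilpotent_shift (delay_toLpE p1 m1).
by apply: (toLp_norm_le p1 m1); rewrite ?Lp_norm_pow.
Qed.

(** On [[-1, 0]] the condition [s + t <= 0] leaves at most the point -1, a null set. *)
Lemma nilpotent_shift_ge1 (s : R) (F : Lp) : 1 <= s -> nilpotent_shift s F = 0.
Proof.
move=> s1; have s0 : 0 <= s by apply: le_trans s1.
have [m1 _] := memLp_shifted s0 (memLp_fun F).
rewrite /nilpotent_shift (delay_toLpE p1 m1) -(toLp0 mu p1 X).
apply: (eq_toLp p1 m1 (memLp0 mu p1 X)).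
have N1 : \forall t \ae mu, t != -1.
  exists [set -1]; split; first exact: measurable_set1.
    have : (lebesgue_measure ([set (-1)%R] `&` `[(-1)%R, (0 : R)%R]) <=
        lebesgue_measure [set (-1 : R)%R])%E.
      apply: le_measure; rewrite ?inE; last exact: subIsetl.
        by apply: measurableI; [exact: measurable_set1|exact: measurable_itv].
      exact: measurable_set1.
    by rewrite lebesgue_measure_set1 measure_le0 => /eqP.
  by move=> t /= /negP; rewrite negbK => /eqP.
apply: (aeS2 _ (delay_ae_itv R) N1) => t; rewrite in_itv/= => /andP[t1 t0] tN1.
rewrite /shifted; case: ifPn => // st.
have : t = -1 by apply/le_anti; rewrite t1 andbT; lra.
by move/eqP; rewrite (negbTE tN1).
Qed.

Context (S : R -> X -> X) (cS : c0_semigroup S) (M b : R).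
Hypothesis M0 : 0 < M.
Hypothesis SM : forall t, 0 <= t <= b -> forall x, `|S t x| <= M * `|x|.

Let hist (s : R) (x : X) : measurableTypeR R -> X :=
  fun t => if - s < t then S (s + t) x else 0.

Lemma strongly_measurable_history (s : R) (x : X) : strongly_measurable (hist s x).
Proof.
have mI : measurable ([set t | - s < t] : set (measurableTypeR R)).
  rewrite (_ : [set t | - s < t] = `]- s, +oo[%classic); first exact: measurable_itv.
  by apply/seteqP; split=> t /=; rewrite in_itv/= andbT.
have cT : continuous (fun t : R => S (Num.max (s + t) 0) x).
  move=> t; apply: (@continuous_comp _ _ _ (fun t : R => s + t) (fun r : R => S (Num.max r 0) x)).
    by apply: cvgD; [exact: cvg_cst|exact: cvg_id].
  exact: c0_max_continuous.
have := strongly_measurable_if mI (strongly_measurable_curve cT)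
  (strongly_measurable_cst (measurableTypeR R) 0).
congr strongly_measurable; apply/funext => t; rewrite /hist.
have [st|st] := boolP (- s < t); last by rewrite memNset//=; exact/negP.
by rewrite mem_set//= max_l//; move: st; lra.
Qed.

Lemma hist_bound (s t : R) (x : X) : 0 <= s -> s <= b -> t \in `[-1, 0] ->
  `|hist s x t| <= M * `|x|.
Proof.
move=> s0 sb; rewrite in_itv/= => /andP[_ t0]; rewrite /hist.
case: ifPn => [st|_]; last by rewrite normr0 mulr_ge0// ltW.
by apply: SM; apply/andP; split; lra.
Qed.

Lemma memLp_hist (s : R) (x : X) : 0 <= s -> s <= b -> memLp mu p (hist s x).
Proof.
move=> s0 sb; apply: (memLp_delay p1 (M := M * `|x|)).
  exact: strongly_measurable_history.
by move=> t tI; exact: hist_bound.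
Qed.

Lemma history_norm (s : R) (x : X) : 0 <= s -> s <= b ->
  `|history p1 S s x| <= M * `|x|.
Proof.
move=> s0 sb; apply: delay_norm_le.
- exact: strongly_measurable_history.
- by rewrite mulr_ge0// ltW.
- by move=> t tI; exact: hist_bound.
Qed.

(** The histories run through times down to 0, where S need not be norm continuous. A strip near
    [-a] is therefore split off: there only boundedness of S is used, together with the small
    measure; elsewhere the semigroup law reduces every increment to the one at [d]. *)
Lemma history_norm_continuous (a : R) :
  (forall d e, 0 < d -> 0 < e -> exists2 eta, 0 < eta &
    forall h, 0 < h -> h < eta -> forall x, `|S (d + h) x - S d x| <= e * `|x|) ->
  0 < a -> a < b ->
  forall e, 0 < e -> exists2 eta, 0 < eta & forall h, 0 < h -> h < eta ->
    forall x, `|history p1 S (a + h) x - history p1 S a x| <= e * `|x|.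
Proof.
move=> SN a0 ab e e0.
(* The second entry makes [(2 d) ^ (1/p)], times the crude bound [2 M] on the strip, at most
   [e / 2]. *)
pose d := Num.min (a / 2) ((e / (4 * M)) `^ p / 2).
have d0 : 0 < d by rewrite lt_min !divr_gt0// powR_gt0// divr_gt0// mulr_gt0.
have da : d < a by rewrite gt_min; apply/orP; left; lra.
have d2 : (2 * d) `^ p^-1 * (2 * M) <= e / 2.
  rewrite -ler_pdivlMr ?mulr_gt0//.
  have -> : e / 2 / (2 * M) = ((e / (4 * M)) `^ p) `^ p^-1.
    rewrite -powRrM mulfV ?gt_eqF// powRr1; last by rewrite divr_ge0 ?mulr_ge0 ?ltW.
    by field; rewrite gt_eqF.
  rewrite ge0_ler_powR ?nnegrE ?invr_ge0 ?powR_ge0 ?mulr_ge0 ?(ltW d0) ?(ltW p_gt0)//.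
  have : d <= (e / (4 * M)) `^ p / 2 by rewrite ge_min lexx orbT.
  by lra.
have e2 : 0 < e / (2 * M) by rewrite divr_gt0// mulr_gt0.
have [eta eta0 Heta] := SN d (e / (2 * M)) d0 e2.
exists (Num.min eta (Num.min d (b - a))).
  by rewrite lt_min eta0 lt_min d0 subr_gt0.
move=> h h0; rewrite lt_min => /andP[heta]; rewrite lt_min => /andP[hd hb] x.
have ahb : a + h <= b by lra.
have mh : memLp mu p (hist (a + h) x) by apply: memLp_hist => //; lra.
have ma : memLp mu p (hist a x) by apply: memLp_hist => //; lra.
rewrite /history -(delay_toLpB p1 mh ma).
(* To the left of the strip both histories vanish; to its right both times are at least [d]. Its
   length is [h + d], which is below [2 d]. *)
pose A := `]- a - h, - a + d]%classic : set (measurableTypeR R).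
have mA : measurable A by exact: measurable_itv.
pose g t := hist (a + h) x t - hist a x t.
have mg : strongly_measurable g by case: (memLpB p1 mh ma).
pose g1 t := if t \in A then g t else 0.
pose g2 t := if t \in A then 0 else g t.
have mc0 := strongly_measurable_cst (measurableTypeR R) (0 : X).
have mg1 : strongly_measurable g1 by exact: strongly_measurable_if.
have mg2 : strongly_measurable g2 by exact: strongly_measurable_if.
have gM t : t \in `[-1, 0] -> `|g t| <= 2 * M * `|x|.
  move=> tI; rewrite (le_trans (ler_normB _ _))//.
  rewrite (le_trans (lerD (hist_bound x _ ahb tI) (hist_bound x (ltW a0) (ltW ab) tI)))//; lra.
have g2M t : t \in `[-1, 0] -> `|g2 t| <= e / 2 * `|x|.
  rewrite in_itv/= => /andP[t1 t0]; rewrite /g2.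
  have e2x : 0 <= e / 2 * `|x| by rewrite mulr_ge0// divr_ge0// ltW.
  case: ifPn => [_|]; first by rewrite normr0.
  rewrite mem_setE in_itv/= negb_and -!leNgt /g /hist.
  have [ta _|ta /=] := leP t (- a - h).
    by rewrite !ifF ?subrr ?normr0//; apply/negbTE; rewrite -leNgt; lra.
  rewrite -ltNge => dt.
  rewrite !ifT; [|lra|lra].
  have dat : 0 <= a + t - d by lra.
  have -> : a + h + t = (a + t - d) + (d + h) by lra.
  have -> : S (a + t) x = S (a + t - d) (S d x).
    by rewrite -[LHS]/(S (a + t) x) -{1}(subrK d (a + t)) (c0_add cS dat (ltW d0)).
  have dh : 0 <= d + h by lra.
  rewrite (c0_add cS dat dh) /=.
  rewrite -(linB (c0_linear cS dat)).
  rewrite (le_trans (SM _ _))//; first by apply/andP; split; lra.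
  rewrite (@le_trans _ _ (M * (e / (2 * M) * `|x|)))//; first by rewrite ler_pM2l// Heta.
  rewrite mulrA le_eqVlt; apply/orP; left; apply/eqP; congr (_ * _).
  by field; rewrite gt_eqF.
have Mx0 : 0 <= 2 * M * `|x| by rewrite mulr_ge0// mulr_ge0// ltW.
have m1 : memLp mu p g1.
  apply: (memLp_delay p1 (M := 2 * M * `|x|)) => // t tI; rewrite /g1.
  by case: ifP => _; [exact: gM|rewrite normr0].
have m2 : memLp mu p g2.
  apply: (memLp_delay p1 (M := 2 * M * `|x|)) => // t tI; rewrite /g2.
  by case: ifP => _; [rewrite normr0|exact: gM].
have gE : g = fun t => g1 t + g2 t.
  by apply/funext => t; rewrite /g1 /g2; case: ifP => _; rewrite ?addr0 ?add0r.
have -> : delay_toLp p1 (fun t => hist (a + h) x t - hist a x t) =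
    delay_toLp p1 g1 + delay_toLp p1 g2.
  rewrite (delay_toLpE p1 m1) (delay_toLpE p1 m2) -(toLpD p1 m1 m2).
  rewrite -[fun t => _ - _]/g gE; exact: delay_toLpE (memLpD p1 m1 m2).
rewrite (le_trans (ler_normD _ _))// [e in leRHS]splitr mulrDl lerD//.
  have muA : (mu A <= (2 * d)%:E)%E.
    apply: (@le_trans _ _ (lebesgue_measure A)).
      apply: le_measure; rewrite ?inE; [|exact: mA|exact: subIsetl].
      by apply: measurableI => //; exact: measurable_itv.
    rewrite lebesgue_measure_itv/= lte_fin ifT; last by lra.
    by rewrite -EFinB lee_fin; lra.
  apply: (@le_trans _ _ (2 * M * `|x| * (2 * d) `^ p^-1)).
    apply: (delay_norm_set p1 mA mg1 Mx0 muA).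
      by move=> t tI At; rewrite /g1 mem_set//; exact: gM.
    by move=> t tI At; rewrite /g1 memNset.
  by rewrite mulrAC ler_wpM2r// mulrC.
by apply: delay_norm_le => //; rewrite mulr_ge0// divr_ge0// ltW.
Qed.

End ShiftHistory.

(** * Density of the domain of a generator *)

Section Increments.
Context (R : realType) (X : normedModType R) (J c : R -> X) (a b : R).
Hypothesis cc : continuous c.
Hypothesis incr : forall s t v e, a <= s -> s <= t -> t <= b ->
  (forall r, s <= r -> r <= t -> `|c r - v| <= e) ->
  `|J t - J s - (t - s) *: v| <= e * (t - s).

Lemma increments_right s : a <= s -> s < b ->
  h^-1 *: (J (s + h) - J s) @[h --> 0^'+] --> c s.
Proof.
move=> as_ sb; apply/cvgrPdist_le => e e0.
have /cvgrPdist_le/(_ _ e0)/nbhs_ballP[d /= d0 Hd] := @cc s.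
near=> h.
have h0 : 0 < h by near: h; exact: nbhs_right_gt.
have hd : h < d by near: h; exact: nbhs_right_lt.
have hb : s + h <= b.
  by rewrite -lerBrDl; near: h; apply: nbhs_right_le; rewrite subr_gt0.
have ce r : s <= r -> r <= s + h -> `|c r - c s| <= e.
  move=> sr rh; rewrite distrC; apply: Hd; rewrite /ball/= distrC ger0_norm ?subr_ge0//.
  by rewrite ltrBlDl (le_lt_trans rh)// ltrD2l.
have sh : s <= s + h by rewrite lerDl ltW.
have := incr as_ sh hb ce; rewrite (_ : s + h - s = h); last by rewrite addrC addKr.
have -> : J (s + h) - J s - h *: c s = h *: (h^-1 *: (J (s + h) - J s) - c s).
  by rewrite scalerBr scalerA mulfV ?gt_eqF// scale1r.
by rewrite normrZ gtr0_norm// mulrC ler_pM2r// distrC.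
Unshelve. all: by end_near. Qed.

Lemma increments_left s u : a < s + u -> s + u <= b ->
  J (r + u) @[r --> s^'-] --> J (s + u).
Proof.
move=> as_ sb; have [M M0 HM] := continuous_bounded_itv a b cc.
apply/cvgrPdist_le => e e0; near=> r.
have rs : r + u <= s + u by rewrite lerD2r; near: r; exact: nbhs_left_le.
have ar : a <= r + u.
  by rewrite -lerBlDr; near: r; apply: nbhs_left_ge; rewrite ltrBlDr.
have H0 : `|J (s + u) - J (r + u)| <= M * (s + u - (r + u)).
  have := @incr (r + u) (s + u) 0 M ar rs sb; rewrite scaler0 subr0; apply => v ru us.
  by rewrite subr0 HM// (le_trans ar)//= (le_trans us).
rewrite (le_trans H0)// (addrC r) addrKA mulrC -ler_pdivlMr// lerBlDr -lerBlDl ltW//.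
by near: r; apply: nbhs_left_gt; rewrite ltrBlDr ltrDl divr_gt0.
Unshelve. all: by end_near. Qed.

End Increments.

Section GeneratorDense.
Context (R : realType) (X : completeNormedModType R).
Context (S : R -> X -> X) (cS : c0_semigroup S) (D : set X) (A : X -> X).
Hypothesis gS : is_generator S D A.

(** The averages of the orbit of x over [[0, t]] lie in the domain and tend to x as t tends to 0. *)
Lemma generator_dense (x : X) (e : R) : 0 < e -> exists2 y, D y & `|x - y| <= e.
Proof.
move=> e0; pose c (t : R) := S (Num.max t 0) x.
have cc : continuous c by exact: c0_max_continuous.
have c0 : c 0 = x by rewrite /c maxxx (c0_id cS).
have cE (t : R) : 0 <= t -> c t = S t x by move=> t0; rewrite /c max_l.
(* An interval of length 2 leaves room for a time up to 1 and a further step of at most 1. *)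
have [J [J0 _ incr]] := antiderivative cc (ler0n R 2)
  (fun A => erefl (mrestr lebesgue_measure (measurable_itv `[0, (2 : R)]) A)).
(* Instead of moving [S r] under the integral, both sides are compared by the mean value inequality:
   their difference has right derivative 0 in t. *)
have JS (r t : R) : 0 <= r -> 0 <= t -> t + r <= 2 -> S r (J t) = J (t + r) - J r.
  move=> r0 t0 tr.
  have lr := c0_linear cS r0; have br := c0_bounded cS r0.
  pose F u := S r (J u) - J (u + r).
  have t2 (s : R) : s <= t -> s + r <= 2 by lra.
  have cF (s : R) : 0 < s -> s <= t -> F u @[u --> s^'-] --> F s.
    move=> s0 st; have sr := t2 _ st; apply: cvgB; last first.
      by apply: (increments_left cc incr) => //; rewrite ltr_wpDr.
    apply: continuous_cvg; first exact: br.
    have := @increments_left _ _ _ _ _ _ cc incr s 0.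
    by rewrite addr0; under eq_fun do rewrite addr0; apply=> //; lra.
  have dF (s : R) : 0 <= s -> s < t -> h^-1 *: (F (s + h) - F s) @[h --> 0^'+] --> (0 : X).
    move=> s0 st.
    have -> : (0 : X) = S r (c s) - c (s + r).
      by rewrite !cE ?addr_ge0// (addrC s) (c0_add cS)//= subrr.
    have H1 : S r (h^-1 *: (J (s + h) - J s)) @[h --> 0^'+] --> S r (c s).
      by apply: (continuous_cvg _ (br _)); apply: (increments_right cc incr) => //; have := t2 _ (ltW st); lra.
    have H2 : h^-1 *: (J (s + r + h) - J (s + r)) @[h --> 0^'+] --> c (s + r).
      by apply: (@increments_right _ _ _ _ _ _ cc incr (s + r)); have := t2 _ (lexx t); lra.
    have H3 : S r (h^-1 *: (J (s + h) - J s)) - h^-1 *: (J (s + r + h) - J (s + r))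
        @[h --> 0^'+] --> S r (c s) - c (s + r) by apply: cvgB.
    apply: cvg_trans H3; apply: near_eq_cvg; near=> h.
    rewrite /F linZ// linB// -scalerBr (addrAC s h r); congr (_ *: _).
    by rewrite !opprB addrACA [in RHS]addrACA; congr (_ + _); rewrite addrC.
  have := @mean_value_le _ _ F (fun=> 0) 0 t 0 0 t0 cF dF.
  rewrite mul0r scaler0 !subr0 normr0 => /(_ (fun _ _ _ => lexx 0)).
  rewrite normr_le0 /F J0 lin0// !add0r opprK addrAC subr_eq0 => /eqP <-.
  by rewrite addrK.
have J0c : h^-1 *: (J (0 + h) - J 0) @[h --> 0^'+] --> c 0 by apply: (@increments_right _ _ _ _ _ _ cc incr 0); lra.
have DJ (t : R) : 0 < t -> t <= 1 -> D (t^-1 *: J t).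
  move=> t0 t1.
  have H1 : h^-1 *: (J (t + h) - J t) @[h --> 0^'+] --> c t.
    by apply: (@increments_right _ _ _ _ _ _ cc incr t); lra.
  suff : h^-1 *: (S h (t^-1 *: J t) - t^-1 *: J t) @[h --> 0^'+] --> t^-1 *: (c t - c 0).
    by move=> /(generator_uniq gS)[].
  have H3 : t^-1 *: (h^-1 *: (J (t + h) - J t) - h^-1 *: (J (0 + h) - J 0))
      @[h --> 0^'+] --> t^-1 *: (c t - c 0) by apply: cvgZl_tmp; apply: cvgB.
  apply: cvg_trans H3; apply: near_eq_cvg; near=> h.
  rewrite -scalerBr scalerA mulrC -scalerA; congr (_ *: _).
  rewrite linZ; last by apply: (c0_linear cS).
  rewrite -scalerBr; congr (_ *: _).
  rewrite JS ?add0r ?J0 ?subr0//; last 2 first. exact: ltW.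
    rewrite -lerBrDl; near: h; apply: nbhs_right_le; lra.
  by rewrite addrAC.
have : h^-1 *: J h @[h --> 0^'+] --> x.
  by move: J0c; rewrite c0; under eq_fun do rewrite add0r J0 subr0.
move=> /cvgrPdist_le/(_ _ e0) H.
suff [h [h0 h1 hx]] : exists h, [/\ 0 < h, h <= 1 & `|x - h^-1 *: J h| <= e].
  by exists (h^-1 *: J h) => //; exact: DJ.
near (0 : R)^'+ => h; exists h; split => //.
by near: h; apply: nbhs_right_le; lra.
by near: h.
Unshelve. all: by end_near. Qed.

End GeneratorDense.

(** * Segments and states of curves *)

Lemma complete_cvg_pow2 (R : realType) (X : completeNormedModType R) (u : X^nat) :
  (forall n, `|u n.+1 - u n| <= 2^-1 ^+ n) -> cvgn u.
Proof.
move=> uS.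
have : cvgn [normed series (fun n => u n.+1 - u n)].
  apply: (@series_le_cvg _ _ (geometric 1 2^-1)) => [n|n|n|] /=.
  - by [].
  - by rewrite mul1r exprn_ge0.
  - by rewrite mul1r.
  - by apply: is_cvg_geometric_series; rewrite ger0_norm ?invr_ge0// invf_lt1// ltr1n.
move=> /normed_cvg/cvg_ex[l sl]; apply/cvg_ex; exists (u 0%N + l).
rewrite [X in X n @[n --> _]](_ : u = fun n => u 0%N + series (fun n => u n.+1 - u n) n); last first.
  by apply/funext => n; rewrite (eq_sum_telescope u).
by apply: cvgD; [exact: cvg_cst|exact: sl].
Qed.

Section DelaySpace.
Context (R : realType) (X : completeNormedModType R) (p : R) (p1 : 1 <= p).
Local Notation Lp := (delayLp p1 X).
Local Notation E := (delaySpace p1 X).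

Lemma l1prod_normE (z : E) : `|z| = `|z.1| + `|z.2|. Proof. by []. Qed.

Lemma delaySpace_complete (F : set_system E) : ProperFilter F -> cauchy F -> cvg F.
Proof.
apply: cauchy_pow2_complete => u uS.
have u1 n : `|(u n.+1).1 - (u n).1| <= 2^-1 ^+ n.
  by rewrite (le_trans _ (uS n))// l1prod_normE lerDl.
have u2 n : `|(u n.+1).2 - (u n).2| <= 2^-1 ^+ n.
  by rewrite (le_trans _ (uS n))// l1prod_normE lerDr.
have /cvg_ex[x ux] := complete_cvg_pow2 u1.
have /cvg_ex[f uf] := Lp_cvg_pow2 (delay_measure_fin R) u2.
apply/cvg_ex; exists (x, f); apply/cvgrPdist_le => e e0.
have e20 : 0 < e / 2 by rewrite divr_gt0.
move: ux uf => /cvgrPdist_le/(_ _ e20) ux /cvgrPdist_le/(_ _ e20) uf.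
apply: filterS2 ux uf => n ux uf.
by rewrite l1prod_normE (splitr e) lerD.
Qed.

Definition segment (k : R -> X) (s : R) : Lp := delay_toLp p1 (fun t => k (s + t)).

Lemma shift_continuous (k : R -> X) (s : R) : continuous k ->
  continuous (fun t => k (s + t)).
Proof.
move=> ck t; apply: continuous_comp; last exact: ck.
by apply: cvgD; [exact: cvg_cst|exact: cvg_id].
Qed.

Lemma segmentB (k l : R -> X) (s t : R) : continuous k -> continuous l ->
  segment k s - segment l t = delay_toLp p1 (fun r => k (s + r) - l (t + r)).
Proof.
move=> ck cl; rewrite -(delay_toLpB p1 (memLp_curve p1 (@shift_continuous k s ck))
  (memLp_curve p1 (@shift_continuous l t cl))); reflexivity.
Qed.

Lemma segment_continuous (k : R -> X) : continuous k -> continuous (segment k).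
Proof.
move=> ck s; apply/cvgrPdist_le => e e0.
have [d d0 Hd] := continuous_uniform (s - 2) (s + 2) ck e0.
near=> r.
have rd : `|s - r| <= d.
  by near: r; apply: cvgr_dist_le => //; exact: cvg_id.
have r1 : `|s - r| <= 1.
  by near: r; apply: cvgr_dist_le => //; exact: cvg_id.
have cd : continuous (fun t => k (s + t) - k (r + t)).
  by move=> t; apply: cvgB; exact: shift_continuous.
rewrite segmentB//; apply: delay_norm_le => //; first exact: strongly_measurable_curve.
  exact: ltW.
move=> t; rewrite in_itv/= => /andP[t1 t0].
move: r1; rewrite ler_distl => /andP[r1 r2].
apply: Hd; [by apply/andP; split; lra|by apply/andP; split; lra|].
by rewrite opprD addrACA subrr addr0.
Unshelve. all: by end_near. Qed.

(** The mean value inequality holds uniformly over the history, and the uniform norm dominates the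
    p-norm since [[-1, 0]] has measure 1. *)
Lemma segment_increment (k k' : R -> X) (s e : R) : right_C1 k k' -> 0 < e ->
  \forall h \near 0^'+,
    `|segment k (s + h) - segment k s - h *: segment k' s| <= e * h.
Proof.
move=> kk e0; have [ck ck' _] := kk.
(* The window contains all [s + t] and [s + h + t] with t in [[-1, 0]] and [h <= 1]. *)
have [d d0 Hd] := continuous_uniform (s - 2) (s + 2) ck' e0.
near=> h.
have h0 : 0 < h by near: h; exact: nbhs_right_gt.
have h1 : h <= 1 by near: h; apply: nbhs_right_le.
have hd : h <= d by near: h; apply: nbhs_right_le.
have cg : continuous (fun r => k (s + h + r) - k (s + r)).
  by move=> t; apply: cvgB; exact: shift_continuous.
have cc := @shift_continuous k' s ck'.
have cd : continuous (fun r => - h *: k' (s + r) + (k (s + h + r) - k (s + r))).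
  by move=> t; apply: cvgD; [apply: cvgZl_tmp; exact: cc|exact: cg].
rewrite segmentB// addrC -scaleNr.
rewrite -(delay_toLp_lin p1 (- h) (memLp_curve p1 cc) (memLp_curve p1 cg)).
apply: delay_norm_le; [exact: strongly_measurable_curve|by rewrite mulr_ge0 ?ltW|].
move=> t; rewrite in_itv/= scaleNr (addrC (- (h *: _))) => /andP[t1 t0].
have := @right_C1_mean _ _ k k' (s + t) (s + h + t) (k' (s + t)) e kk.
have -> : s + h + t - (s + t) = h by lra.
apply; first by lra.
move=> r sr rs; apply: Hd; [by apply/andP; split; lra..|].
by rewrite ger0_norm; lra.
Unshelve. all: by end_near. Qed.

Lemma derivative_segment (k k' : R -> X) (s : R) : right_C1 k k' ->
  W1p (segment k s) /\ derivative (segment k s) = segment k' s.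
Proof. by move=> kk; exact: derivative_right_C1 (right_C1_shift s kk). Qed.

(** [Phi] is bounded only in the Sobolev norm, so the segments of [k'] must vary continuously too;
    this is what makes C^1 curves the right test objects. *)
Lemma W1p_segment_continuous (Phi : Lp -> X) (k k' : R -> X) :
  W1p_bounded_linear Phi -> right_C1 k k' ->
  continuous (fun s => Phi (segment k s)).
Proof.
move=> [lP [M PM]] kk s; have [ck ck' _] := kk.
have PB r : `|Phi (segment k s) - Phi (segment k r)| <=
    `|M| * (`|segment k s - segment k r| + `|segment k' s - segment k' r|).
  have [Ws _] := derivative_segment s kk; have [Wr _] := derivative_segment r kk.
  have := lP (-1) _ _ Wr Ws; rewrite !scaleN1r ![- _ + _]addrC => <-.
  have [Wd dd] := derivative_right_C1 p1 (right_C1B (right_C1_shift s kk) (right_C1_shift r kk)).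
  rewrite (segmentB _ _ ck ck) (segmentB _ _ ck' ck').
  rewrite (le_trans (PM _ Wd))// /W1p_norm dd ler_wpM2r ?ler_norm//.
apply/cvgrPdist_le => e e0.
have M1 : 0 < `|M| + 1 by rewrite ltr_wpDl.
have d0 : 0 < e / 2 / (`|M| + 1) by rewrite divr_gt0// divr_gt0.
have /cvgrPdist_le/(_ _ d0) h1 := @segment_continuous k ck s.
have /cvgrPdist_le/(_ _ d0) h2 := @segment_continuous k' ck' s.
apply: filterS2 h1 h2 => r h1 h2; rewrite (le_trans (PB r))//.
rewrite (le_trans (ler_wpM2l _ (lerD h1 h2)))//.
set c := e / 2 / (`|M| + 1).
have -> : `|M| * (c + c) = e * (`|M| / (`|M| + 1)) by rewrite /c; field; rewrite gt_eqF.
by rewrite ler_piMr ?(ltW e0)// ler_pdivrMr// mul1r lerDl.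
Qed.

End DelaySpace.

Section Mild.
Context (R : realType) (X : completeNormedModType R) (p : R) (p1 : 1 <= p).
Context (S : R -> X -> X) (cS : c0_semigroup S) (D : set X) (A : X -> X).
Hypothesis gS : is_generator S D A.
Local Notation Lp := (delayLp p1 X).
Local Notation E := (delaySpace p1 X).
Local Notation segment := (segment p1).

(* The states of such a curve are the orbits of the semigroup generated by [A]
   and [d/dt] without the perturbation [Phi]. *)
Definition mild (k k' : R -> X) :=
  [/\ right_C1 k k', D (k 0) & forall t, 0 <= t -> k t = S t (k 0)].

Definition state (k : R -> X) (s : R) : E := (k s, segment k s).

Lemma state_continuous (k : R -> X) : continuous k -> continuous (state k).
Proof.
move=> ck s; apply/cvgrPdist_le => e e0.
have e20 : 0 < e / 2 by rewrite divr_gt0.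
have /cvgrPdist_le/(_ _ e20) h1 := ck s.
have /cvgrPdist_le/(_ _ e20) h2 := @segment_continuous _ _ _ p1 k ck s.
apply: filterS2 h1 h2 => r h1 h2.
by rewrite l1prod_normE (splitr e) lerD.
Qed.

Lemma state_increment (k k' : R -> X) (s e : R) : right_C1 k k' -> 0 < e ->
  \forall h \near 0^'+, `|state k (s + h) - state k s - h *: state k' s| <= e * h.
Proof.
move=> kk e0; have e20 : 0 < e / 2 by rewrite divr_gt0.
have [_ _ dk] := kk.
have := right_derivative_le e20 (dk s).
apply: filterS2 (segment_increment p1 s kk e20) => h h1 h2.
by rewrite l1prod_normE (splitr e) mulrDl lerD.
Qed.

Section Curve.
Context (k k' : R -> X) (mk : mild k k').

Lemma mild_orbit (s : R) : 0 <= s -> D (k s) /\ A (k s) = k' s.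
Proof.
move=> s0; have [[_ _ dk] D0 kS] := mk.
have [DS AS] := generator_invariant cS gS s0 D0; rewrite (kS _ s0); split=> //.
rewrite AS; apply: cvg_unique (dk s); first exact: norm_hausdorff.
apply: cvg_trans (generator_orbit cS gS s0 D0); apply: near_eq_cvg; near=> h.
have sh0 : 0 <= s + h by rewrite addr_ge0.
by rewrite (kS _ sh0) (kS _ s0).
Unshelve. all: by end_near. Qed.

Lemma state_domain (s : R) : 0 <= s -> delay_domain D (state k s).
Proof.
move=> s0; have [kk D0 kS] := mk; have [ck _ _] := kk; split.
- by case: (mild_orbit s0).
- by case: (derivative_segment p1 s kk).
- have cs := @shift_continuous _ _ k s ck.
  exists (fun t => k (s + t)); split; last by rewrite addr0.
    exact: continuous_subspaceT.
  exact: (delay_toLp_ae p1 (memLp_curve p1 cs)).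
Qed.

Lemma state_operator (Phi : Lp -> X) (s : R) : 0 <= s ->
  delay_operator A Phi (state k s) = state k' s + ((Phi (segment k s), 0) : E).
Proof.
move=> s0; have [kk _ _] := mk; have [_ Ak] := mild_orbit s0.
have [_ dk] := derivative_segment p1 s kk.
by rewrite /delay_operator /= Ak dk; congr (_, _); rewrite /= addr0.
Qed.

(** Identifies the argument of [Phi] in the integral condition with the history of the curve at time
    s. *)
Lemma segment_decomp (s : R) : 0 <= s ->
  history p1 S s (k 0) + nilpotent_shift s (segment k 0) = segment k s.
Proof.
move=> s0; have [[ck _ _] D0 kS] := mk.
have [M M0 SM] := c0_locally_bounded s (@cauchy_cvg X) cS.
have -> : segment k 0 = delay_toLp p1 k.
  by congr delay_toLp; apply/funext => t; rewrite add0r.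
have [-> ms] := nilpotent_shiftE p1 s0 ck.
have mh := memLp_hist p1 cS M0 SM (k 0) s0 (lexx s).
have cs := @shift_continuous _ _ k s ck.
rewrite /history (delay_toLpE p1 mh) -(toLpD p1 mh ms) /segment.
rewrite (delay_toLpE p1 (memLp_curve p1 cs)).
congr toLp; apply/funext => t.
have [st|st] := ltP (- s) t.
  have st0 : 0 < s + t by lra.
  by rewrite leNgt st0/= addr0 [RHS](kS _ (ltW st0)).
by rewrite add0r ifT//; lra.
Qed.

(** In [2 M + 1], one [M] bounds the value at s, the other its history since time 0, and 1 the
    shifted initial history. *)
Lemma state_bound (M b s : R) : 0 < M ->
  (forall t, 0 <= t <= b -> forall x, `|S t x| <= M * `|x|) -> 0 <= s -> s <= b ->
  `|state k s| <= (2 * M + 1) * `|state k 0|.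
Proof.
move=> M0 SM s0 sb; have [_ D0 kS] := mk.
rewrite !l1prod_normE /= -(segment_decomp s0) (kS _ s0).
have h1 := SM s _ (k 0); have {}h1 := h1 (introT andP (conj s0 sb)).
have h2 := history_norm p1 cS M0 SM (k 0) s0 sb.
have h3 := nilpotent_shift_norm (segment k 0) s0.
rewrite (le_trans (lerD h1 (ler_normD _ _)))//.
rewrite (le_trans (lerD (lexx _) (lerD h2 h3)))//.
rewrite mulrDl mul1r mulrDr.
have := normr_ge0 (k 0); have := normr_ge0 (segment k 0).
move: (`|segment k 0|) => f f0 x0.
have : 0 <= M * f by rewrite mulr_ge0// ltW.
by lra.
Qed.

End Curve.

Lemma mild_shift (k k' : R -> X) (s : R) : 0 <= s -> mild k k' ->
  mild (fun t => k (s + t)) (fun t => k' (s + t)).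
Proof.
move=> s0 mk; have [kk D0 kS] := mk; split.
- exact: right_C1_shift.
- by rewrite addr0; case: (mild_orbit mk s0).
- move=> t t0; rewrite addr0 (kS _ s0) (kS _ (addr_ge0 s0 t0)).
  by rewrite addrC (c0_add cS).
Qed.

Lemma state_shift (k : R -> X) (s t : R) :
  state (fun r => k (s + r)) t = state k (s + t).
Proof.
congr (_, _); congr delay_toLp; apply/funext => r; rewrite addrA//.
Qed.

(** An orbit starting in the domain near [z.1] is continued to negative times by its tangent line,
    which makes it C^1; a curve that vanishes from time 0 on then corrects the history. *)
Lemma mild_dense (z : E) (e : R) : 0 < e ->
  exists k k', mild k k' /\ `|z - state k 0| <= e.
Proof.
move=> e0; have e20 : 0 < e / 2 by rewrite divr_gt0.
have [x Dx zx] := generator_dense cS gS z.1 e20.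
pose k0 (t : R) := S (Num.max t 0) x + Num.min t 0 *: A x.
pose k0' (t : R) := S (Num.max t 0) (A x).
have cmin : continuous (fun t : R => Num.min t 0).
  by move=> t; apply: continuous_min; [exact: cvg_id|exact: cvg_cst].
have kk0 : right_C1 k0 k0'.
  split.
  - move=> t; apply: cvgD; first exact: (@c0_max_continuous _ _ _ cS x).
    by apply: cvgZr_tmp; exact: cmin.
  - exact: c0_max_continuous.
  - move=> t; have [t0|t0] := leP 0 t.
      rewrite /k0' max_l//.
      apply: cvg_trans (generator_orbit cS gS t0 Dx); apply: near_eq_cvg; near=> h.
      have h0 : 0 < h by near: h; exact: nbhs_right_gt.
      have th0 : 0 <= t + h by rewrite addr_ge0// ltW.
      by rewrite /k0 !max_l// !min_r// !scale0r !addr0.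
    rewrite /k0' max_r ?ltW// (c0_id cS).
    apply: cvg_near_cst; near=> h.
    have h0 : 0 < h by near: h; exact: nbhs_right_gt.
    have th0 : t + h <= 0.
      by rewrite -lerBrDl; near: h; apply: nbhs_right_le; rewrite sub0r oppr_gt0.
    rewrite /k0 !max_r ?(ltW t0)// !min_l ?(ltW t0)// opprD addrACA subrr add0r.
    by rewrite -scalerBl (addrC t) addrK scalerA mulVf ?scale1r// gt_eqF.
have [ck0 _ _] := kk0.
have [f [f' [[ff f0] zf]]] := approximableT (z.2 - delay_toLp p1 k0) e20.
have [cf _ _] := ff.
have f00 : f 0 = 0 by case: (f0 0 (lexx 0)).
have k00 : k0 0 = x by rewrite /k0 maxxx minxx scale0r addr0 (c0_id cS).
exists (k0 \+ f), (k0' \+ f'); split.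
  split; [exact: right_C1D|by rewrite /= k00 f00 addr0|].
  move=> t t0; rewrite /=; have [-> _] := f0 t t0.
  by rewrite k00 f00 !addr0 /k0 max_l// min_r// scale0r addr0.
rewrite l1prod_normE (splitr e) lerD//=; first by rewrite k00 f00 addr0.
have -> : segment (k0 \+ f) 0 = delay_toLp p1 (fun t => 1 *: f t + k0 t).
  by congr delay_toLp; apply/funext => t; rewrite add0r scale1r addrC.
rewrite (delay_toLp_lin p1 1 (memLp_curve p1 cf) (memLp_curve p1 ck0)) scale1r.
by rewrite (addrC (delay_toLp p1 f)) opprD addrA.
Unshelve. all: by end_near. Qed.

End Mild.

(** * The Duhamel estimate *)

(** Turns the extended real integral of the integral condition into a real function that can serve
    as a majorant in [increment_bound]. *)
Lemma nonneg_antiderivative (R : realType) (g : R -> R) (b : R) : continuous g ->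
  (forall s, 0 <= g s) -> 0 <= b ->
  exists J : R -> R, [/\ J 0 = 0,
    ((J b)%:E <= \int[lebesgue_measure]_(s in `[0%R, b]) (g s)%:E)%E,
    forall s t, 0 <= s -> s <= t -> t <= b -> J s <= J t &
    forall s e, 0 <= s -> s < b -> 0 < e -> \forall h \near 0^'+,
      h * g s <= J (s + h) - J s + e * h].
Proof.
move=> cg g0 b0.
pose mu := mrestr (@lebesgue_measure R) (measurable_itv `[0, b]).
have muE A : mu A = lebesgue_measure (A `&` `[0, b]) by [].
have [J [J0 Jb incr]] := @antiderivative R R^o g 0 b cg b0 mu muE.
have mufin : (mu setT < +oo)%E.
  rewrite muE setTI lebesgue_measure_itv/= lte_fin.
  by case: ifPn => _; rewrite ?ltry// -EFinB ltry.
have muC : mu (~` `[0, b]%classic) = 0%E by rewrite muE setICl measure0.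
exists J; split => //.
- have mI : measurable (`[0, b]%classic : set (measurableTypeR R)) by exact: measurable_itv.
  have mg : measurable_fun setT (fun s : measurableTypeR R => (g s)%:E).
    by apply/measurable_EFinP; exact: continuous_measurable_fun.
  rewrite (@eq_measure_integral _ _ _ _ mu); last first.
    by move=> A mA AI; rewrite /= /mrestr setIidl.
  apply: (@le_trans _ _ (`|J b|%:E)); first by rewrite lee_fin ler_norm.
  apply: (le_trans (bochner_norm mufin Jb)).
  rewrite (@ge0_negligible_integral _ _ _ mu setT (~` `[0, b]%classic)) //.
  - rewrite setDE setTI setCK le_eqVlt; apply/orP; left; apply/eqP.
    by apply: eq_integral => s _; rewrite ger0_norm.
  - exact: measurableC.
  - by under eq_fun do rewrite ger0_norm//.
- move=> s t s0 st tb; have [C C0 HC] := continuous_bounded_itv 0 b cg.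
  (* Since g lies between 0 and C, it is within [C / 2] of [C / 2]; this forces the increment to be
     nonnegative. *)
  have := incr s t (C / 2) (C / 2) s0 st tb.
  have H r : s <= r -> r <= t -> `|g r - C / 2| <= C / 2.
    move=> sr rt; have r0b : 0 <= r <= b by rewrite (le_trans s0 sr) (le_trans rt tb).
    have := HC r r0b; rewrite ger0_norm// => gC.
    by have := g0 r; rewrite ler_norml; lra.
  move=> /(_ H); rewrite ler_norml => /andP[H1 _].
  have -> : J s <= J t = (0 <= J t - J s) by rewrite subr_ge0.
  by move: H1; rewrite [_ *: _]mulrC; lra.
- move=> s e s0 sb e0; have e0' := right_derivative_le e0 (increments_right cg incr s0 sb).
  apply: filterS e0' => h H; have {}H : `|J (s + h) - J s - h * g s : R| <= e * h by exact: H.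
  by move: H; rewrite ler_norml => /andP[]; lra.
Qed.

Section Duhamel.
Context (R : realType) (X : completeNormedModType R) (p : R) (p1 : 1 <= p).
Context (S : R -> X -> X) (cS : c0_semigroup S) (D : set X) (A : X -> X).
Hypothesis gS : is_generator S D A.
Local Notation Lp := (delayLp p1 X).
Local Notation E := (delaySpace p1 X).
Local Notation segment := (segment p1).
Local Notation state := (state p1).
Local Notation mild := (mild S D).
Context (Phi : Lp -> X) (PhiB : W1p_bounded_linear Phi) (q : R -> R).
Hypothesis Hq : forall (t : R) (z : E), 0 < t -> delay_domain D z ->
  (\int[lebesgue_measure]_(s in `[0%R, t])
     (`|Phi (history p1 S s z.1 + nilpotent_shift s z.2)|%:E) <= (q t * `|z|)%:E)%E.
Context (T : R -> E -> E) (cT : c0_semigroup T).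
Hypothesis gT : is_generator T (delay_domain D) (delay_operator A Phi).

(* [s |-> Q (T (c - s) (state k s))] has right derivative
   [- Q (T (c - s) (Phi (segment k s), 0))]. *)
Lemma duhamel_bound (k k' : R -> X) (Q : E -> E) (t c b C W : R) : mild k k' ->
  0 < t -> t <= c -> t <= b -> linear Q -> 0 <= C ->
  (forall v, `|Q v| <= C * `|v|) -> 0 <= W ->
  (forall r, c - t <= r -> r <= c -> forall y : X, `|Q (T r ((y, 0) : E))| <= W * `|y|) ->
  `|Q (T (c - t) (state k t)) - Q (T c (state k 0))| <= W * (q b * `|state k 0|).
Proof.
move=> mk t0 tc tb lQ C0 QC W0 QW.
have [kk _ _] := mk; have [ck _ _] := kk.
have c0 : 0 < c by apply: lt_le_trans tc.
have b0 : 0 < b by apply: lt_le_trans tb.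
have [M M0 TM] := c0_locally_bounded c (@delaySpace_complete _ _ _ p1) cT.
pose g s := `|Phi (segment k s)|.
have cg : continuous g.
  by move=> s; apply: cvg_norm; exact: (W1p_segment_continuous PhiB kk).
have g0 s : 0 <= g s by exact: normr_ge0.
have [J [J0 Jb Jm Ji]] := nonneg_antiderivative cg g0 (ltW b0).
have {}Jb : J b <= q b * `|state k 0|.
  rewrite -lee_fin (le_trans Jb)// (le_trans _ (Hq b0 (state_domain p1 cS gS mk (lexx 0))))//.
  rewrite le_eqVlt; apply/orP; left; apply/eqP; apply: eq_integral => s.
  rewrite inE/= in_itv/= => /andP[s0 _].
  by rewrite /g -(segment_decomp p1 cS mk s0).
pose F s := Q (T (c - s) (state k s)).
have QTM r v : 0 <= r -> r <= c -> `|Q (T r v)| <= C * M * `|v|.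
  move=> r0 rc; rewrite (le_trans (QC _))// -mulrA ler_wpM2l// TM//.
  by rewrite r0.
have lQT r : 0 <= r -> linear (Q \o T r).
  by move=> r0 a u v /=; rewrite (c0_linear cT r0) lQ.
have cst := @state_continuous _ _ _ p1 k ck.
suff : `|F t - F 0| <= W * J t - W * J 0.
  rewrite /F subr0 J0 mulr0 subr0 => /le_trans; apply.
  by rewrite ler_wpM2l// (le_trans _ Jb)// Jm// ltW.
apply: (@increment_bound _ _ F (fun s => W * J s) 0 t (ltW t0)).
(* Left continuity. As [T] is only strongly continuous, the change of time is tested on the fixed
   state at s, and the change of state is absorbed by the uniform bound. *)
- move=> s s0 st; apply/cvgrPdist_le => e e0.
  have e20 : 0 < e / 2 / (C * M + 1).
    by rewrite divr_gt0 ?divr_gt0// ltr_wpDl// mulr_ge0// ltW.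
  have e30 : 0 < e / 2 / (C + 1) by rewrite divr_gt0 ?divr_gt0// ltr_wpDl.
  have h1 := cvg_at_left_filter (cst s).
  have h2 : T (Num.max (c - r) 0) (state k s) @[r --> s^'-] --> T (Num.max (c - s) 0) (state k s).
    apply: cvg_at_left_filter.
    apply: (@continuous_comp _ _ _ (fun r : R => c - r) (fun r => T (Num.max r 0) (state k s))).
      by apply: cvgB; [exact: cvg_cst|exact: cvg_id].
    exact: c0_max_continuous.
  have cs0 : 0 <= c - s by rewrite subr_ge0 (le_trans st).
  near=> r.
  have rs : r <= s by near: r; exact: nbhs_left_le.
  have r0 : 0 <= r by near: r; exact: nbhs_left_ge.
  have cr0 : 0 <= c - r by rewrite subr_ge0 (le_trans rs)// (le_trans st).
  have d1 : `|state k s - state k r| <= e / 2 / (C * M + 1).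
    by near: r; move/cvgrPdist_le : h1; exact.
  have d2 : `|T (c - s) (state k s) - T (c - r) (state k s)| <= e / 2 / (C + 1).
    rewrite -(max_l cs0) -(max_l cr0).
    by near: r; move/cvgrPdist_le : h2; exact.
  have -> : F s - F r = Q (T (c - s) (state k s) - T (c - r) (state k s)) +
      (Q \o T (c - r)) (state k s - state k r).
    by rewrite (linB (lQT _ cr0)) (linB lQ) /= addrA subrK.
  rewrite (le_trans (ler_normD _ _))// (splitr e) lerD//.
    rewrite (le_trans (QC _))// (le_trans (ler_wpM2l C0 d2))//.
    by rewrite mulrCA ler_piMr ?divr_ge0 ?(ltW e0)// ler_pdivrMr ?mul1r ?lerDl// ltr_wpDl.
  rewrite (le_trans (QTM _ _ cr0 _))//; first by rewrite gerBl.
  have CM0 : 0 <= C * M by rewrite mulr_ge0// ltW.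
  rewrite (le_trans (ler_wpM2l CM0 d1))//.
  by rewrite mulrCA ler_piMr ?divr_ge0 ?(ltW e0)// ler_pdivrMr ?mul1r ?lerDl// ltr_wpDl.
- by move=> r s r0 rs st; rewrite ler_wpM2l// Jm// (le_trans st).
- move=> s e s0 st e0.
  have CM0 : 0 <= C * M by rewrite mulr_ge0// ltW.
  pose e1 := e / 4 / (C * M + 1); pose e2 := e / 2 / (W + 1).
  have e10 : 0 < e1 by rewrite divr_gt0 ?divr_gt0// ltr_wpDl.
  have e20 : 0 < e2 by rewrite divr_gt0 ?divr_gt0// ltr_wpDl.
  have n1 := state_increment p1 s kk e10.
  have Ds := state_domain p1 cS gS mk s0.
  have n2 := @right_derivative_le _ _ (T ^~ (state k s)) 0 _ _ e10
    (generator_orbit cT gT (lexx 0) Ds).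
  have n3 := Ji s e2 s0 (lt_le_trans st tb) e20.
  near=> h.
  have h0 : 0 < h by near: h; exact: nbhs_right_gt.
  have ht : s + h <= t.
    by rewrite -lerBrDl; near: h; apply: nbhs_right_le; rewrite subr_gt0.
  have d1 : `|state k (s + h) - state k s - h *: state k' s| <= e1 * h by near: h.
  have d2 : `|T (0 + h) (state k s) - T 0 (state k s) -
     h *: T 0 (delay_operator A Phi (state k s))| <= e1 * h by near: h.
  have d3 : h * g s <= J (s + h) - J s + e2 * h by near: h.
  rewrite add0r (c0_id cT) /= (state_operator cS gS mk Phi s0) in d2.
  have r0 : 0 <= c - (s + h) by rewrite subr_ge0 (le_trans ht).
  have rc : c - (s + h) <= c by rewrite gerBl addr_ge0// ltW.
  have lL := lQT _ r0.
  pose L := Q \o T (c - (s + h)).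
  pose u : E := (Phi (segment k s), 0).
  pose v1 := state k (s + h) - state k s - h *: state k' s.
  pose v2 := T h (state k s) - state k s - h *: (state k' s + u).
  (* [v1] and [v2] are the first-order remainders of the curve and of [T]. Their terms in
     [state k' s] cancel, so only the perturbation [u] survives at first order. *)
  have -> : F (s + h) - F s = L v1 - (L v2 + h *: L u).
    have -> : F s = L (T h (state k s)).
      rewrite /F /L /= -[T _ (T h _)]/((T (c - (s + h)) \o T h) _) -(c0_add cT r0 (ltW h0)).
      by congr (Q (T _ _)); rewrite opprD addrA subrK.
    rewrite -(linZ lL) -(linD lL) -/L -[F (s + h)]/(L _) -!(linB lL).
    congr (L _).
    have -> : v1 = state k (s + h) - T h (state k s) + (v2 + h *: u).
      by rewrite /v1 /v2 scalerDr opprD !addrA !subrK.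
    by rewrite addrK.
  have b1 : `|L v1| <= C * M * (e1 * h).
    by rewrite (le_trans (QTM _ _ r0 rc))// ler_wpM2l.
  have b2 : `|L v2| <= C * M * (e1 * h).
    by rewrite (le_trans (QTM _ _ r0 rc))// ler_wpM2l.
  have b3 : `|h *: L u| <= W * (h * g s).
    rewrite normrZ gtr0_norm// mulrCA ler_pM2l//.
    by apply: QW => //; rewrite lerD2l lerN2.
  rewrite (le_trans (ler_normB _ _))// (le_trans (lerD b1 (le_trans (ler_normD _ _) (lerD b2 b3))))//.
  have b4 := ler_wpM2l W0 d3.
  have b5 : C * M * (e1 * h) <= e / 4 * h.
    rewrite mulrA ler_pM2r// /e1 mulrCA ler_piMr ?divr_ge0 ?(ltW e0)//.
    by rewrite ler_pdivrMr ?mul1r ?lerDl// ltr_wpDl.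
  have b6 : W * (e2 * h) <= e / 2 * h.
    rewrite mulrA ler_pM2r// /e2 mulrCA ler_piMr ?divr_ge0 ?(ltW e0)//.
    by rewrite ler_pdivrMr ?mul1r ?lerDl// ltr_wpDl.
  rewrite mulrDr mulrBr in b4.
  by move: b4 b5 b6; clear; lra.
Unshelve. all: by end_near. Qed.

End Duhamel.

(** * Norm continuity *)

Lemma opnorm_continuous_right (R : realType) (V : normedModType R) (S : R -> V -> V) :
  c0_semigroup S -> immediately_norm_continuous S ->
  forall d e, 0 < d -> 0 < e -> exists2 eta, 0 < eta &
    forall h, 0 < h -> h < eta -> forall x, `|S (d + h) x - S d x| <= e * `|x|.
Proof.
move=> cS SN d e d0 e0.
have := SN d; rewrite /= in_itv/= andbT => /(_ d0)/cvgr0Pnorm_le/(_ _ e0).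
rewrite near_withinE => /nbhs_ballP[eta /= eta0 H]; exists eta => // h h0 he x.
have dh0 : 0 <= d + h by rewrite addr_ge0// ltW.
have lS : linear (S (d + h) \- S d).
  move=> a u v /=; rewrite (c0_linear cS dh0) (c0_linear cS (ltW d0)).
  by rewrite opprD addrACA scalerBr.
have [M1 _ H1] := linear_continuous_bound (c0_linear cS dh0) (c0_bounded cS dh0).
have [M2 _ H2] := linear_continuous_bound (c0_linear cS (ltW d0)) (c0_bounded cS (ltW d0)).
have HM v : `|(S (d + h) \- S d) v| <= (M1 + M2) * `|v|.
  by rewrite (le_trans (ler_normB _ _))// mulrDl lerD.
rewrite (le_trans (opnorm_ge x lS HM))// ler_wpM2r// (le_trans (ler_norm _))//.
apply: H; rewrite /= ?in_itv/= ?andbT ?addr_gt0//.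
by rewrite /ball/= opprD addrA subrr sub0r normrN gtr0_norm.
Qed.

Section NormContinuity.
Context (R : realType) (X : completeNormedModType R) (p : R) (p1 : 1 <= p).
Context (S : R -> X -> X) (cS : c0_semigroup S) (D : set X) (A : X -> X).
Hypothesis gS : is_generator S D A.
Local Notation Lp := (delayLp p1 X).
Local Notation E := (delaySpace p1 X).
Local Notation segment := (segment p1).
Local Notation state := (state p1).
Local Notation mild := (mild S D).
Context (Phi : Lp -> X) (PhiB : W1p_bounded_linear Phi) (q : R -> R).
Hypothesis q0 : forall t, 0 <= t -> 0 <= q t.
Hypothesis qcvg : q t @[t --> 0^'+] --> (0 : R).
Hypothesis Hq : forall (t : R) (z : E), 0 < t -> delay_domain D z ->
  (\int[lebesgue_measure]_(s in `[0%R, t])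
     (`|Phi (history p1 S s z.1 + nilpotent_shift s z.2)|%:E) <= (q t * `|z|)%:E)%E.
Context (T : R -> E -> E) (cT : c0_semigroup T).
Hypothesis gT : is_generator T (delay_domain D) (delay_operator A Phi).
Hypothesis SN : forall d e, 0 < d -> 0 < e -> exists2 eta, 0 < eta &
    forall h, 0 < h -> h < eta -> forall x, `|S (d + h) x - S d x| <= e * `|x|.
(** The horizon 3 leaves room for all times [a + h] and [d + h] with a, d and h at most 1. *)
Context (M N : R) (M0 : 0 < M) (N0 : 0 < N).
Hypothesis SM : forall t, 0 <= t <= 3 -> forall x, `|S t x| <= M * `|x|.
Hypothesis TN : forall t, 0 <= t <= 3 -> forall z, `|T t z| <= N * `|z|.

Lemma mild_orbit_bound (k k' : R -> X) (t : R) : mild k k' -> 0 < t -> t <= 3 ->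
  `|state k t - T t (state k 0)| <= N * (q t * `|state k 0|).
Proof.
move=> mk t0 t3.
have := @duhamel_bound _ _ _ p1 _ cS _ _ gS _ PhiB _ Hq _ cT gT k k' id t t t 1 N mk
  t0 (lexx t) (lexx t) _ ler01 _ (ltW N0) _.
rewrite subrr (c0_id cT); apply => //.
- by move=> v; rewrite mul1r.
- move=> r r0 rt y; rewrite (le_trans (TN _ _))//.
    by rewrite r0 (le_trans rt).
  by rewrite l1prod_normE /= normr0 addr0.
Qed.

Lemma shift_orbit_bound (k k' : R -> X) (a t : R) : mild k k' -> 0 <= a -> 0 < t -> t <= 3 ->
  `|state k (a + t) - T t (state k a)| <= N * (q t * `|state k a|).
Proof.
move=> mk a0 t0 t3.
have := mild_orbit_bound (mild_shift cS gS a0 mk) t0 t3.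
by rewrite !state_shift addr0.
Qed.

(** A limsup bound as h tends to 0 for the increments at [d] restricted to X x {0}; [c] is the
    constant that the iteration improves. *)
Definition small_increments (d c : R) := forall e : R, 0 < e -> exists2 eta, 0 < eta &
  forall h, 0 < h -> h < eta -> forall y : X,
    `|T (d + h) ((y, 0) : E) - T d ((y, 0) : E)| <= (c + e) * `|y|.

Let K := 2 * M + 1.

(* With [Q := T h - id], the Duhamel formula on [0, a - d] involves [Q (T r)] only
   for [r >= d], where it is controlled by [W]; on the remaining interval of
   length [d] the perturbation is at most of order [q d]. *)
Lemma increment_mild (k k' : R -> X) (a d h W : R) : mild k k' ->
  0 < d -> d < a -> a <= 1 -> 0 < h -> h <= 1 -> 0 <= W ->
  (forall y : X, `|T (d + h) ((y, 0) : E) - T d ((y, 0) : E)| <= W * `|y|) ->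
  `|T (a + h) (state k 0) - T a (state k 0)| <=
  (N * W * q a + N * K * (q (d + h) + q d)) * `|state k 0| +
  `|state k (a + h) - state k a|.
Proof.
move=> mk d0 da a1 h0 h1 W0 HW.
have a0 : 0 < a by apply: lt_trans da.
have Tadd s t v : 0 <= s -> 0 <= t -> T s (T t v) = T (s + t) v.
  by move=> s0 t0; rewrite (c0_add cT).
pose Q z := T h z - z.
have lQ : linear Q.
  by move=> b u v; rewrite /Q (c0_linear cT (ltW h0)) opprD addrACA scalerBr.
have QC z : `|Q z| <= (N + 1) * `|z|.
  rewrite (le_trans (ler_normB _ _))// mulrDl mul1r lerD// TN//.
  by rewrite (ltW h0)/=; lra.
have ad : 0 <= a - d by rewrite subr_ge0 ltW.
have Q1 : `|Q (T (a - (a - d)) (state k (a - d))) - Q (T a (state k 0))| <=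
    N * W * (q a * `|state k 0|).
  (* The integral condition is used on [[0, a]] and not on [[0, a - d]], so that the factor [q a]
     does not depend on [d]. *)
  apply: (@duhamel_bound _ _ _ p1 _ cS _ _ gS _ PhiB _ Hq _ cT gT k k' Q (a - d) a a (N + 1)) => //.
  - by rewrite subr_gt0.
  - by rewrite gerBl ltW.
  - by rewrite gerBl ltW.
  - by rewrite addr_ge0// ltW.
  - by rewrite mulr_ge0// ltW.
  - move=> r dr ra y; have {}dr : d <= r by move: dr; rewrite opprB addrCA subrr addr0.
    have rd : 0 <= r - d by rewrite subr_ge0.
    have -> : Q (T r ((y, 0) : E)) = T (r - d) (T (d + h) ((y, 0) : E) - T d ((y, 0) : E)).
      have dh0 : 0 <= d + h by rewrite addr_ge0// ltW.
      rewrite (linB (c0_linear cT rd)) (Tadd _ _ _ rd dh0) (Tadd _ _ _ rd (ltW d0)).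
      by rewrite addrA subrK /Q (Tadd _ _ _ (ltW h0) (le_trans (ltW d0) dr)) addrC.
    rewrite (le_trans (TN _ _))//; first by rewrite rd/=; lra.
    by rewrite -mulrA ler_pM2l.
rewrite (_ : a - (a - d) = d) in Q1; last by rewrite opprB addrCA subrr addr0.
have zK : `|state k (a - d)| <= K * `|state k 0|.
  by apply: (state_bound p1 cS mk M0 SM) => //; lra.
have b1 := @shift_orbit_bound k k' (a - d) d mk ad d0 _.
have b2 := @shift_orbit_bound k k' (a - d) (d + h) mk ad (addr_gt0 d0 h0) _.
rewrite subrK in b1; rewrite addrA subrK in b2.
have {}b1 : `|state k a - T d (state k (a - d))| <= N * K * q d * `|state k 0|.
  rewrite (le_trans (b1 _))//; first by lra.
  by rewrite -!mulrA ler_pM2l// mulrCA ler_wpM2l// q0// ltW.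
have {}b2 : `|state k (a + h) - T (d + h) (state k (a - d))| <=
    N * K * q (d + h) * `|state k 0|.
  rewrite (le_trans (b2 _))//; first by lra.
  by rewrite -!mulrA ler_pM2l// mulrCA ler_wpM2l// q0// addr_ge0// ltW.
have QE : Q (T d (state k (a - d))) = T (d + h) (state k (a - d)) - T d (state k (a - d)).
  by rewrite /Q Tadd ?ltW// (addrC h).
have -> : T (a + h) (state k 0) - T a (state k 0) = Q (T a (state k 0)).
  by rewrite /Q Tadd ?ltW// (addrC h).
rewrite distrC in Q1.
rewrite -(subrK (Q (T d (state k (a - d)))) (Q (T a (state k 0)))).
rewrite (le_trans (ler_normD _ _))// mulrDl -[leRHS]addrA lerD//; first by rewrite -mulrA; exact: Q1.
rewrite QE.
set w := state k (a - d) in b1 b2 *.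
have -> : T (d + h) w - T d w = (state k (a + h) - state k a) -
    ((state k (a + h) - T (d + h) w) - (state k a - T d w)).
  move: (T (d + h) w) (T d w) (state k (a + h)) (state k a) => x1 x2 x3 x4.
  by rewrite (opprB x4) (addrC x2) addrACA [in RHS]opprD addrA subrr add0r opprD opprK.
rewrite (le_trans (ler_normB _ _))// [leRHS]addrC lerD//.
rewrite (mulrDr (N * K)) mulrDl (le_trans (ler_normB _ _))// lerD//.
Qed.

(** Passes from the dense states to all vectors. The norm of the history is kept as a separate term
    because it carries the increment of the shift, which is not small in general. *)
Lemma closed_increment (L : E -> E) (C a B : R) : linear L -> 0 <= C -> 0 <= a -> 0 <= B ->
  (forall v, `|L v| <= C * `|v|) ->
  (forall k k', mild k k' -> `|L (state k 0)| <= a * `|state k 0| + B * `|segment k 0|) ->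
  forall z, `|L z| <= a * `|z| + B * `|z.2|.
Proof.
move=> lL C0 a0 B0 LC H z; apply/ler_addgt0Pr => e e0.
have c0 : 0 < C + a + B + 1 by rewrite ltr_wpDl// !addr_ge0.
have d0 : 0 < e / (C + a + B + 1) by rewrite divr_gt0.
have [k [k' [mk zk]]] := mild_dense cS gS z d0.
have := H k k' mk; move: zk; set w := state k 0; set d := e / _ => zw Lw.
have w2 : `|segment k 0| <= `|z.2| + d.
  have : `|z.2 - w.2| <= d by rewrite (le_trans _ zw)// l1prod_normE lerDr.
  have -> : segment k 0 = z.2 - (z.2 - w.2) by rewrite opprB addrCA subrr addr0.
  by move=> H1; rewrite (le_trans (ler_normB _ _))// lerD.
have w1 : `|w| <= `|z| + d.
  have -> : w = z - (z - w) by rewrite opprB addrCA subrr addr0.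
  by rewrite (le_trans (ler_normB _ _))// lerD.
have Lz : `|L z| <= C * d + `|L w|.
  have -> : L z = L (z - w) + L w by rewrite (linB lL) subrK.
  by rewrite (le_trans (ler_normD _ _))// lerD// (le_trans (LC _))// ler_wpM2l.
have ed : e = (C + a + B + 1) * d by rewrite mulrC divfK// gt_eqF.
rewrite (le_trans Lz)//.
have h1 := ler_wpM2l a0 w1; have h2 := ler_wpM2l B0 w2.
rewrite ed; move: h1 h2 Lw; rewrite !mulrDr !mulrDl mul1r.
by have := ltW d0; rewrite -/d; lra.
Qed.

(** One pass of the iteration. The error [e] is spent in quarters: on S, on its histories, on the
    terms in [q] near [d], and on the slack in [small_increments]. [B] isolates the shift: its term
    vanishes on vectors [(y, 0)], and at [a = 1] one may take [B = 0]. *)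
Lemma increment_step (a t0 c B : R) : 0 < a -> a <= 1 -> 0 < t0 -> 0 <= c -> 0 <= B ->
  (forall d, 0 < d -> d < t0 -> small_increments d c) ->
  (forall h (f : Lp), 0 < h -> `|nilpotent_shift (a + h) f - nilpotent_shift a f| <= B * `|f|) ->
  forall e, 0 < e -> exists2 eta, 0 < eta & forall h, 0 < h -> h < eta ->
    forall z : E, `|T (a + h) z - T a z| <= (N * q a * c + e) * `|z| + B * `|z.2|.
Proof.
move=> a0 a1 t00 c0 B0 Hc HB e e0.
have qa0 : 0 <= q a by rewrite q0// ltW.
have K0 : 0 < K by rewrite /K; move: M0; lra.
have NK0 : 0 < N * K by rewrite mulr_gt0.
have Nq : 0 <= N * q a by rewrite mulr_ge0// ltW.
have e10 : 0 < e / 8 / (N * K) by rewrite divr_gt0// divr_gt0.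
have [d1 d10 qd] : exists2 d1, 0 < d1 & forall t, 0 < t -> t < d1 -> q t <= e / 8 / (N * K).
  move/cvgr0Pnorm_le : qcvg => /(_ _ e10); rewrite near_withinE => /nbhs_ballP[d1 /= d10 H].
  exists d1 => // t t0' td; rewrite (le_trans (ler_norm _))//; apply: H => //.
  by rewrite /ball/= sub0r normrN gtr0_norm.
(* The half gives [d < a] and [d < t0], and keeps [d + h] below [d1] for [h < d]. *)
pose d := Num.min (Num.min a t0) d1 / 2.
have m0 : 0 < Num.min (Num.min a t0) d1 by rewrite !lt_min a0 t00 d10.
have d0 : 0 < d by rewrite divr_gt0.
have dm : d + d = Num.min (Num.min a t0) d1 by rewrite /d; field.
have [da dt dd1] : [/\ d < a, d < t0 & d + d <= d1].
  have : d + d <= a by rewrite dm !ge_min lexx.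
  have : d + d <= t0 by rewrite dm !ge_min lexx orbT.
  have : d + d <= d1 by rewrite dm !ge_min lexx orbT.
  by move: d0 => /[swap] ? /[swap] ? /[swap] ? ?; split; lra.
have e20 : 0 < e / 4 / (N * q a + 1) by rewrite divr_gt0 ?divr_gt0// ltr_wpDl.
have [n1 n10 H1] := Hc d d0 dt _ e20.
have e40 : 0 < e / 4 by rewrite divr_gt0.
have [n2 n20 H2] := SN a0 e40.
have a3 : a < 3 by lra.
have [n3 n30 H3] := history_norm_continuous p1 cS M0 SM SN a0 a3 e40.
exists (Num.min (Num.min (Num.min n1 n2) n3) (Num.min d 1)).
  by rewrite !lt_min n10 n20 n30 d0 ltr01.
move=> h h0; rewrite !lt_min => /andP[/andP[/andP[hn1 hn2] hn3] /andP[hd h1]].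
have ah0 : 0 <= a + h by rewrite addr_ge0// ltW.
have lL : linear (fun z => T (a + h) z - T a z).
  move=> b u v; rewrite (c0_linear cT ah0) (c0_linear cT (ltW a0)).
  by rewrite opprD addrACA scalerBr.
apply: (closed_increment (C := N + N) lL) => //.
- by rewrite addr_ge0// ltW.
- by rewrite addr_ge0 ?(ltW e0)// mulr_ge0.
- move=> v; rewrite (le_trans (ler_normB _ _))// mulrDl lerD// TN//.
    by rewrite ah0/=; lra.
  by rewrite (ltW a0)/=; lra.
move=> k k' mk; have [_ _ kS] := mk.
have W0 : 0 <= c + e / 4 / (N * q a + 1) by rewrite addr_ge0// ltW.
rewrite (le_trans (increment_mild mk d0 da a1 h0 (ltW h1) W0 (H1 h h0 hn1)))//.
have s1 : `|state k (a + h) - state k a| <= e / 2 * `|k 0| + B * `|segment k 0|.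
  rewrite l1prod_normE /= (kS _ ah0) (kS _ (ltW a0)).
  rewrite -(segment_decomp p1 cS mk ah0) -(segment_decomp p1 cS mk (ltW a0)).
  rewrite opprD addrACA.
  rewrite (le_trans (lerD (H2 h h0 hn2 (k 0)) (le_trans (ler_normD _ _) (lerD (H3 h h0 hn3 (k 0)) (HB h _ h0)))))//.
  by rewrite addrA -mulrDl (_ : e / 4 + e / 4 = e / 2)//; lra.
have s2 : `|k 0| <= `|state k 0| by rewrite l1prod_normE lerDl.
have s3 : N * K * (q (d + h) + q d) <= e / 4.
  have q1 : q (d + h) <= e / 8 / (N * K) by apply: qd; [rewrite addr_gt0|lra].
  have q2 : q d <= e / 8 / (N * K) by apply: qd => //; lra.
  rewrite (le_trans (ler_wpM2l (ltW NK0) (lerD q1 q2)))// le_eqVlt.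
  by apply/orP; left; apply/eqP; field; rewrite !gt_eqF.
have s4 : N * (c + e / 4 / (N * q a + 1)) * q a <= N * q a * c + e / 4.
  rewrite mulrAC mulrDr lerD2l mulrCA ler_piMr ?(ltW e40)//.
  by rewrite ler_pdivrMr ?mul1r ?lerDl// ltr_wpDl.
have s5 := ler_wpM2l (ltW (divr_gt0 e0 (ltr0n R 2))) s2.
have s6 := ler_wpM2r (normr_ge0 (state k 0)) (lerD s4 s3).
rewrite (le_trans (lerD s6 s1))//.
rewrite addrA lerD2r.
have -> : N * q a * c + e = (N * q a * c + e / 4 + e / 4) + e / 2 by lra.
by rewrite [leRHS]mulrDl lerD2l.
Qed.

(* As [N q(d) <= 1 / 2] for small [d], [increment_step] turns the constant [c]
   into [c / 2]; iterate. *)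
Lemma small_increments_small_time : exists2 t0, 0 < t0 &
  forall d, 0 < d -> d < t0 -> small_increments d 0.
Proof.
have N20 : 0 < (2 * N)^-1 by rewrite invr_gt0 mulr_gt0.
have [t0 [t00 t01 qt]] : exists t0, [/\ 0 < t0, t0 <= 1 &
    forall t, 0 < t -> t < t0 -> q t <= (2 * N)^-1].
  move/cvgr0Pnorm_le : qcvg => /(_ _ N20); rewrite near_withinE => /nbhs_ballP[d1 /= d10 H].
  exists (Num.min d1 1); rewrite lt_min d10 ltr01 ge_min lexx orbT; split=> // t t0.
  rewrite lt_min => /andP[td _]; rewrite (le_trans (ler_norm _))//; apply: H => //.
  by rewrite /ball/= sub0r normrN gtr0_norm.
exists t0 => //.
(* The induction starts from the trivial bound [2 N]. All small [d] are treated at once, since the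
   step for one time uses the bound at still smaller times. *)
have main n : forall d, 0 < d -> d < t0 -> small_increments d (2 * N * 2^-1 ^+ n).
  elim: n => [d d0 dt e e0|n IH d d0 dt e e0].
    exists 1 => // h h0 h1 y; rewrite expr0 mulr1.
    rewrite (le_trans (ler_normB _ _))//.
    have y0 : `|(y, 0) : E| = `|y| by rewrite l1prod_normE /= normr0 addr0.
    have b1 : `|T (d + h) ((y, 0) : E)| <= N * `|y|.
      by rewrite -y0 TN//; apply/andP; split; lra.
    have b2 : `|T d ((y, 0) : E)| <= N * `|y|.
      by rewrite -y0 TN//; apply/andP; split; lra.
    rewrite (le_trans (lerD b1 b2))// -mulrDl ler_wpM2r//.
    by lra.
  have c0 : 0 <= 2 * N * 2^-1 ^+ n by rewrite !mulr_ge0 ?exprn_ge0// ltW.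
  (* The crude bound 2 is harmless: it multiplies the history, which is 0 for vectors [(y, 0)]. *)
  have HB h (f : Lp) : 0 < h ->
      `|nilpotent_shift (d + h) f - nilpotent_shift d f| <= 2 * `|f|.
    move=> h0; rewrite (le_trans (ler_normB _ _))// mulrDl mul1r.
    by rewrite lerD// nilpotent_shift_norm ?addr_ge0 ?(ltW d0) ?(ltW h0).
  have [eta eta0 H] := increment_step d0 (le_trans (ltW dt) t01) t00 c0 (ler0n R 2) IH HB e0.
  exists eta => // h h0 he y; rewrite (le_trans (H h h0 he _))//=.
  rewrite normr0 mulr0 addr0 l1prod_normE /= normr0 addr0 ler_wpM2r// lerD2r.
  rewrite exprS -[leRHS]mulrCA ler_wpM2r//.
  by rewrite (le_trans (ler_wpM2l (ltW N0) (qt d d0 dt)))// invfM mulrCA mulfV ?mulr1// gt_eqF.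
move=> d d0 dt e e0.
have : (2 * N * 2^-1 ^+ n : R) @[n --> \oo] --> (2 * N * 0 : R).
  apply: cvgMl_tmp; apply: cvg_expr.
  by rewrite ger0_norm ?invr_ge0// invf_lt1// ltr1n.
rewrite mulr0 => /cvgr0Pnorm_le.
have e20 : 0 < e / 2 by rewrite divr_gt0.
move=> /(_ _ e20) /filter_ex[n Hn].
have [eta eta0 H] := main n d d0 dt _ e20; exists eta => // h h0 he y.
rewrite (le_trans (H h h0 he y))// ler_wpM2r// add0r [leRHS](splitr e) lerD2r.
by rewrite (le_trans (ler_norm _)).
Qed.

Lemma increment_at_delay (e : R) : 0 < e -> exists2 eta, 0 < eta &
  forall h, 0 < h -> h < eta -> forall z : E, `|T (1 + h) z - T 1 z| <= e * `|z|.
Proof.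
move=> e0; have [t0 t00 Ht0] := small_increments_small_time.
have HB h (f : Lp) : 0 < h ->
    `|nilpotent_shift (1 + h) f - nilpotent_shift 1 f| <= 0 * `|f|.
  by move=> h0; rewrite !nilpotent_shift_ge1 ?subr0 ?normr0 ?mul0r// lerDl ltW.
have [eta eta0 H] := increment_step ltr01 (lexx 1) t00 (lexx 0) (lexx 0) Ht0 HB e0.
exists eta => // h h0 he z; rewrite (le_trans (H h h0 he z))//.
by rewrite mulr0 add0r mul0r addr0.
Qed.

End NormContinuity.

(** By the semigroup law an increment from u to w is [T (u - a)] applied to one at [a] with the same
    step. The bound depends only on [w - u], so increments to the left of t are covered by starting
    at the earlier time. *)
Lemma norm_continuous_from (R : realType) (V : normedModType R) (T : R -> V -> V) (a : R) :
  0 <= a -> c0_semigroup T ->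
  (forall b, exists2 M, 0 < M & forall t, 0 <= t <= b -> forall v, `|T t v| <= M * `|v|) ->
  (forall e, 0 < e -> exists2 eta, 0 < eta &
    forall h, 0 < h -> h < eta -> forall v, `|T (a + h) v - T a v| <= e * `|v|) ->
  norm_continuous_on `[a, +oo[ T.
Proof.
move=> a0 cT Tb Ta t /=; rewrite in_itv/= andbT => at_.
have [M M0 TM] := Tb (t + 1).
apply/cvgr0Pnorm_le => e e0.
have [eta eta0 H] := Ta (e / M) (divr_gt0 e0 M0).
have inc u w : a <= u -> u <= w -> u <= t + 1 -> w - u < eta ->
    forall v, `|T w v - T u v| <= e * `|v|.
  move=> au uw ut wu v.
  have [<-|uw'] := eqVneq u w; first by rewrite subrr normr0 mulr_ge0// ltW.
  have h0 : 0 < w - u by rewrite subr_gt0 lt_neqAle uw'.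
  have ua0 : 0 <= u - a by rewrite subr_ge0.
  have aw0 : 0 <= a + (w - u) by rewrite addr_ge0// ltW.
  have -> : T w v - T u v = T (u - a) (T (a + (w - u)) v - T a v).
    rewrite (linB (c0_linear cT ua0)) -[T _ (T _ v)]/((T (u - a) \o T (a + (w - u))) v).
    rewrite -[T (u - a) (T a v)]/((T (u - a) \o T a) v) -!(c0_add cT)//.
    by rewrite addrA subrK addrCA subrr addr0.
  rewrite (le_trans (TM _ _ _))//; first by rewrite ua0/=; lra.
  rewrite (le_trans (ler_wpM2l (ltW M0) (H _ h0 wu v)))//.
  by rewrite mulrA mulrCA mulfV ?mulr1// gt_eqF.
rewrite near_withinE; near=> s; rewrite /= in_itv/= andbT => as_.
have st : `|t - s| < Num.min eta 1.
  near: s; apply: cvgr_dist_lt; first exact: cvg_id.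
  by rewrite lt_min eta0 ltr01.
have Tst v : `|(T s \- T t) v| <= e * `|v|.
  move: st; rewrite lt_min /= => /andP[s1 s2].
  have [ts|st] := leP t s.
    move: s1 s2; rewrite distrC ger0_norm ?subr_ge0// => s1 s2.
    by apply: inc => //; rewrite lerDl.
  move: s1 s2; rewrite ger0_norm ?subr_ge0 ?(ltW st)// => s1 s2.
  by rewrite distrC; apply: inc => //; [exact: ltW|rewrite (le_trans (ltW st))// lerDl].
rewrite ger0_norm; last exact: opnorm_ge0 Tst.
by apply: opnorm_le => //; exact: ltW.
Unshelve. all: by end_near. Qed.

Theorem proposition5p3 (R : realType) (X : completeNormedModType R)
    (p : R) (p1 : 1 <= p)
    (S : R -> X -> X) (D : set X) (A : X -> X)
    (Phi : delayLp p1 X -> X) (q : R -> R)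
    (T : R -> delaySpace p1 X -> delaySpace p1 X) :
  c0_semigroup S -> is_generator S D A ->
  W1p_bounded_linear Phi ->
  (forall t, 0 <= t -> 0 <= q t) ->
  q t @[t --> 0^'+] --> (0 : R) ->
  (forall (t : R) (z : delaySpace p1 X), 0 < t -> delay_domain D z ->
    (\int[lebesgue_measure]_(s in `[0%R, t])
       (`|Phi (history p1 S s z.1 + nilpotent_shift s z.2)|%:E) <= (q t * `|z|)%:E)%E) ->
  c0_semigroup T -> is_generator T (delay_domain D) (delay_operator A Phi) ->
  immediately_norm_continuous S ->
  norm_continuous_on `[1, +oo[ T.
Proof.
move=> cS gS PhiB q0 qcvg Hq cT gT /(opnorm_continuous_right cS) SN.
have TB b := c0_locally_bounded b (@delaySpace_complete _ _ _ p1) cT.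
have [M M0 SM] := c0_locally_bounded 3 (@cauchy_cvg X) cS.
have [N N0 TN] := TB 3.
apply: (norm_continuous_from ler01 cT TB) => e e0.
exact: (increment_at_delay cS gS PhiB q0 qcvg Hq cT gT SN M0 N0 SM TN e0).
Qed.
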